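(* Let $f$ be a bounded simple graph parameter. Then the following are equivalent: (a) $f$ is testable. (b) For every $\varepsilon>0$ there is an integer $k$ such that for every simple graph $G$ on at least $k$ nodes, $|f(G)-\mathsf E(f(\mathbb G(k,G)))|\le\varepsilon$. (c) For every convergent sequence $(G_n)$ of simple graphs with $|V(G_n)|\to\infty$, the limit of $f(G_n)$ exists as $n\to\infty$. (d) There exists a functional $\check f(W)$ on $\mathcal W$ that is continuous in the rectangle norm $\|\cdot\|_\square$, and such that $\check f(W_G)-f(G)\to0$ if $|V(G)|\to\infty$ ($G$ simple). (e) For every $\varepsilon>0$ there is an $\varepsilon_0>0$ and a positive integer $n_0$ such that if $G_1,G_2$ are two simple graphs with $|V(G_1)|,|V(G_2)|\ge n_0$ and $\delta_\square(G_1,G_2)<\varepsilon_0$, then $|f(G_1)-f(G_2)|<\varepsilon$.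
   Context: A simple graph is a finite graph (nonempty node set) without loops or multiple edges. A simple graph parameter is a real-valued function on simple graphs invariant under isomorphism. Testability: for $k\le|V(G)|$, $\mathbb G(k,G)$ is the random induced subgraph $G[S]$, $S$ uniform among the $k$-element subsets of $V(G)$. $f$ is testable if for every $\varepsilon>0$ there is a positive integer $k$ such that if $G$ is a simple graph with at least $k$ nodes, then from $\mathbb G(k,G)$ one can compute an estimate $\widetilde f$ (a function of $\mathbb G(k,G)$) with $\Pr(|f(G)-\widetilde f|>\varepsilon)\le\varepsilon$. (One can always use $\widetilde f=f(\mathbb G(k,G))$.) Convergence: $t(F,G)=\hom(F,G)/|V(G)|^{|V(F)|}$, with $\hom(F,G)$ the number of adjacency-preserving maps $V(F)\to V(G)$; $(G_n)$ is convergent if $t(F,G_n)$ converges for every simple graph $F$. Graphons: $\mathcal W$ is the space of bounded measurable symmetric functions $W:[0,1]^2\to\mathbb R$. The rectangle (cut) norm is $\|W\|_\square=\sup_{S,T}|\int_{S\times T}W(x,y)\,dx\,dy|$ over measurable $S,T\subseteq[0,1]$. For a simple graph $G$ with nodes labeled $1,\dots,n$, split $[0,1]$ into consecutive intervals $I_1,\dots,I_n$ of length $1/n$; $W_G(x,y)=1$ if $x\in I_i$, $y\in I_j$ with $ij\in E(G)$, and $W_G(x,y)=0$ otherwise. (In (d) the assertion holds for labeled graphs $G$, for any labeling.) Cut distance of simple graphs: let $G,G'$ be simple graphs with $n,n'$ nodes and adjacency matrices $\beta,\beta'$. A fractional overlay is a nonnegative $n\times n'$ matrix $X$ with all row sums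 $1/n$ and all column sums $1/n'$. Then $$\delta_\square(G,G')=\min_X\max_{S,T\subseteq[n]\times[n']}\Bigl|\sum_{(i,u)\in S,\,(j,v)\in T}X_{iu}X_{jv}(\beta_{ij}-\beta'_{uv})\Bigr|,$$ the minimum over all fractional overlays $X$. *)

(* Defs.v *)
From mathcomp Require Import all_boot all_order all_algebra.
From mathcomp Require Import all_classical all_reals all_analysis.
From mathcomp Require Import measurable_realfun.

Set Implicit Arguments.
Unset Strict Implicit.
Unset Printing Implicit Defensive.

Import Order.TTheory GRing.Theory Num.Theory.
Import numFieldNormedType.Exports.

Local Open Scope classical_set_scope.
Local Open Scope ring_scope.

(** ** Simple graphs and graph parameters *)

Record sgraph := SGraph {
  vertex :> finType;
  adj : rel vertex;
  adj_sym : symmetric adj;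
  adj_irr : irreflexive adj;
  vertex_gt0 : (0 < #|vertex|)%N }.

Definition sg_iso (G H : sgraph) : Prop :=
  exists2 phi : G -> H, bijective phi &
    forall x y : G, adj (phi x) (phi y) = adj x y.

Definition graph_parameter (R : realType) (f : sgraph -> R) : Prop :=
  forall G H : sgraph, sg_iso G H -> f G = f H.

Definition bounded_parameter (R : realType) (f : sgraph -> R) : Prop :=
  exists M : R, forall G : sgraph, `|f G| <= M.

(** ** Sampling *)

Definition ksubset (k : nat) (G : sgraph) : finType :=
  {S : {set G} | #|S| == k}.

Section Induced.
Variables (k : nat) (k_gt0 : (0 < k)%N) (G : sgraph) (S : ksubset k G).

Definition induced_adj : rel {x : G | x \in val S} :=
  fun x y => adj (val x) (val y).

Lemma induced_sym : symmetric induced_adj.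
Proof. by move=> x y; rewrite /induced_adj adj_sym. Qed.

Lemma induced_irr : irreflexive induced_adj.
Proof. by move=> x; rewrite /induced_adj adj_irr. Qed.

Lemma induced_gt0 : (0 < #|{: {x : G | x \in val S}}|)%N.
Proof. by rewrite card_sig (eqP (valP S)). Qed.

Definition induced_sgraph : sgraph := SGraph induced_sym induced_irr induced_gt0.

End Induced.

(* Probability and expectation for a uniformly random k-subset of the nodes;
   both are only meaningful for k <= #|G|. *)
Definition Pr_ksubset (R : realType) (k : nat) (G : sgraph)
    (P : pred (ksubset k G)) : R :=
  #|[set S : ksubset k G | P S]%SET|%:R / #|ksubset k G|%:R.

Definition E_ksubset (R : realType) (k : nat) (G : sgraph)
    (X : ksubset k G -> R) : R :=
  (\sum_(S : ksubset k G) X S) / #|ksubset k G|%:R.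

(* The estimate is a function of the isomorphism type of the sample: the node
   type of [induced_sgraph k_gt0 S] must not leak any information on G. *)
Definition testable (R : realType) (f : sgraph -> R) : Prop :=
  forall eps : R, 0 < eps ->
  exists (k : nat) (k_gt0 : (0 < k)%N) (ftilde : sgraph -> R),
    graph_parameter ftilde /\
    forall G : sgraph, (k <= #|G|)%N ->
      Pr_ksubset R (fun S : ksubset k G =>
        eps < `|f G - ftilde (induced_sgraph k_gt0 S)|) <= eps.

(** ** Convergence *)

Definition hom (F G : sgraph) : nat :=
  #|[set phi : {ffun F -> G} |
      [forall x, forall y, adj x y ==> adj (phi x) (phi y)]]%SET|.

Definition hom_density (R : realType) (F G : sgraph) : R :=
  (hom F G)%:R / (#|G| ^ #|F|)%:R.

Definition convergent (R : realType) (G_ : nat -> sgraph) : Prop :=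
  forall F : sgraph, cvgn (fun n => hom_density R F (G_ n)).

(** ** Graphons *)

(* Functions on the unit square are represented by their extensions by 0 to the
   whole plane. *)
Record graphon (R : realType) := Graphon {
  graphon_fun :> R * R -> R;
  graphon_supp : forall p : R * R,
    ~ (`[0, 1]%classic `*` `[0, 1]%classic) p -> graphon_fun p = 0;
  graphon_meas : measurable_fun [set: R * R] graphon_fun;
  graphon_bounded : exists M : R, forall p : R * R, `|graphon_fun p| <= M;
  graphon_sym : forall x y, graphon_fun (x, y) = graphon_fun (y, x) }.

Definition cut_norm (R : realType) (W : R * R -> R) : R :=
  sup [set r : R | exists S T : set R,
    [/\ measurable S, measurable T, S `<=` `[0, 1], T `<=` `[0, 1] &
      r = `|\int[(@lebesgue_measure R \x @lebesgue_measure R)%E]_(p in S `*` T)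
              W p|]].

Definition cut_continuous (R : realType) (phi : graphon R -> R) : Prop :=
  forall W : graphon R, forall eps : R, 0 < eps ->
  exists2 delta : R, 0 < delta & forall W' : graphon R,
    cut_norm (W' \- W) < delta -> `|phi W' - phi W| < eps.

(* The intervals [0, 1/n], ]1/n, 2/n], ..., ](n-1)/n, 1] partition [0, 1]. *)
Definition part (R : realType) (n : nat) (i : 'I_n) : set R :=
  if (i == 0 :> nat)%N then `[0, n%:R^-1]%classic
  else `]i%:R / n%:R, i.+1%:R / n%:R]%classic.

Section GraphonOf.
Variables (R : realType) (G : sgraph) (l : 'I_#|G| -> G).

Definition graphon_of_set : set (R * R) :=
  [set p | exists i j : 'I_#|G|,
    [/\ part i p.1, part j p.2 & adj (l i) (l j)]].

Definition graphon_of_fun : R * R -> R := \1_graphon_of_set.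

Lemma part_sub01 n (i : 'I_n) : part i `<=` (`[0, 1] : set R).
Proof.
have n0 : (0 : R) < n%:R by rewrite ltr0n (leq_ltn_trans _ (ltn_ord i)).
move=> x; rewrite /part; case: ifP => _ /=; rewrite !in_itv/=.
  case/andP => -> /le_trans; apply.
  by rewrite invf_le1// ler1n -(ltr0n R).
case/andP => x1 x2; apply/andP; split.
  by apply: (le_trans _ (ltW x1)); rewrite divr_ge0.
by apply: (le_trans x2); rewrite ler_pdivrMr// mul1r ler_nat ltn_ord.
Qed.

Lemma measurable_part n (i : 'I_n) : measurable (part i : set R).
Proof. by rewrite /part; case: ifP => _; exact: measurable_itv. Qed.

Lemma graphon_of_supp (p : R * R) :
  ~ (`[0, 1]%classic `*` `[0, 1]%classic) p -> graphon_of_fun p = 0.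
Proof.
move=> np; rewrite /graphon_of_fun indicE memNset// => -[i [j [pi pj _]]].
by apply: np; split; [exact: part_sub01 pi|exact: part_sub01 pj].
Qed.

Lemma graphon_of_meas : measurable_fun [set: R * R] graphon_of_fun.
Proof.
apply: measurable_indic.
rewrite (_ : graphon_of_set = \bigcup_(ij in [set ij : 'I_#|G| * 'I_#|G| |
    adj (l ij.1) (l ij.2)]) (part ij.1 `*` part ij.2)).
  apply: fin_bigcup_measurable => [|ij _]; first exact: finite_finset.
  by apply: measurableX; exact: measurable_part.
apply/seteqP; split => p /=.
  by case=> i [j [pi pj ij]]; exists (i, j).
by case=> -[i j] /= ij [pi pj]; exists i, j.
Qed.

Lemma graphon_of_bounded : exists M : R, forall p, `|graphon_of_fun p| <= M.
Proof.
by exists 1 => p; rewrite /graphon_of_fun indicE; case: (_ \in _);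
  rewrite ?normr1 ?normr0.
Qed.

Lemma graphon_of_sym x y : graphon_of_fun (x, y) = graphon_of_fun (y, x).
Proof.
rewrite /graphon_of_fun !indicE; congr (nat_of_bool _)%:R.
by apply/idP/idP; rewrite !inE => -[i [j [pi pj ij]]]; exists j, i;
  rewrite adj_sym.
Qed.

Definition graphon_of : graphon R := Graphon graphon_of_supp graphon_of_meas
  graphon_of_bounded graphon_of_sym.

End GraphonOf.

(** ** Cut distance of simple graphs *)

Definition fractional_overlay (R : realType) (G G' : sgraph)
    (X : G -> G' -> R) : Prop :=
  [/\ forall i u, 0 <= X i u,
      forall i, \sum_(u : G') X i u = #|G|%:R^-1 &
      forall u, \sum_(i : G) X i u = #|G'|%:R^-1].

(* The default value 0 of the maximum is attained at S = T = set0. *)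
Definition overlay_cut (R : realType) (G G' : sgraph) (X : G -> G' -> R) : R :=
  \big[Num.max/0]_(S : {set G * G'}) \big[Num.max/0]_(T : {set G * G'})
    `|\sum_(p in S) \sum_(q in T) X p.1 p.2 * X q.1 q.2 *
        ((adj p.1 q.1)%:R - (adj p.2 q.2)%:R)|.

(* The infimum is a minimum: [overlay_cut] is continuous on the nonempty
   compact set of fractional overlays. *)
Definition cut_distance (R : realType) (G G' : sgraph) : R :=
  inf [set overlay_cut X | X in @fractional_overlay R G G'].

(* Main.v *)
(** The cycle is (a) => (b) => (c) => (e) => (d) => (a).
    (a) => (b): a graph on exactly k nodes is its only sample, so f and the
    estimator agree up to the error on k-node graphs.
    (b) => (c): the expectation of f on a sample is, up to O(1/n), a linear
    combination of homomorphism densities.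
    (c) => (e): by the counting lemma, graphs at small cut distance have close
    homomorphism densities; interleave two such sequences along a convergent
    subsequence.
    (e) => (d): McShane extension, since the cut distance is at most the cut norm of
    W_G - W_G'.
    (d) => (a): if f is not testable, there are graphs G_n with untypical samples
    H_n. The node set of G_n is colored so that, at every level j, a bounded
    function of the colors approximates the adjacency matrix in cut norm up to
    2^-j (weak regularity). As small cut norm is equivalent to few weighted
    four-cycles, and the expected number of the latter is preserved by sampling,
    H_n may be assumed to inherit these approximations and the color frequencies.
    Sorting the nodes lexicographically by colors then makes W_(G_n) a Cauchy
    sequence in cut norm along a subsequence, with W_(H_n) merging with it. The
    cut norm is complete on [0, 1]-valued graphons (Radon-Nikodym), and continuity
    at the limit graphon gives a contradiction. *)

Require Import Defs.
From HB Require Import structures.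
From mathcomp Require Import all_boot all_order all_algebra.
From mathcomp Require Import all_classical all_reals all_analysis.
From mathcomp Require Import measurable_realfun.
From mathcomp Require Import ring lra zify.

Set Implicit Arguments.
Unset Strict Implicit.
Unset Printing Implicit Defensive.

Import Order.TTheory GRing.Theory Num.Theory.
Import numFieldNormedType.Exports.

Local Open Scope classical_set_scope.
Local Open Scope ring_scope.

(** * Real sequences *)

(** Condition (d) gives continuity at each single graphon, with no uniformity, so testability cannot
    be read off from the distance between a graph and its sample: a limit point is needed. It is
    found among labeled graphons in the plain cut norm, without measure preserving maps. Once nodes
    are sorted by color, the integral over a given rectangle is determined, up to the regularity
    error, by finitely many cumulative color frequencies and by the choice of one of finitely many
    kernels; all these data can be made to converge along a subsequence. Four-cycle counts take the
    place of concentration arguments: being averages over 4-tuples of nodes, they survive sampling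
    in expectation, and Markov's inequality suffices. The price is a fourth root, whence the fourth
    powers in the choice of errors. In the extension of f to graphons, f need not be a function of
    W_G, since a graph and its blow-ups can share their graphon; the terms 1/|V(G)| in the moduli
    absorb this. *)

Lemma dist_lt_of_le (R : realType) (a b c e : R) :
  a <= b + c -> b <= a + c -> c < e -> `|a - b| < e.
Proof. by move=> ab ba ce; rewrite ltr_norml; apply/andP; split; lra. Qed.

Section Sequences.
Variable R : realType.
Implicit Types (u v : nat -> R) (l : R).

Lemma cvgn_leP u l : u n @[n --> \oo] --> l <->
  forall e : R, 0 < e -> exists N, forall n, (N <= n)%N -> `|u n - l| <= e.
Proof.
split=> [ul e e0|H].
  have /cvgrPdist_le /(_ e e0) [N _ HN] := ul.
  by exists N => n Nn; rewrite distrC; exact: HN.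
apply/cvgrPdist_le => e e0; have [N HN] := H _ e0.
by exists N => // n Nn; rewrite distrC; exact: HN.
Qed.

Lemma cauchy_cvgn u :
  (forall e : R, 0 < e -> exists N, forall n m, (N <= n)%N -> (N <= m)%N ->
    `|u n - u m| <= e) -> cvgn u.
Proof.
move=> H; apply/cauchy_cvgP; apply: cauchy_exP => e e0.
have [|N HN] := H (e / 2); first by rewrite divr_gt0.
exists (u N); exists N => // n /= Nn.
rewrite /ball/=; apply: le_lt_trans (HN _ _ _ _) _ => //; lra.
Qed.

Lemma cvgn_cauchy u : cvgn u ->
  forall e : R, 0 < e -> exists N, forall n m, (N <= n)%N -> (N <= m)%N ->
    `|u n - u m| <= e.
Proof.
move=> /cvgn_leP ul e e0.
have [|N HN] := ul (e / 2); first by rewrite divr_gt0.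
exists N => n m /HN h1 /HN h2; rewrite (splitr e).
by apply: le_trans (ler_distD (limn u) _ _) _; rewrite lerD// distrC.
Qed.

Lemma cvgn_approx u :
  (forall e : R, 0 < e -> exists2 v, cvgn v &
    exists N, forall n, (N <= n)%N -> `|u n - v n| <= e) -> cvgn u.
Proof.
move=> H; apply: cauchy_cvgn => e e0.
have e3 : 0 < e / 3 by rewrite divr_gt0.
have [v /cvgn_cauchy /(_ _ e3)[N1 h1] [N2 h2]] := H _ e3.
exists (maxn N1 N2) => n m; rewrite !geq_max => /andP[n1 n2] /andP[m1 m2].
move: (h1 _ _ n1 m1) (h2 _ n2) (h2 _ m2); rewrite !ler_norml.
by move=> /andP[? ?] /andP[? ?] /andP[? ?]; apply/andP; split; lra.
Qed.

(** Instead of iterated extraction, all coordinates converge at once along an ultrafilter finer than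
    the cofinite one, by compactness of segments. The n-th index is then chosen beyond n with the
    first coordinates within 1/(n+1) of their limits. [phi] need not be increasing: [n <= phi n] is
    what later arguments use. *)
Lemma diagonal_subsequence (u : nat -> nat -> R) :
  (forall i, exists M, forall n, `|u i n| <= M) ->
  exists phi : nat -> nat, (forall n, (n <= phi n)%N) /\
    forall i, cvgn (fun n => u i (phi n)).
Proof.
move=> ub; have [p [pU ple]] := ultraFilterLemma (eventually_filter).
have [L HL] : exists L : nat -> R, forall i e, 0 < e -> p [set n | `|u i n - L i| < e].
  suff H i : exists l : R, forall e, 0 < e -> p [set n | `|u i n - l| < e].
    by exists (fun i => sval (cid (H i))) => i; case: cid.
  have [M uM] := ub i.
  have [|l [_ cl]] := @segment_compact R (- M) M (u i @ p) _.
    apply: (@filterS nat p _ setT); last exact: filterT.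
    by move=> n _ /=; rewrite in_itv/= -ler_norml.
  exists l => e e0; have [//|pC] := in_ultra_setVsetC [set n | `|u i n - l| < e] pU.
  have ue : (u i @ p) (~` ball l e).
    apply: (@filterS nat p _ _ _ _ pC) => n /= + b; apply.
    by move: b; rewrite /ball/= distrC.
  by have [x [nb b]] := cl _ _ ue (nbhsx_ballx _ _ e0); case: nb.
have pick n : exists m, (n <= m)%N /\ forall i, (i <= n)%N -> `|u i m - L i| < n.+1%:R^-1.
  have pm : p [set m | (n <= m)%N] by apply: ple; exists n.
  have pI k : p [set m | forall i, (i <= k)%N -> `|u i m - L i| < n.+1%:R^-1].
    elim: k => [|k IH].
      have := HL 0%N _ (ltac:(by rewrite invr_gt0) : 0 < n.+1%:R^-1 :> R).
      by apply: filterS => m /= h i; rewrite leqn0 => /eqP ->.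
    have := HL k.+1 _ (ltac:(by rewrite invr_gt0) : 0 < n.+1%:R^-1 :> R).
    apply: filterS2 IH => m /= h1 h2 i; rewrite leq_eqVlt => /orP[/eqP ->//|].
    by rewrite ltnS; exact: h1.
  by have [m [nm h]] := filter_ex (filterI pm (pI n)); exists m.
exists (fun n => sval (cid (pick n))); split=> [n|i]; first by case: cid => m [].
apply/cvg_ex; exists (L i); apply/cvgn_leP => e e0.
exists (maxn i (Num.bound e^-1)) => n; rewrite geq_max => /andP[ni nb].
case: cid => m [_ /(_ _ ni)] /= /ltW /le_trans; apply.
rewrite -[leRHS]invrK lef_pV2 ?posrE ?invr_gt0//.
apply: le_trans (ltW (archi_boundP _)) _; first by rewrite invr_ge0 ltW.
by rewrite ler_nat; exact: leqW.
Qed.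

End Sequences.

(** * Cut norms of finite kernels *)

(** The sums are not normalized, so for a graph the bound [c] has the form [e * #|G|%:R ^+ 2]. *)
Definition cut_le (R : realType) (A B : finType) (U : A -> B -> R) (c : R) :=
  forall (S : {set A}) (T : {set B}), `|\sum_(x in S) \sum_(y in T) U x y| <= c.

Section CutLe.
Variables (R : realType) (A B : finType).
Implicit Types (U : A -> B -> R) (c : R).

(** A linear form on the cube is largest at a vertex, namely the indicator of its positive
    coefficients. *)
Lemma weighted_sum_le (I : finType) (a r : I -> R) :
  (forall x, 0 <= r x <= 1) ->
  \sum_x r x * a x <= \sum_(x in [set x | 0 < a x]%SET) a x.
Proof.
move=> r01; rewrite [leRHS]big_mkcond/=; apply: ler_sum => x _.
rewrite inE; have /andP[r0 r1] := r01 x.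
by case: ltP => a0; nra.
Qed.

(** The form is linear in each family of weights separately, so first [r] and then [t] may be
    replaced by an indicator. *)
Lemma cut_le_weight_ub U c (r : A -> R) (t : B -> R) : cut_le U c ->
  (forall x, 0 <= r x <= 1) -> (forall y, 0 <= t y <= 1) ->
  \sum_x \sum_y r x * t y * U x y <= c.
Proof.
move=> Uc r01 t01.
under eq_bigr => x _ do under eq_bigr => y _ do rewrite -mulrA.
under eq_bigr => x _ do rewrite -mulr_sumr.
apply: le_trans (weighted_sum_le _ r01) _.
rewrite exchange_big/=.
under eq_bigr => y _ do rewrite -mulr_sumr.
apply: le_trans (weighted_sum_le _ t01) _.
rewrite exchange_big/=.
exact: le_trans (ler_norm _) (Uc _ _).
Qed.

Lemma cut_leN U c : cut_le U c -> cut_le (fun x y => - U x y) c.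
Proof.
move=> Uc S T; under eq_bigr => x _ do rewrite sumrN.
by rewrite sumrN normrN.
Qed.

Lemma cut_le_weight U c (r : A -> R) (t : B -> R) : cut_le U c ->
  (forall x, 0 <= r x <= 1) -> (forall y, 0 <= t y <= 1) ->
  `|\sum_x \sum_y r x * t y * U x y| <= c.
Proof.
move=> Uc r01 t01; rewrite ler_norml cut_le_weight_ub// andbT lerNl.
apply: le_trans (cut_le_weight_ub (cut_leN Uc) r01 t01).
rewrite -sumrN; apply: ler_sum => x _; rewrite -sumrN; apply: ler_sum => y _.
by rewrite mulrN.
Qed.

(** Positive and negative parts of both weights give four terms, each at most [c]. *)
Lemma cut_le_signed U c (r : A -> R) (t : B -> R) : cut_le U c ->
  (forall x, `|r x| <= 1) -> (forall y, `|t y| <= 1) ->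
  `|\sum_x \sum_y r x * t y * U x y| <= 4 * c.
Proof.
move=> Uc r1 t1.
pose pos (z : R) := Num.max z 0; pose neg (z : R) := Num.max (- z) 0.
have zE z : z = pos z - neg z.
  by rewrite /pos /neg; case: (lerP z 0) => z0; case: (lerP (- z) 0) => ?; lra.
have p01 z : `|z| <= 1 -> 0 <= pos z <= 1.
  rewrite ler_norml /pos => /andP[? ?].
  by case: (lerP z 0) => z0; apply/andP; split; lra.
have n01 z : `|z| <= 1 -> 0 <= neg z <= 1.
  rewrite ler_norml /neg => /andP[? ?].
  by case: (lerP (- z) 0) => z0; apply/andP; split; lra.
have -> : \sum_x \sum_y r x * t y * U x y =
    \sum_x \sum_y pos (r x) * pos (t y) * U x y
    - \sum_x \sum_y pos (r x) * neg (t y) * U x y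
    - \sum_x \sum_y neg (r x) * pos (t y) * U x y
    + \sum_x \sum_y neg (r x) * neg (t y) * U x y.
  rewrite -!sumrB -big_split/=; apply: eq_bigr => x _.
  rewrite -!sumrB -big_split/=; apply: eq_bigr => y _.
  rewrite {1}(zE (r x)) {1}(zE (t y)); ring.
have h1 := cut_le_weight Uc (fun x => p01 _ (r1 x)) (fun y => p01 _ (t1 y)).
have h2 := cut_le_weight Uc (fun x => p01 _ (r1 x)) (fun y => n01 _ (t1 y)).
have h3 := cut_le_weight Uc (fun x => n01 _ (r1 x)) (fun y => p01 _ (t1 y)).
have h4 := cut_le_weight Uc (fun x => n01 _ (r1 x)) (fun y => n01 _ (t1 y)).
move: h1 h2 h3 h4; rewrite !ler_norml.
by move=> /andP[? ?] /andP[? ?] /andP[? ?] /andP[? ?]; apply/andP; split; lra.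
Qed.

End CutLe.

Lemma sqr_sum_le (R : realType) (I : finType) (P : {pred I}) (a : I -> R) :
  (\sum_(i in P) a i) ^+ 2 <= #|P|%:R * \sum_(i in P) a i ^+ 2.
Proof.
have [P0|P_gt0] := posnP #|P|.
  by rewrite !big_pred0 ?expr0n ?mulr0//; exact: card0_eq.
set s := \sum_(i in P) a i; set q := \sum_(i in P) a i ^+ 2.
have h : 0 <= \sum_(i in P) (#|P|%:R * a i - s) ^+ 2.
  by apply: sumr_ge0 => i _; exact: sqr_ge0.
have e : \sum_(i in P) (#|P|%:R * a i - s) ^+ 2 = #|P|%:R * (#|P|%:R * q - s ^+ 2).
  transitivity (\sum_(i in P) (#|P|%:R ^+ 2 * a i ^+ 2
      + (- 2 * #|P|%:R * s) * a i + s ^+ 2)); first by apply: eq_bigr => i _; ring.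
  rewrite !big_split/= -!mulr_sumr sumr_const -/s -/q -mulr_natl; ring.
move: h; rewrite e pmulr_rge0 ?ltr0n// subr_ge0; exact.
Qed.

(** * Counting four-cycles *)

(** With the outer pair [x'], [y'] fixed, the inner double sum is a bilinear form in [U x y] with
    weights [U x y'] and [U x' y]. The whole is the squared Frobenius norm of the Gram matrix of the
    columns of [U]. *)
Definition c4 (R : realType) (V : finType) (U : V -> V -> R) : R :=
  \sum_x' \sum_y' \sum_x \sum_y U x y * U x' y * U x y' * U x' y'.

Section C4.
Variables (R : realType) (V : finType).
Implicit Types (U : V -> V -> R) (c : R).

(** For each of the [#|V| ^ 2] pairs [x'], [y'], the inner sum is a cut form with signed weights
    bounded by 1. *)
Lemma c4_le U c : (forall x y, `|U x y| <= 1) -> cut_le U c ->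
  c4 U <= 4 * #|V|%:R ^+ 2 * c.
Proof.
move=> U1 Uc.
have step x' y' : \sum_x \sum_y U x y * U x' y * U x y' * U x' y' <= 4 * c.
  apply: le_trans (ler_norm _) _.
  have -> : \sum_x \sum_y U x y * U x' y * U x y' * U x' y' =
      U x' y' * \sum_x \sum_y U x y' * U x' y * U x y.
    rewrite mulr_sumr; apply: eq_bigr => x _; rewrite mulr_sumr.
    by apply: eq_bigr => y _; ring.
  rewrite normrM -[leRHS]mul1r ler_pM//; exact: cut_le_signed.
have -> : 4 * #|V|%:R ^+ 2 * c = \sum_(x' : V) \sum_(y' : V) 4 * c.
  rewrite !sumr_const -!mulrnA -[RHS]mulr_natl natrM.
  have -> : #|xpredT : pred V|%:R = #|V|%:R :> R by [].
  ring.
by apply: ler_sum => x' _; apply: ler_sum => y' _.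
Qed.

(** Cauchy-Schwarz twice: over rows, which brings in the Gram entries [d y y'], and over pairs of
    columns, which squares them. Both times the restriction to [S] and [T] is dropped because the
    summands are nonnegative. *)
Lemma cut_c4 U (S T : {set V}) :
  (\sum_(x in S) \sum_(y in T) U x y) ^+ 4 <= #|V|%:R ^+ 4 * c4 U.
Proof.
pose d y y' := \sum_x U x y * U x y'.
have le1 : (\sum_(x in S) \sum_(y in T) U x y) ^+ 2 <=
    #|V|%:R * \sum_y \sum_y' `|d y y'|.
  apply: le_trans (sqr_sum_le _ _) _.
  apply: ler_pM => //.
  - by apply: sumr_ge0 => x _; exact: sqr_ge0.
  - by rewrite ler_nat max_card.
  apply: (@le_trans _ _ (\sum_x (\sum_(y in T) U x y) ^+ 2)).
    rewrite [leLHS]big_mkcond/=; apply: ler_sum => x _.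
    by case: ifP => // _; exact: sqr_ge0.
  have -> : \sum_x (\sum_(y in T) U x y) ^+ 2 =
      \sum_(y in T) \sum_(y' in T) d y y'.
    under eq_bigr => x _ do rewrite expr2 mulr_suml.
    rewrite exchange_big/=; apply: eq_bigr => y _.
    under eq_bigr => x _ do rewrite mulr_sumr.
    by rewrite exchange_big.
  rewrite big_mkcond/=; apply: ler_sum => y _.
  have pos : 0 <= \sum_y' `|d y y'| by apply: sumr_ge0.
  case: ifP => // _; rewrite big_mkcond/=; apply: ler_sum => y' _.
  by case: ifP => // _; exact: ler_norm.
have c4E : c4 U = \sum_(p : V * V) `|d p.1 p.2| ^+ 2.
  rewrite -(pair_bigA _ (fun y y' => `|d y y'| ^+ 2))/=.
  transitivity (\sum_y \sum_y' \sum_x \sum_x' U x y * U x' y * U x y' * U x' y').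
    rewrite /c4.
    under eq_bigr => x' _ do under eq_bigr => y' _ do rewrite exchange_big/=.
    under eq_bigr => x' _ do rewrite exchange_big/=.
    rewrite exchange_big/=; apply: eq_bigr => y _.
    rewrite exchange_big/=; apply: eq_bigr => y' _.
    by rewrite exchange_big.
  apply: eq_bigr => y _; apply: eq_bigr => y' _.
  rewrite real_normK ?num_real// expr2 mulr_suml; apply: eq_bigr => x _.
  by rewrite mulr_sumr; apply: eq_bigr => x' _; ring.
have -> : (\sum_(x in S) \sum_(y in T) U x y) ^+ 4 =
    ((\sum_(x in S) \sum_(y in T) U x y) ^+ 2) ^+ 2 by rewrite -exprM.
apply: (@le_trans _ _ ((#|V|%:R * \sum_y \sum_y' `|d y y'|) ^+ 2)).
  by rewrite ler_sqr// nnegrE ?sqr_ge0// mulr_ge0// sumr_ge0// => ? _; exact: sumr_ge0.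
rewrite exprMn pair_bigA/= c4E.
apply: (@le_trans _ _ (#|V|%:R ^+ 2 *
    (#|{: V * V}|%:R * \sum_(p : V * V) `|d p.1 p.2| ^+ 2))).
  rewrite ler_wpM2l ?sqr_ge0//.
  exact: (sqr_sum_le _ (fun p : V * V => `|d p.1 p.2|)).
rewrite card_prod natrM mulrA.
by have -> : #|V|%:R ^+ 2 * (#|V|%:R * #|V|%:R) = #|V|%:R ^+ 4 :> R by ring.
Qed.

Lemma c4_ge0 U : 0 <= c4 U.
Proof.
have [V0|V0] := posnP #|V|.
  by rewrite /c4 big_pred0// => x; exact: (card0_eq V0 x).
have := cut_c4 U finset.set0 finset.set0; rewrite big_set0 expr0n/=.
by rewrite pmulr_rge0// exprn_gt0// ltr0n.
Qed.

End C4.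

(** * Weak regularity *)

Lemma adj01 (R : realType) (G : sgraph) (x y : G) : 0 <= ((adj x y)%:R : R) <= 1.
Proof. by case: adj; rewrite ?lexx ler01. Qed.

Definition clamp (R : realType) (z : R) : R := Num.min 1 (Num.max 0 z).

Lemma clamp01 (R : realType) (z : R) : 0 <= clamp z <= 1.
Proof.
by rewrite /clamp; case: (lerP 0 z) => ?; case: (lerP 1) => ?; apply/andP; split; lra.
Qed.

(** Projection to [0, 1] does not move away from a point of [0, 1]. *)
Lemma clamp_near (R : realType) (a z : R) : 0 <= a <= 1 ->
  (a - clamp z) ^+ 2 <= (a - z) ^+ 2.
Proof.
rewrite /clamp => /andP[a0 a1].
by case: (lerP 0 z) => ?; case: (lerP 1) => ?; nra.
Qed.

(* Frieze-Kannan greedy algorithm. Each round adds +-eps on a rectangle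
   witnessing a large cut norm of the remainder and clamps to [0, 1]; this
   lowers the mean square error by eps^2. As the steps have constant size, only
   finitely many patterns [d a] occur. *)
Lemma weak_regularity (R : realType) (eps : R) : 0 < eps ->
  exists (q N : nat) (d : nat -> nat -> nat -> R),
    (forall a i j, 0 <= d a i j <= 1) /\
    forall G : sgraph, exists (a : nat) (s : G -> nat),
      [/\ (a < N)%N, forall x, (s x < q)%N &
        cut_le (fun x y => (adj x y)%:R - d a (s x) (s y)) (eps * #|G|%:R ^+ 2)].
Proof.
move=> eps0.
(* After [t] rounds either the cut norm is already small or the square error is at most
   [1 - t * eps ^+ 2]; the latter is impossible once this is negative. *)
suff iter t : exists (q N : nat) (d : nat -> nat -> nat -> R),
    (forall a i j, 0 <= d a i j <= 1) /\
    forall G : sgraph, exists (a : nat) (s : G -> nat),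
      [/\ (a < N)%N, forall x, (s x < q)%N &
        cut_le (fun x y => (adj x y)%:R - d a (s x) (s y)) (eps * #|G|%:R ^+ 2) \/
        \sum_x \sum_y ((adj x y)%:R - d a (s x) (s y)) ^+ 2 <=
          (1 - t%:R * eps ^+ 2) * #|G|%:R ^+ 2].
  have [t ht] : exists t : nat, 1 < t%:R * eps ^+ 2.
    exists (Num.bound (eps ^+ 2)^-1).
    rewrite -ltr_pdivrMr ?exprn_gt0// div1r.
    by rewrite archi_boundP// ltW// invr_gt0 exprn_gt0.
  have [q [N [d [d01 H]]]] := iter t; exists q, N, d; split=> // G.
  have [a [s [aN sq [//|E]]]] := H G; first by exists a, s.
  exfalso; move: E; apply/negP; rewrite -ltNge.
  apply: (@lt_le_trans _ _ 0).
    rewrite pmulr_llt0; first by rewrite subr_lt0.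
    by rewrite exprn_gt0// ltr0n vertex_gt0.
  by apply: sumr_ge0 => x _; apply: sumr_ge0 => y _; exact: sqr_ge0.
elim: t => [|t [q [N [d [d01 H]]]]].
  exists 1, 1, (fun _ _ _ => 0); split=> [a i j|G]; first by rewrite lexx ler01.
  exists 0, (fun=> 0); split=> //; right.
  apply: (@le_trans _ _ (\sum_(x : G) \sum_(y : G) 1)).
    apply: ler_sum => x _; apply: ler_sum => y _; rewrite subr0.
    by case: adj; rewrite ?expr1n ?expr0n ?ler01.
  rewrite !sumr_const mul0r subr0 mul1r -mulrnA natrM expr2.
  by rewrite le_eqVlt eqxx.
pose sg (b : bool) : R := if b then eps else - eps.
(* One new bit in the pattern index stores the sign of the correction; two new bits in each color
   store membership in [T] (lowest) and in [S] (next). *)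
exists (4 * q)%N, (2 * N)%N, (fun a i j =>
  clamp (d a./2 i./2./2 j./2./2 + sg (odd a) * (odd i./2)%:R * (odd j)%:R)).
split=> [a i j|G]; first exact: clamp01.
have [a [s [aN sq E]]] := H G.
set U := fun x y => (adj x y)%:R - d a (s x) (s y) in E.
have sgE b : sg b ^+ 2 = eps ^+ 2 by case: b; rewrite /sg ?sqrrN.
case: (pselect (cut_le U (eps * #|G|%:R ^+ 2))) => [C|].
  (* All new bits are 0, so the correction vanishes and clamping does not change a value already in
     [0, 1]. *)
  exists a.*2, (fun x => (s x).*2.*2); split=> [|x|]; [lia|by have := sq x; lia|].
  left; move: C; congr (cut_le _ _); apply/funext => x; apply/funext => y.
  rewrite /U !doubleK !odd_double mulr0 addr0.
  congr (_ - _); rewrite /clamp; have /andP[d0 d1] := d01 a (s x) (s y).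
  by rewrite (max_idPr d0) (min_idPr d1).
have {}E : ~ cut_le U (eps * #|G|%:R ^+ 2) ->
  \sum_x \sum_y (U x y) ^+ 2 <= (1 - t%:R * eps ^+ 2) * #|G|%:R ^+ 2 by case: E.
move=> /[dup] nC /E {}E.
have [S [T ST]] : exists (S T : {set G}),
    eps * #|G|%:R ^+ 2 < `|\sum_(x in S) \sum_(y in T) U x y|.
  apply: contrapT => nST; apply: nC => S T; rewrite leNgt; apply/negP => ST.
  by apply: nST; exists S, T.
pose b := 0 <= \sum_(x in S) \sum_(y in T) U x y.
exists (b + a.*2)%N, (fun x => ((x \in T) + ((x \in S) + (s x).*2).*2)%N).
split=> [|x|].
- by case: (b); lia.
- by have := sq x; case: (x \in T); case: (x \in S); lia.
right; rewrite half_bit_double oddD odd_double addbF oddb.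
under eq_bigr => x _ do under eq_bigr => y _ do
  rewrite !half_bit_double !oddD !odd_double !addbF !oddb.
(* Expanding the square, the cross term lowers the mean by at least [2 * eps ^+ 2] and the last term
   raises it by [eps ^+ 2], a net gain of [eps ^+ 2]. *)
apply: (@le_trans _ _ (\sum_x \sum_y (U x y ^+ 2
    - 2 * sg b * ((x \in S)%:R * ((y \in T)%:R * U x y)) + eps ^+ 2))).
  apply: ler_sum => x _; apply: ler_sum => y _.
  apply: le_trans (clamp_near _ (adj01 R x y)) _.
  rewrite /U; case: (x \in S); case: (y \in T); rewrite /= ?mulr1n ?mulr0n; have := sgE b; have := sqr_ge0 eps; nra.
under eq_bigr => x _ do rewrite 2!big_split/= sumrN -mulr_sumr -mulr_sumr.
rewrite 2!big_split/= sumrN -mulr_sumr.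
have -> : \sum_(x : G) (x \in S)%:R * \sum_(y : G) (y \in T)%:R * U x y =
    \sum_(x in S) \sum_(y in T) U x y.
  rewrite [RHS]big_mkcond/=; apply: eq_bigr => x _.
  case: ifP => _; rewrite /= ?mulr0n ?mulr1n ?mul0r// mul1r.
  rewrite [RHS]big_mkcond/=; apply: eq_bigr => y _.
  by case: ifP => _; rewrite /= ?mulr0n ?mulr1n ?mul0r// mul1r.
rewrite !sumr_const.
have -> : eps ^+ 2 *+ #|xpredT : pred G| *+ #|xpredT : pred G| =
    eps ^+ 2 * #|G|%:R ^+ 2.
  by rewrite -[LHS]mulrnA -[LHS]mulr_natr natrM [in RHS]expr2.
have {}ST : eps * (eps * #|G|%:R ^+ 2) <= sg b * \sum_(x in S) \sum_(y in T) U x y.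
  move: ST; rewrite /b; case: (lerP 0) => h.
    by rewrite /= ger0_norm// => ST; rewrite ler_wpM2l ?ltW.
  by rewrite /= ltr0_norm// => ST; rewrite mulNr -mulrN ler_wpM2l ?ltW.
rewrite -natr1; nra.
Qed.

(** * Weak limits of dominated sequences *)

Lemma additive_bigsetU d (T : measurableType d) (R : realType)
    (phi : set T -> R) (F : (set T)^nat) n :
  (forall n, measurable (F n)) -> trivIset setT F ->
  (forall A B, measurable A -> measurable B -> A `&` B = set0 ->
    phi (A `|` B) = phi A + phi B) -> phi set0 = 0 ->
  phi (\big[setU/set0]_(i < n) F i) = \sum_(i < n) phi (F i).
Proof.
move=> mF tF phiU phi0; elim: n => [|n IH]; first by rewrite !big_ord0.
rewrite !big_ord_recr/= phiU ?IH//; first exact: bigsetU_measurable.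
by apply: (@trivIset_bigsetUI _ predT) => // i j _ _; exact: tF.
Qed.

Section WeakLimit.
Context d (T : measurableType d) (R : realType).
Variable mu : {sigma_finite_measure set T -> \bar R}.
Variables (D : set T) (w : nat -> T -> R) (G : set (set T)).
Hypotheses (mD : measurable D) (Dfin : (mu D < +oo)%E).
Hypotheses (mw : forall n, measurable_fun setT (w n)).
Hypotheses (w01 : forall n x, 0 <= w n x <= \1_D x).
Hypotheses (GE : @measurable _ T = <<s G >>) (GI : setI_closed G).

Let J n (A : set T) : R := \int[mu]_(x in A) w n x.
Let m (A : set T) : R := fine (mu (A `&` D)).

Hypotheses (JT : cvgn (J ^~ setT)) (JG : forall A, G A -> cvgn (J ^~ A)).

Let indD_int : mu.-integrable setT (EFin \o \1_D).
Proof.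
apply/integrableP; split; first exact/measurable_EFinP.
under eq_integral => x _ do rewrite /= ger0_norm ?ler0n//.
by rewrite integral_indic// setIT.
Qed.

Let w_int n A : measurable A -> mu.-integrable A (EFin \o w n).
Proof.
move=> mA; apply: (integrableS measurableT) => //.
apply: le_integrable indD_int => //; first exact/measurable_EFinP.
move=> x _ /=; rewrite lee_fin; have /andP[w0 w1] := w01 n x.
by rewrite !ger0_norm// (le_trans w0).
Qed.

Let muD_fin A : measurable A -> mu (A `&` D) \is a fin_num.
Proof.
move=> mA; rewrite ge0_fin_numE//; apply: le_lt_trans Dfin.
by apply: le_measure; rewrite ?inE//; exact: measurableI.
Qed.

Let JU n A B : measurable A -> measurable B -> A `&` B = set0 ->
  J n (A `|` B) = J n A + J n B.
Proof.
move=> mA mB AB; rewrite /J Rintegral_setU//; last exact/disj_set2P.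
by apply: w_int; exact: measurableU.
Qed.

Let mU A B : measurable A -> measurable B -> A `&` B = set0 ->
  m (A `|` B) = m A + m B.
Proof.
move=> mA mB AB; rewrite /m setIUl measureU ?fineD ?muD_fin//.
- exact: measurableI.
- exact: measurableI.
- by rewrite setIACA AB set0I.
Qed.

Let J_ge0 n A : 0 <= J n A.
Proof. by apply: Rintegral_ge0 => x _; case/andP: (w01 n x). Qed.

Let J_le n A : measurable A -> J n A <= m A.
Proof.
move=> mA; rewrite /m setIC -integral_indic//; apply: fine_le.
- exact: integrable_fin_num (w_int n mA).
- by rewrite integral_indic// setIC muD_fin.
apply: ge0_le_integral => //.
- by move=> x _; rewrite lee_fin; case/andP: (w01 n x).
- by apply/measurable_EFinP; exact: measurable_funTS.
- by apply/measurable_EFinP; exact: measurable_funTS.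
- by move=> x _; rewrite lee_fin; case/andP: (w01 n x).
Qed.

Let JD n A B : measurable A -> measurable B -> B `<=` A ->
  J n A - J n B = J n (A `\` B).
Proof.
move=> mA mB BA; have := JU n mB (measurableD mA mB); rewrite setDUK//.
rewrite setDE setICA setICr setI0 => /(_ erefl) ->.
by rewrite addrC addKr.
Qed.

(** As [m] dominates every [J n], this controls the tails of a countable union uniformly in n, and
    those of the limit [L] as well. *)
Let m_tail (F : (set T)^nat) : (forall n, measurable (F n)) ->
  trivIset setT F -> forall e : R, 0 < e ->
  exists N, forall n, (N <= n)%N ->
    m ((\bigcup_k F k) `\` \big[setU/set0]_(i < n) F i) <= e.
Proof.
move=> mF tF e e0.
have mUF : measurable (\bigcup_k F k) by exact: bigcup_measurable.
have tFD : trivIset setT (fun k => F k `&` D).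
  exact: trivIset_setIr.
have mFD k : measurable (F k `&` D) by exact: measurableI.
have := @measure_semi_sigma_additive _ _ _ mu _ mFD tFD.
rewrite -setI_bigcupl => /(_ (measurableI _ _ mUF mD)).
rewrite -[X in _ --> X](fineK (muD_fin mUF)).
move=> /fine_cvgP[_] /cvgn_leP /(_ _ e0)[N HN]; exists N => n /HN.
have mS : measurable (\big[setU/set0]_(i < n) F i) by exact: bigsetU_measurable.
have mSE : m (\big[setU/set0]_(i < n) F i) = fine (\sum_(0 <= i < n) mu (F i `&` D))%E.
  rewrite (additive_bigsetU _ mF tF mU); last by rewrite /m set0I measure0.
  by rewrite big_mkord sum_fine// => i _; exact: muD_fin.
rewrite -mSE distrC -/(m _) => H.
have := mU mS (measurableD mUF mS); rewrite setDUK; last exact: bigsetU_bigcup.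
rewrite setDE setICA setICr setI0 => /(_ erefl) E.
by apply: le_trans H; rewrite E addrC addKr ler_norm.
Qed.

(** Dynkin's theorem extends convergence from the pi-system [G]. A countable disjoint union is
    approximated by finite ones with an error independent of n. *)
Let J_cvg A : measurable A -> cvgn (J ^~ A).
Proof.
move=> mA; have sA : <<s G >> A by rewrite -GE.
pose P := [set S | cvgn (J ^~ S)].
apply: (@dynkin_induction _ T G P GE GI JT JG _ _ A sA).
- move=> S mS cS; rewrite /P/= (_ : J ^~ (~` S) = (fun n => J n setT - J n S)).
    by apply: (is_cvgB JT cS).
  by apply/funext => n; rewrite JD// setTD.
- move=> F mF tF cF; apply: cvgn_approx => e e0.
  have [N HN] := m_tail mF tF e0.
  exists (fun n => J n (\big[setU/set0]_(i < N) F i)).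
    rewrite (_ : (fun n => _) = (fun n => \sum_(i < N) J n (F i))).
      elim: (N) => [|k IH].
        rewrite (_ : (fun n => _) = cst 0); first exact: is_cvg_cst.
        by apply/funext => n; rewrite big_ord0.
      rewrite (_ : (fun n => _) = (fun n => \sum_(i < k) J n (F i) + J n (F k))).
        exact: (is_cvgD IH (cF k)).
      by apply/funext => n; rewrite big_ord_recr.
    apply/funext => n; rewrite (additive_bigsetU _ mF tF (@JU n))//.
    exact: Rintegral_set0.
  have mS : measurable (\big[setU/set0]_(i < N) F i) by exact: bigsetU_measurable.
  have mUF : measurable (\bigcup_k F k) by exact: bigcup_measurable.
  exists 0%N => n _; rewrite JD//; last exact: bigsetU_bigcup.
  rewrite ger0_norm//; apply: le_trans (HN N _) => //.
  by apply: J_le; exact: measurableD.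
Qed.

Let L A : R := limn (J ^~ A).

Let L_ge0 A : measurable A -> 0 <= L A.
Proof. by move=> /J_cvg cA; apply: limr_ge => //; apply: nearW => n. Qed.

Let L_le A : measurable A -> L A <= m A.
Proof.
by move=> mA; apply: limr_le; [exact: J_cvg|apply: nearW => n; exact: J_le].
Qed.

Let LU A B : measurable A -> measurable B -> A `&` B = set0 ->
  L (A `|` B) = L A + L B.
Proof.
move=> mA mB AB; apply: cvg_lim => //.
rewrite (_ : J ^~ (A `|` B) = (fun n => J n A + J n B)).
  exact: (cvgD (J_cvg mA) (J_cvg mB)).
by apply/funext => n; exact: JU.
Qed.

Let L0 : L set0 = 0.
Proof.
rewrite /L (_ : J ^~ set0 = cst 0) ?lim_cst//.
by apply/funext => n; exact: Rintegral_set0.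
Qed.

(** The sequence [J n A] need not converge for nonmeasurable [A]; the value 0 keeps [nu] nonnegative
    on every set. *)
Let nu A : \bar R := if pselect (measurable A) then (L A)%:E else 0%E.

Let nuE A : measurable A -> nu A = (L A)%:E.
Proof. by rewrite /nu; case: pselect. Qed.

Let nu0 : nu set0 = 0%E. Proof. by rewrite nuE// L0. Qed.

Let nu_ge0 A : (0 <= nu A)%E.
Proof. by rewrite /nu; case: pselect => // mA; rewrite lee_fin L_ge0. Qed.

Let nu_sigma_additive : semi_sigma_additive nu.
Proof.
move=> F mF tF mUF; rewrite nuE//.
have -> : (fun n => \sum_(0 <= i < n) nu (F i))%E =
    (fun n => (\sum_(i < n) L (F i))%:E).
  apply/funext => n; rewrite big_mkord -sumEFin; apply: eq_bigr => i _; exact: nuE.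
apply: cvg_EFin; first exact: nearW.
apply/cvgn_leP => e /(m_tail mF tF)[N HN]; exists N => n /HN.
have mS : measurable (\big[setU/set0]_(i < n) F i) by exact: bigsetU_measurable.
have mUS : measurable ((\bigcup_k F k) `\` \big[setU/set0]_(i < n) F i).
  exact: measurableD.
move=> H; apply: le_trans H; apply: le_trans (L_le mUS).
rewrite -(additive_bigsetU _ mF tF LU L0) distrC.
have := LU mS mUS; rewrite setDUK; last exact: bigsetU_bigcup.
rewrite setDE setICA setICr setI0 => /(_ erefl) ->.
by rewrite addrC addKr ger0_norm// -setDE L_ge0.
Qed.

(** The setwise limit of the integrals is additive and dominated by [mu] on [D], hence a finite
    measure absolutely continuous with respect to [mu]; [h] is its density. *)
Lemma weak_limit : exists h : T -> R,
  [/\ measurable_fun setT h, forall x, 0 <= h x <= \1_D x &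
    forall A, measurable A ->
      \int[mu]_(x in A) w n x @[n --> \oo] --> \int[mu]_(x in A) h x].
Proof.
have nu_fin : fin_num_fun nu by move=> A mA; rewrite nuE.
pose nuM : {measure set T -> \bar R} :=
  HB.pack nu (isMeasure.Build _ _ _ nu nu0 nu_ge0 nu_sigma_additive).
have nuM_fin : fin_num_fun nuM := nu_fin.
pose nuF : {finite_measure set T -> \bar R} :=
  HB.pack (Measure.sort nuM) (Measure_isFinite.Build _ _ _ nuM nuM_fin).
have dom : nuF `<< mu.
  apply/null_content_dominatesP => A mA A0.
  rewrite -[nuF A]/(nu A) nuE//; congr (_%:E); apply/eqP.
  rewrite eq_le L_ge0// andbT; apply: le_trans (L_le mA) _.
  rewrite /m (_ : mu (A `&` D) = 0%E)//.
  by apply/eqP; rewrite eq_le measure_ge0 andbT -A0 le_measure ?inE//; exact: measurableI.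
pose g := Radon_Nikodym_SigmaFinite.f nuF mu.
have g0 x : (0 <= g x)%E by exact: Radon_Nikodym_SigmaFinite.f_ge0.
have gfin x : g x \is a fin_num by exact: Radon_Nikodym_SigmaFinite.f_fin_num.
have gint : mu.-integrable setT g by exact: Radon_Nikodym_SigmaFinite.f_integrable.
have gE A : measurable A -> (L A)%:E = (\int[mu]_(x in A) g x)%E.
  by move=> mA; rewrite -nuE//; exact: (Radon_Nikodym_SigmaFinite.f_integral dom mA).
have mg : measurable_fun setT (fine \o g).
  by apply: measurableT_comp => //; exact: measurable_int gint.
(* The density [g] is bounded by the indicator of [D] only almost everywhere, whereas [h] must
   satisfy the bound at each point. On [B], where the truncation acts, the integral of the excess is
   [L B - m B <= 0], so the truncation changes [g] on a null set only. *)
pose h x := Num.min (fine (g x)) (\1_D x).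
have mh : measurable_fun setT h.
  by apply: measurable_minr => //; exact: measurable_indic.
have h01 x : 0 <= h x <= \1_D x.
  by rewrite /h le_min fine_ge0// ler0n/= ge_min lexx orbT.
pose B := [set x | \1_D x < fine (g x)].
have m1D : measurable_fun setT (\1_D : T -> R) by exact: measurable_indic.
have mB : measurable B.
  rewrite (_ : B = setT `&` (fun x => \1_D x < (fine \o g) x) @^-1` [set true]).
    exact: measurable_fun_ltr.
  by rewrite setTI.
have gfE : EFin \o (fine \o g) = g by apply/funext => x /=; rewrite fineK.
have gintB : mu.-integrable B (EFin \o (fine \o g)).
  by rewrite gfE; apply: (integrableS measurableT).
have dintB : mu.-integrable B (EFin \o \1_D) by apply: (integrableS measurableT).
pose f1 x : R := fine (g x) - \1_D x.
have fB0 : (\int[mu]_(x in B) `|(EFin \o f1) x| = 0)%E.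
  apply/eqP; rewrite eq_le; apply/andP; split; last exact: integral_ge0.
  rewrite (eq_integral (EFin \o f1)); last first.
    by move=> x; rewrite inE /B/= => /ltW ?; rewrite ger0_norm// subr_ge0.
  under eq_integral do rewrite /= EFinB.
  rewrite integralB_EFin// [X in (X - _)%E](_ : _ = (L B)%:E); last first.
    by rewrite gE//; apply: eq_integral => x _; rewrite /= fineK.
  rewrite integral_indic// (setIC D B).
  rewrite [X in (_ - X)%E](_ : _ = (m B)%:E); last by rewrite fineK// muD_fin.
  rewrite -EFinB lee_fin subr_le0.
  exact: L_le.
have aegh : ae_eq mu setT g (EFin \o h).
  have mf : measurable_fun B (EFin \o f1).
    apply: measurable_funTS; apply/measurable_EFinP.
    exact: measurable_funB.
  have := (ae_eq_integral_abs mu mB mf).1 fB0.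
  apply: filterS => x Hx _; rewrite /= /h.
  have [xB|xB] := pselect (B x).
    by move: (Hx xB) => /= [] /eqP; rewrite subr_eq0 => /eqP <-; rewrite minxx fineK.
  by rewrite min_l ?fineK// leNgt; apply/negP.
exists h; split=> // A mA.
rewrite (_ : \int[mu]_(x in A) h x = L A); first exact: J_cvg.
have E : (\int[mu]_(x in A) g x = \int[mu]_(x in A) (EFin \o h) x)%E.
  apply: ae_eq_integral => //.
  - by apply: measurable_funTS; exact: measurable_int gint.
  - by apply: measurable_funTS; exact/measurable_EFinP.
  - exact: ae_eq_subset aegh.
by rewrite /Rintegral -[X in fine X]E -gE.
Qed.

End WeakLimit.

(** * Completeness of the cut norm *)

Section CutNorm.
Variable R : realType.
Local Notation TR := (measurableTypeR R).
Implicit Types (W V : TR * TR -> R) (S T : set TR).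

Local Notation la := (@lebesgue_measure R).
Local Notation la2 := (la \x la)%E.
Local Notation I01 := (`[0, 1]%classic : set TR).

Definition rect_int W S T : R := \int[la2]_(p in S `*` T) W p.

Definition bounded_mfun W :=
  measurable_fun setT W /\ exists M : R, forall p, `|W p| <= M.

Definition unit_subset S := measurable S /\ S `<=` I01.

Lemma la_I01 : la I01 = 1%E.
Proof. by rewrite lebesgue_measure_itv/= lte01 oppr0 adde0. Qed.

Lemma la_unit_subset S : unit_subset S -> (la S <= 1)%E.
Proof. by move=> [mS SI]; rewrite -la_I01 le_measure ?inE. Qed.

Lemma la_unit_subset_fin S : unit_subset S -> la S \is a fin_num.
Proof.
by move=> uS; rewrite ge0_fin_numE// (le_lt_trans (la_unit_subset uS))// ltry.
Qed.

Lemma la2_rect S T : unit_subset S -> unit_subset T ->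
  la2 (S `*` T) = (la S * la T)%E.
Proof. by move=> [mS _] [mT _]; rewrite product_measure1E. Qed.

Lemma la2_rect_le1 S T : unit_subset S -> unit_subset T -> (la2 (S `*` T) <= 1)%E.
Proof.
move=> uS uT; rewrite la2_rect// -[leRHS]mul1e.
by apply: lee_pmul => //; exact: la_unit_subset.
Qed.

Lemma bounded_mfun_int W A : bounded_mfun W -> measurable A ->
  (la2 A < +oo)%E -> la2.-integrable A (EFin \o W).
Proof.
move=> [mW [M WM]] mA Afin; apply: measurable_bounded_integrable => //.
  exact: measurable_funTS.
exists M; split; first exact: num_real.
by move=> x Mx p _ /=; rewrite (le_trans (WM p))// ltW.
Qed.

Lemma rect_integrable W S T : bounded_mfun W -> unit_subset S ->
  unit_subset T -> la2.-integrable (S `*` T) (EFin \o W).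
Proof.
move=> bW uS uT; apply: bounded_mfun_int => //.
  by apply: measurableX; [case: uS|case: uT].
by rewrite (le_lt_trans (la2_rect_le1 uS uT))// ltry.
Qed.

Lemma rect_intB W V S T : bounded_mfun W -> bounded_mfun V ->
  unit_subset S -> unit_subset T ->
  rect_int (W \- V) S T = rect_int W S T - rect_int V S T.
Proof.
move=> bW bV uS uT; apply: RintegralB; [|exact: rect_integrable..].
by apply: measurableX; [case: uS|case: uT].
Qed.

Lemma rect_intD W V S T : bounded_mfun W -> bounded_mfun V ->
  unit_subset S -> unit_subset T ->
  rect_int (W \+ V) S T = rect_int W S T + rect_int V S T.
Proof.
move=> bW bV uS uT; apply: RintegralD; [|exact: rect_integrable..].
by apply: measurableX; [case: uS|case: uT].
Qed.

Lemma rect_intZ (c : R) W S T : bounded_mfun W ->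
  unit_subset S -> unit_subset T ->
  rect_int (fun p => c * W p) S T = c * rect_int W S T.
Proof.
move=> bW uS uT; apply: RintegralZl; last exact: rect_integrable.
by apply: measurableX; [case: uS|case: uT].
Qed.

Lemma rect_int_le W S T (M : R) : measurable_fun setT W ->
  (forall p, `|W p| <= M) ->
  unit_subset S -> unit_subset T -> `|rect_int W S T| <= M.
Proof.
move=> mW WM uS uT.
have mST : measurable (S `*` T) by apply: measurableX; [case: uS|case: uT].
have bW : bounded_mfun W by split=> //; exists M.
have bn : bounded_mfun (Num.norm \o W).
  split; last by exists M => p /=; rewrite normr_id.
  exact: measurableT_comp.
have bM : bounded_mfun (cst M) by split; [exact: measurable_cst|exists `|M|].
rewrite /rect_int.
have iW := rect_integrable bW uS uT.
apply: (@le_trans _ _ (\int[la2]_(p in S `*` T) `|W p|)).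
  by have := le_normr_Rintegral mST iW; rewrite /=.
apply: (@le_trans _ _ (\int[la2]_(p in S `*` T) M)).
  by apply: le_Rintegral => //; [exact: (rect_integrable bn)|exact: (rect_integrable bM)].
rewrite Rintegral_cst//.
have M0 : 0 <= M by exact: le_trans (WM (0, 0)).
rewrite -[leRHS]mulr1 ler_wpM2l//.
have h := la2_rect_le1 uS uT.
by rewrite -[leRHS]/(fine 1%E) fine_le// ge0_fin_numE// (le_lt_trans h)// ltry.
Qed.

Lemma cut_norm_ub W S T : bounded_mfun W -> unit_subset S -> unit_subset T ->
  `|rect_int W S T| <= cut_norm W.
Proof.
move=> [mW [M WM]] [mS SI] [mT TI]; apply: ub_le_sup; last by exists S, T; split.
by exists M => r [A [B [mA mB AI BI ->]]]; exact: rect_int_le.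
Qed.

Lemma cut_norm_le W (c : R) :
  (forall S T, unit_subset S -> unit_subset T -> `|rect_int W S T| <= c) ->
  cut_norm W <= c.
Proof.
move=> H; apply: ge_sup.
  by exists `|rect_int W set0 set0|; exists set0, set0; split.
by move=> r [S [T [mS mT SI TI ->]]]; exact: H.
Qed.

Lemma cut_norm_ge0 W : bounded_mfun W -> 0 <= cut_norm W.
Proof.
move=> bW; have u0 : unit_subset set0 by split.
exact: le_trans (normr_ge0 _) (cut_norm_ub bW u0 u0).
Qed.

Lemma graphon_bmf (W : graphon R) : bounded_mfun W.
Proof. by split; [exact: graphon_meas|exact: graphon_bounded]. Qed.

Lemma bounded_mfunB W V : bounded_mfun W -> bounded_mfun V -> bounded_mfun (W \- V).
Proof.
move=> [mW [M WM]] [mV [N VN]]; split; first exact: measurable_funB.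
by exists (M + N) => p; apply: le_trans (ler_normB _ _) _; rewrite lerD.
Qed.

Lemma cut_norm_triangle W V U : bounded_mfun W -> bounded_mfun V ->
  bounded_mfun U -> cut_norm (W \- U) <= cut_norm (W \- V) + cut_norm (V \- U).
Proof.
move=> bW bV bU; apply: cut_norm_le => S T uS uT.
rewrite rect_intB//.
apply: le_trans (ler_distD (rect_int V S T) _ _) _.
by rewrite lerD// -rect_intB//; apply: cut_norm_ub => //; exact: bounded_mfunB.
Qed.

Lemma cut_normC W V : bounded_mfun W -> bounded_mfun V ->
  cut_norm (W \- V) = cut_norm (V \- W).
Proof.
suff H X Y : bounded_mfun X -> bounded_mfun Y ->
    cut_norm (X \- Y) <= cut_norm (Y \- X).
  by move=> bW bV; apply/eqP; rewrite eq_le !H.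
move=> bX bY; apply: cut_norm_le => S T uS uT.
rewrite rect_intB// distrC -rect_intB//.
by apply: cut_norm_ub => //; exact: bounded_mfunB.
Qed.

Lemma rect_int_swap W S T : bounded_mfun W -> (forall p, 0 <= W p) ->
  unit_subset S -> unit_subset T ->
  rect_int (fun p => W (p.2, p.1)) S T = rect_int W T S.
Proof.
move=> [mW _] W0 [mS _] [mT _].
have mST : measurable (S `*` T) by exact: measurableX.
have mTS : measurable (T `*` S) by exact: measurableX.
have msw : measurable_fun setT (fun p : TR * TR => W (p.2, p.1)).
  apply: (measurableT_comp mW); apply: measurable_fun_pair.
    exact: measurable_snd.
  exact: measurable_fst.
congr fine; rewrite integral_mkcond [RHS]integral_mkcond.
rewrite fubini_tonelli1/=; last 2 first.
- by apply/(measurable_restrictT _ mST)/measurable_EFinP; exact: measurable_funTS.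
- by move=> p; apply: erestrict_ge0 => q _; rewrite lee_fin.
rewrite fubini_tonelli2/=; last 2 first.
- by apply/(measurable_restrictT _ mTS)/measurable_EFinP; exact: measurable_funTS.
- by move=> p; apply: erestrict_ge0 => q _; rewrite lee_fin.
apply: eq_integral => x _; apply: eq_integral => y _.
rewrite !patchE/=; congr (if _ then _ else _).
by apply/idP/idP; rewrite !inE => -[].
Qed.

Lemma swap_mfun W : measurable_fun setT W ->
  measurable_fun setT (fun p : TR * TR => W (p.2, p.1)).
Proof.
move=> mW; apply: (measurableT_comp mW); apply: measurable_fun_pair.
  exact: measurable_snd.
exact: measurable_fst.
Qed.

Lemma la2_sigma_finite : sigma_finite setT la2.
Proof.
have /sigma_finiteP[F [TF ndF Foo]] := sigma_finiteT la.
exists (fun n => F n `*` F n); last first.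
  move=> n; have [mF Fn] := Foo n; split; first exact: measurableX.
  by rewrite product_measure1E// lte_mul_pinfty// ge0_fin_numE.
apply/seteqP; split=> // -[x y] _.
have [m _ Fx] : (\bigcup_n F n) x by rewrite -TF.
have [n _ Fy] : (\bigcup_n F n) y by rewrite -TF.
exists (maxn m n) => //; split.
  by move: x Fx; apply/subsetPset/ndF; exact: leq_maxl.
by move: y Fy; apply/subsetPset/ndF; exact: leq_maxr.
Qed.

(** A Cauchy sequence has convergent integrals over every rectangle; rectangles form a generating
    pi-system, so [weak_limit] yields a limit function. The Cauchy bound is uniform over rectangles
    and survives the passage to the limit in one index. *)
Lemma cut_norm_complete (W : nat -> graphon R) :
  (forall n p, 0 <= W n p <= 1) ->
  (forall e : R, 0 < e -> exists N, forall m n, (N <= m)%N -> (N <= n)%N ->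
    cut_norm (W m \- W n) <= e) ->
  exists V : graphon R, forall e : R, 0 < e ->
    exists N, forall n, (N <= n)%N -> cut_norm (W n \- V) <= e.
Proof.
move=> W01 WC.
pose D : set (TR * TR) := I01 `*` I01.
have uI : unit_subset I01 by split.
have mD : measurable D by exact: measurableX.
have bW n : bounded_mfun (W n) by exact: graphon_bmf.
have WD n p : 0 <= W n p <= \1_D p.
  have /andP[-> W1] := W01 n p; rewrite indicE.
  have [pD|pD] := boolP (p \in D); first by [].
  rewrite graphon_supp/= ?lexx// => Dp; move/negP : pD; apply; rewrite inE.
  exact: Dp.
(* The cut norm tests subsets of [0, 1] only, the generating pi-system contains all rectangles; the
   extension by 0 reconciles the two. *)
have rectE n S T : rect_int (W n) S T = rect_int (W n) (S `&` I01) (T `&` I01).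
  rewrite /rect_int setXI [RHS]Rintegral_mkcondr; congr fine.
  apply: eq_integral => p _; congr EFin; rewrite patchE; case: ifPn => // pD; rewrite graphon_supp// => Dp.
  by move/negP : pD; apply; rewrite inE.
have rect_cvg S T : measurable S -> measurable T ->
    cvgn (fun n => rect_int (W n) S T).
  move=> mS mT; apply: cauchy_cvgn => e /WC[N HN]; exists N => m n Nm Nn.
  apply: le_trans (HN _ _ Nm Nn).
  have uS : unit_subset (S `&` I01) by split; [exact: measurableI|move=> x []].
  have uT : unit_subset (T `&` I01) by split; [exact: measurableI|move=> x []].
  rewrite !(rectE _ S T) -rect_intB//; apply: cut_norm_ub => //.
  exact: bounded_mfunB.
pose G := [set A `*` B | A in @measurable _ TR & B in @measurable _ TR].
have GI : setI_closed G.
  move=> _ _ [A mA [B mB <-]] [A' mA' [B' mB' <-]].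
  exists (A `&` A'); first exact: measurableI.
  by exists (B `&` B'); [exact: measurableI|rewrite setXI].
have GT : <<s G >> = @measurable _ (TR * TR)%type.
  by rewrite measurable_prod_measurableType.
have Dfin : (la2 D < +oo)%E by exact: le_lt_trans (la2_rect_le1 uI uI) (ltry _).
have JT : cvgn (fun n => \int[la2]_(p in setT) W n p).
  by rewrite -setXTT; exact: rect_cvg.
have JG A : G A -> cvgn (fun n => \int[la2]_(p in A) W n p).
  by move=> [S mS [T mT <-]]; exact: rect_cvg.
have [h [mh h01 hW]] : exists h : TR * TR -> R,
    [/\ measurable_fun setT h, forall p, 0 <= h p <= \1_D p & forall A, measurable A ->
      \int[la2]_(p in A) W n p @[n --> \oo] --> \int[la2]_(p in A) h p].
  (* The canonical sigma-finite structure of a product measure found by unification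
     is that of a product of sub-probabilities. *)
  pose la2s : {sigma_finite_measure set (TR * TR)%type -> \bar R} :=
    HB.pack (Measure.sort la2) (Measure_isSigmaFinite.Build _ _ _ la2 la2_sigma_finite).
  exact: (@weak_limit _ (TR * TR)%type R la2s D (fun n => W n) G mD Dfin
    (fun n => (bW n).1) WD (esym GT) GI JT JG).
(* The density [h] is determined up to null sets, while a graphon is symmetric at every point.
   Averaging [h] with its transpose keeps all rectangle integrals of the limit, because those of
   [W n] are symmetric. *)
pose V (p : TR * TR) := 2^-1 * (h p + h (p.2, p.1)).
have h1 p : 0 <= h p <= 1.
  by have := h01 p; rewrite indicE => /andP[-> /le_trans]; apply; case: (_ \in _).
have V01 p : 0 <= V p <= 1.
  have /andP[? ?] := h1 p; have /andP[? ?] := h1 (p.2, p.1).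
  by rewrite /V; apply/andP; split; lra.
have msh := swap_mfun mh.
have mV : measurable_fun setT V.
  by apply: measurable_funM => //; apply: measurable_funD.
have VS p : ~ (`[0, 1]%classic `*` `[0, 1]%classic) p -> V p = 0.
  move=> nD; have h0 q : ~ D q -> h q = 0.
    move=> nDq; have := h01 q; rewrite indicE memNset//=.
    by move=> ?; apply/eqP; rewrite eq_le andbC.
  by rewrite /V !h0 ?addr0 ?mulr0//; case: p nD => x y nD [] /= ? ?; apply: nD.
have Vb : exists M : R, forall p, `|V p| <= M.
  by exists 1 => p; have /andP[V0 V1] := V01 p; rewrite ger0_norm.
have Vsym x y : V (x, y) = V (y, x) by rewrite /V/= addrC.
pose VG : graphon R := @Graphon R V VS mV Vb Vsym.
have bV : bounded_mfun V by [].
have bh : bounded_mfun h.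
  by split=> //; exists 1 => p; have /andP[? ?] := h1 p; rewrite ger0_norm.
have bsh : bounded_mfun (fun p => h (p.2, p.1)).
  by split=> //; exists 1 => p; have /andP[? ?] := h1 (p.2, p.1); rewrite ger0_norm.
have VE S T : unit_subset S -> unit_subset T ->
    rect_int V S T = 2^-1 * (rect_int h S T + rect_int h T S).
  move=> uS uT; rewrite -(@rect_int_swap h S T)//; last by move=> p; case/andP: (h1 p).
  rewrite -rect_intD// rect_intZ//; split; first exact: measurable_funD.
  exists 2 => p; have /andP[? ?] := h1 p; have /andP[? ?] := h1 (p.2, p.1).
  by rewrite ger0_norm /=; lra.
have Vlim S T : unit_subset S -> unit_subset T ->
    rect_int (W n) S T @[n --> \oo] --> rect_int V S T.
  move=> uS uT.
  have mST : measurable (S `*` T) by apply: measurableX; [case: uS|case: uT].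
  have mTS : measurable (T `*` S) by apply: measurableX; [case: uT|case: uS].
  have c1 := hW _ mST; have c2 := hW _ mTS.
  have E n : rect_int (W n) T S = rect_int (W n) S T.
    rewrite -(@rect_int_swap (W n) S T)//; last by move=> p; case/andP: (W01 n p).
    by congr fine; apply: eq_integral => -[x y] _; rewrite graphon_sym.
  have c3 : rect_int (W n) S T @[n --> \oo] --> rect_int h T S.
    apply: cvg_trans c2; apply: near_eq_cvg; apply: nearW => n; exact: E.
  rewrite VE// (_ : rect_int h T S = rect_int h S T).
    by rewrite (_ : 2^-1 * _ = rect_int h S T)//; lra.
  exact: (cvg_unique _ c3 c1).
exists VG => e /WC[N HN]; exists N => n Nn; apply: cut_norm_le => S T uS uT.
rewrite rect_intB//.
(* Fix n and let m tend to infinity in the Cauchy bound. *)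
have c : `|rect_int (W n) S T - rect_int (W m) S T| @[m --> \oo] -->
    `|rect_int (W n) S T - rect_int V S T|.
  apply: cvg_norm; apply: cvgB; [exact: cvg_cst|exact: Vlim].
apply: (closed_cvg (fun x => x <= e) _ _ _ c) => //.
exists N => // m /= Nm; apply: le_trans (HN _ _ Nn Nm).
by rewrite -rect_intB//; apply: cut_norm_ub => //; exact: bounded_mfunB.
Qed.


End CutNorm.

(** * Integrals of labeled graphons over rectangles *)

Section Parts.
Variable R : realType.
Local Notation TR := (measurableTypeR R).
Implicit Types (S T A : set TR).

Definition lam A : R := fine (@lebesgue_measure R A).

Lemma lam_ge0 A : 0 <= lam A.
Proof. exact: fine_ge0. Qed.

Lemma lamU A B : unit_subset A -> unit_subset B -> A `&` B = set0 ->
  lam (A `|` B) = lam A + lam B.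
Proof.
move=> uA uB AB; rewrite /lam measureU//; [|by case: uA|by case: uB].
by rewrite fineD//; exact: la_unit_subset_fin.
Qed.

Lemma unit_subsetI S A : unit_subset S -> measurable A -> unit_subset (S `&` A).
Proof. by move=> [mS SI] mA; split; [exact: measurableI|move=> x [/SI]]. Qed.

Lemma lam_le S T : unit_subset S -> unit_subset T -> S `<=` T -> lam S <= lam T.
Proof.
move=> uS uT ST; apply: fine_le; [exact: la_unit_subset_fin..|].
by rewrite le_measure ?inE; [|case: uS|case: uT|].
Qed.

Lemma lam_le1 S : unit_subset S -> lam S <= 1.
Proof.
move=> uS; rewrite -[leRHS]/(fine 1%E) fine_le//; last exact: la_unit_subset.
exact: la_unit_subset_fin.
Qed.

(** The first k of n intervals form an initial segment of length k/n, so the part of [S] that they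
    cover depends on the ratio k/n alone, and does so in a 1-Lipschitz way. This allows graphs of
    different sizes to be tested on the same set [S]. *)
Definition cumul S (t : R) : R := lam (S `&` `[0, t]).

Lemma cumulB S (s t : R) : unit_subset S -> 0 <= s -> s <= t ->
  cumul S t - cumul S s = lam (S `&` `]s, t]).
Proof.
move=> uS s0 st; rewrite /cumul.
have -> : S `&` `[0, t] = (S `&` `[0, s]) `|` (S `&` `]s, t]).
  rewrite -setIUr; congr (_ `&` _); apply/seteqP; split=> x /=; rewrite !in_itv/=.
    by move=> /andP[-> xt]; case: (leP x s) => xs; [left|right].
  by case=> /andP[h1 h2]; apply/andP; split; lra.
rewrite lamU; [by rewrite addrC addKr|exact: unit_subsetI..|].
rewrite setIACA setIid (_ : _ `&` `]s, t] = set0) ?setI0//.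
by apply/seteqP; split=> x //=; rewrite !in_itv/=; case=> /andP[? ?] /andP[? ?]; lra.
Qed.

Lemma cumul_lip S (s t : R) : unit_subset S -> 0 <= s -> 0 <= t ->
  `|cumul S t - cumul S s| <= `|t - s|.
Proof.
move=> uS; wlog st : s t / s <= t.
  move=> H s0 t0; case: (leP s t) => [st|/ltW ts]; first exact: H.
  by rewrite distrC [leRHS]distrC; exact: H.
move=> s0 t0; rewrite cumulB// ger0_norm ?lam_ge0// ger0_norm ?subr_ge0//.
have -> : t - s = fine (@lebesgue_measure R `]s, t]).
  rewrite lebesgue_measure_itv/=; case: ifPn => //.
  by rewrite lte_fin -leNgt => ts; apply/eqP; rewrite /= subr_eq0 eq_le ts st.
apply: fine_le; [exact/la_unit_subset_fin/unit_subsetI| |].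
  by rewrite lebesgue_measure_itv/=; case: ifP.
by apply: le_measure; rewrite ?inE//; case: (unit_subsetI uS (measurable_itv `]s, t])).
Qed.

Lemma cumul0 S : unit_subset S -> cumul S 0 = 0.
Proof.
move=> uS; apply/eqP; rewrite eq_le lam_ge0 andbT /cumul.
apply: (@le_trans _ _ (fine (@lebesgue_measure R `[0, 0]))); last first.
  by rewrite lebesgue_measure_itv/= ltxx.
apply: fine_le; [exact/la_unit_subset_fin/unit_subsetI| |].
  by rewrite lebesgue_measure_itv/=; case: ifP.
by apply: le_measure; rewrite ?inE//; case: (unit_subsetI uS (measurable_itv `[0, 0])).
Qed.

Lemma cumul1 S : unit_subset S -> cumul S 1 = lam S.
Proof. by move=> [mS SI]; rewrite /cumul setIidl. Qed.

Lemma part_unit n (i : 'I_n) : unit_subset (part i : set TR).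
Proof. by split; [exact: measurable_part|exact: part_sub01]. Qed.

Lemma lam_part S n (i : 'I_n) : unit_subset S ->
  lam (S `&` part i) = cumul S (i.+1%:R / n%:R) - cumul S (i%:R / n%:R).
Proof.
move=> uS; rewrite /part; case: ifPn => i0.
  by rewrite (eqP i0) mul0r cumul0// subr0 div1r.
rewrite cumulB ?divr_ge0// ler_pM2r ?invr_gt0 ?ltr0n ?ler_nat//.
exact: leq_ltn_trans (ltn_ord i).
Qed.

Lemma sum_lam_part S n k : unit_subset S -> (k <= n)%N ->
  \sum_(i < n | (i < k)%N) lam (S `&` part i) = cumul S (k%:R / n%:R).
Proof.
move=> uS kn.
under eq_bigr => i _ do rewrite lam_part//.
rewrite -(big_ord_widen n (fun i => cumul S (i.+1%:R / n%:R) - cumul S (i%:R / n%:R)))//.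
rewrite -(big_mkord xpredT (fun i => cumul S (i.+1%:R / n%:R) - cumul S (i%:R / n%:R))).
rewrite (telescope_sumr (fun i : nat => cumul S (i%:R / n%:R)))//.
by rewrite mul0r cumul0// subr0.
Qed.

Lemma part_inj n (i j : 'I_n) (x : R) : part i x -> part j x -> i = j.
Proof.
have n0 : (0 : R) < n%:R by rewrite ltr0n (leq_ltn_trans _ (ltn_ord i)).
have b (k : 'I_n) : part k x -> x <= k.+1%:R / n%:R /\
    ((0 < k)%N -> k%:R / n%:R < x).
  rewrite /part; case: ifPn => k0 /=; rewrite in_itv/= => /andP[h1 h2]; split=> //.
    by rewrite (eqP k0) div1r.
  by rewrite (eqP k0).
suff lt_part (k m : 'I_n) : part k x -> part m x -> ~ (k < m)%N.
  move=> pi pj; apply/val_inj => /=.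
  by case: (ltngtP i j) => // [/(lt_part _ _ pi pj)|/(lt_part _ _ pj pi)].
move=> /b[xk _] /b[_ mx] km; have {}mx := mx (leq_ltn_trans (leq0n _) km).
have := lt_le_trans mx xk; rewrite ltr_pM2r ?invr_gt0// ltr_nat.
by rewrite ltnNge km.
Qed.

Lemma lam_sum_part S n : unit_subset S -> (0 < n)%N ->
  lam S = \sum_(i < n) lam (S `&` part i).
Proof.
move=> uS n0; rewrite -(cumul1 uS) -[1](@divff _ n%:R) ?pnatr_eq0 -?lt0n//.
by rewrite -sum_lam_part//; apply: eq_bigl => i; rewrite ltn_ord.
Qed.

Lemma box_mfun A B (c : R) : measurable A -> measurable B ->
  bounded_mfun (fun p : TR * TR => c * \1_(A `*` B) p).
Proof.
move=> mA mB; split.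
  apply: measurable_funM => //; apply: measurable_indic; exact: measurableX.
exists `|c| => p; rewrite normrM indicE; case: (_ \in _); rewrite ?normr1 ?normr0 ?mulr1//.
by rewrite mulr0.
Qed.

Lemma rect_int_box S T A B (c : R) : unit_subset S -> unit_subset T ->
  measurable A -> measurable B ->
  rect_int (fun p => c * \1_(A `*` B) p) S T = c * (lam (S `&` A) * lam (T `&` B)).
Proof.
move=> uS uT mA mB.
have uSA := unit_subsetI uS mA; have uTB := unit_subsetI uT mB.
rewrite rect_intZ//; last first.
  by have := box_mfun 1 mA mB; under eq_fun do rewrite mul1r.
congr (_ * _); rewrite /rect_int /Rintegral integral_indic; last 2 first.
- by apply: measurableX; [case: uS|case: uT].
- exact: measurableX.
rewrite (setIC (A `*` B)) -setXI [X in fine X](la2_rect uSA uTB) fineM//;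
  exact: la_unit_subset_fin.
Qed.

Lemma rect_int_sum (I : Type) (s : seq I) (P : pred I) (W : I -> TR * TR -> R) S T :
  (forall i, bounded_mfun (W i)) -> unit_subset S -> unit_subset T ->
  bounded_mfun (fun p => \sum_(i <- s | P i) W i p) /\
  rect_int (fun p => \sum_(i <- s | P i) W i p) S T = \sum_(i <- s | P i) rect_int (W i) S T.
Proof.
move=> bW uS uT.
have b0 : bounded_mfun (fun=> 0 : R).
  by split; [exact: measurable_cst|exists 0 => p; rewrite normr0].
elim: s => [|i s [IHb IH]].
  rewrite big_nil (_ : (fun p => _) = fun=> 0); last first.
    by apply/funext => p; rewrite big_nil.
  split=> //; rewrite -[X in rect_int X](_ : (fun p => 0 * 0) = _); last first.
    by apply/funext => p; rewrite mul0r.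
  by rewrite rect_intZ// mul0r.
rewrite big_cons (_ : (fun p => _) = (fun p => if P i then
    W i p + \sum_(j <- s | P j) W j p else \sum_(j <- s | P j) W j p)); last first.
  by apply/funext => p; rewrite big_cons.
case: ifP => // _; split; last by rewrite rect_intD// IH.
have [mi [Mi HMi]] := bW i; have [ms [Ms HMs]] := IHb; split.
  exact: measurable_funD.
by exists (Mi + Ms) => p; apply: le_trans (ler_normD _ _) _; rewrite lerD.
Qed.

Lemma graphon_of_sum (G : sgraph) (l : 'I_#|G| -> G) : @graphon_of_fun R G l =
  (fun p => \sum_(i < #|G|) \sum_(j < #|G|)
    (adj (l i) (l j))%:R * \1_(part i `*` part j) p).
Proof.
apply/funext => p; rewrite /graphon_of_fun indicE.
case: (pselect (exists ij : 'I_#|G| * 'I_#|G|, part ij.1 p.1 /\ part ij.2 p.2)) => H; last first.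
  rewrite memNset ?big1// => [i _|[i [j [pi pj _]]]]; last by apply: H; exists (i, j).
  rewrite big1// => j _; rewrite indicE memNset ?mulr0// => -[pi pj].
  by apply: H; exists (i, j).
have [[i j] /= [pi pj]] := H.
rewrite (bigD1 i)//= [X in _ = _ + X]big1 ?addr0; last first.
  move=> k ki; rewrite big1// => m _; rewrite indicE memNset ?mulr0// => -[pk _].
  by move/eqP : ki; apply; exact: part_inj pk pi.
rewrite (bigD1 j)//= [X in _ = _ + X]big1 ?addr0; last first.
  move=> k kj; rewrite indicE memNset ?mulr0// => -[_ pk].
  by move/eqP : kj; apply; exact: part_inj pk pj.
rewrite indicE [X in _ * X](_ : _ = 1) ?mulr1; last by rewrite mem_set.
congr (nat_of_bool _)%:R; apply/idP/idP; rewrite inE.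
  by move=> [k [m [pk pm]]]; rewrite (part_inj pi pk) (part_inj pj pm).
by move=> a; exists i, j.
Qed.

Lemma rect_int_graphon_of (G : sgraph) (l : 'I_#|G| -> G) S T :
  unit_subset S -> unit_subset T ->
  rect_int (graphon_of R l) S T = \sum_(i < #|G|) \sum_(j < #|G|)
    lam (S `&` part i) * lam (T `&` part j) * (adj (l i) (l j))%:R.
Proof.
move=> uS uT; rewrite /graphon_of/= graphon_of_sum.
have bb i j : bounded_mfun (fun p : TR * TR =>
    (adj (l i) (l j))%:R * \1_(part i `*` part j) p).
  by apply: box_mfun; exact: measurable_part.
rewrite (rect_int_sum _ _ (fun i => (rect_int_sum _ _ (bb i) uS uT).1) uS uT).2.
apply: eq_bigr => i _; rewrite (rect_int_sum _ _ (bb i) uS uT).2.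
apply: eq_bigr => j _; rewrite rect_int_box//; [|exact: measurable_part..].
by rewrite mulrC.
Qed.

End Parts.

(** * Cut distance versus cut norm *)

Section CutDistance.
Variable R : realType.
Local Notation TR := (measurableTypeR R).

Lemma lam_part1 n (i : 'I_n) : lam (part i : set TR) = n%:R^-1.
Proof.
have n0 : (0 : R) < n%:R by rewrite ltr0n (leq_ltn_trans _ (ltn_ord i)).
rewrite /lam /part; case: ifPn => _; rewrite lebesgue_measure_itv/= lte_fin.
  by rewrite invr_gt0 n0 /= subr0.
by rewrite ltr_pM2r ?invr_gt0// ltr_nat ltnSn/= -mulrBl -natrB// subSnn mul1r.
Qed.

Section Overlay.
Variables (G G' : sgraph) (l : 'I_#|G| -> G) (l' : 'I_#|G'| -> G').
Variables (g : G -> 'I_#|G|) (g' : G' -> 'I_#|G'|).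
Hypotheses (lK : cancel l g) (gK : cancel g l) (lK' : cancel l' g') (gK' : cancel g' l').

(** Placing both node sets on the same interval [0, 1] couples them: a pair gets the length of the
    overlap of its two intervals. *)
Let X (x : G) (u : G') : R := lam (part (g x) `&` part (g' u) : set TR).

Let cell (S : {set G * G'}) : set TR :=
  [set t | exists x u, [/\ (x, u) \in S, part (g x) t & part (g' u) t]].

Let cell_unit S : unit_subset (cell S).
Proof.
split; last by move=> t [x [u [_ /part_sub01]]].
rewrite (_ : cell S = \bigcup_(p in [set p : G * G' | p \in S])
    (part (g p.1) `&` part (g' p.2))).
  apply: fin_bigcup_measurable => [|p _]; first exact: finite_finset.
  by apply: measurableI; exact: measurable_part.
apply/seteqP; split=> t.
  by move=> [x [u [xu ? ?]]]; exists (x, u).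
by move=> [[x u] /= xu [? ?]]; exists x, u.
Qed.

Let sum_part' (S : set TR) : unit_subset S ->
  lam S = \sum_(u : G') lam (S `&` part (g' u)).
Proof.
move=> uS; rewrite (lam_sum_part uS (vertex_gt0 G')).
by rewrite [RHS](reindex l')/=; [apply: eq_bigr => i _; rewrite lK'|exists g' => ? _].
Qed.

Let sum_part (S : set TR) : unit_subset S ->
  lam S = \sum_(x : G) lam (S `&` part (g x)).
Proof.
move=> uS; rewrite (lam_sum_part uS (vertex_gt0 G)).
by rewrite [RHS](reindex l)/=; [apply: eq_bigr => i _; rewrite lK|exists g => ? _].
Qed.

Let part2_unit x u : unit_subset (part (g x) `&` part (g' u) : set TR).
Proof. by apply: unit_subsetI; [exact: part_unit|exact: measurable_part]. Qed.

Let X_overlay : fractional_overlay X.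
Proof.
split=> [i u|x|u]; first exact: lam_ge0.
  by rewrite -sum_part' ?lam_part1//; exact: part_unit.
rewrite -(lam_part1 (g' u)) (sum_part (part_unit _ (g' u))).
by apply: eq_bigr => x _; rewrite /X setIC.
Qed.

Let lam_cell S x : lam (cell S `&` part (g x)) = \sum_(u | (x, u) \in S) X x u.
Proof.
rewrite sum_part'; last by apply: unit_subsetI; [exact: cell_unit|exact: measurable_part].
rewrite [RHS]big_mkcond/=; apply: eq_bigr => u _.
rewrite /X; case: ifPn => xu.
  congr lam; apply/seteqP; split=> t; first by move=> [[]].
  by move=> [px pu]; split=> //; split=> //; exists x, u.
rewrite -[RHS](_ : lam set0 = 0); last by rewrite /lam measure0.
congr lam; apply/seteqP; split=> // t [[[y [v [yv py pv]]] px] pu].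
by move/negP : xu; apply; rewrite -(gK x) -(gK' u) (part_inj px py) (part_inj pu pv) gK gK'.
Qed.

Let lam_cell' S u : lam (cell S `&` part (g' u)) = \sum_(x | (x, u) \in S) X x u.
Proof.
rewrite sum_part; last by apply: unit_subsetI; [exact: cell_unit|exact: measurable_part].
rewrite [RHS]big_mkcond/=; apply: eq_bigr => x _.
rewrite /X; case: ifPn => xu.
  congr lam; apply/seteqP; split=> t; first by move=> [[]].
  by move=> [px pu]; split=> //; split=> //; exists x, u.
rewrite -[RHS](_ : lam set0 = 0); last by rewrite /lam measure0.
congr lam; apply/seteqP; split=> // t [[[y [v [yv py pv]]] pu] px].
by move/negP : xu; apply; rewrite -(gK x) -(gK' u) (part_inj px py) (part_inj pu pv) gK gK'.
Qed.

Let overlay_sum (S T : {set G * G'}) :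
  \sum_(p in S) \sum_(q in T) X p.1 p.2 * X q.1 q.2 *
    ((adj p.1 q.1)%:R - (adj p.2 q.2)%:R) =
  rect_int (graphon_of R l \- graphon_of R l') (cell S) (cell T).
Proof.
have uS := cell_unit S; have uT := cell_unit T.
rewrite rect_intB; [|exact: graphon_bmf|exact: graphon_bmf|by []|by []].
rewrite !rect_int_graphon_of//.
have -> : \sum_(i < #|G|) \sum_(j < #|G|) lam (cell S `&` part i) *
      lam (cell T `&` part j) * (adj (l i) (l j))%:R =
    \sum_x \sum_y (\sum_(u | (x, u) \in S) X x u) *
      (\sum_(u | (y, u) \in T) X y u) * (adj x y)%:R.
  rewrite (reindex g)/=; last by exists l => ? _.
  apply: eq_bigr => x _; rewrite (reindex g)/=; last by exists l => ? _.
  by apply: eq_bigr => y _; rewrite !gK !lam_cell.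
have -> : \sum_(i < #|G'|) \sum_(j < #|G'|) lam (cell S `&` part i) *
      lam (cell T `&` part j) * (adj (l' i) (l' j))%:R =
    \sum_u \sum_v (\sum_(x | (x, u) \in S) X x u) *
      (\sum_(x | (x, v) \in T) X x v) * (adj u v)%:R.
  rewrite (reindex g')/=; last by exists l' => ? _.
  apply: eq_bigr => u _; rewrite (reindex g')/=; last by exists l' => ? _.
  by apply: eq_bigr => v _; rewrite !gK' !lam_cell'.
transitivity (\sum_(p in S) \sum_(q in T) X p.1 p.2 * X q.1 q.2 * (adj p.1 q.1)%:R -
  \sum_(p in S) \sum_(q in T) X p.1 p.2 * X q.1 q.2 * (adj p.2 q.2)%:R).
  rewrite -sumrB; apply: eq_bigr => p _; rewrite -sumrB; apply: eq_bigr => q _.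
  by rewrite mulrBr.
congr (_ - _).
  transitivity (\sum_x \sum_(u | (x, u) \in S) \sum_y \sum_(v | (y, v) \in T)
      X x u * X y v * (adj x y)%:R).
    rewrite [RHS]pair_big_dep/=; apply: eq_big => [[x u]//|[x u] _/=].
    by rewrite [RHS]pair_big_dep/=; apply: eq_big => [[y v]//|[y v] _/=].
  apply: eq_bigr => x _; rewrite exchange_big/=; apply: eq_bigr => y _.
  rewrite -mulrA mulr_suml; apply: eq_bigr => u _.
  by rewrite mulr_suml mulr_sumr; apply: eq_bigr => v _; rewrite mulrA.
transitivity (\sum_u \sum_(x | (x, u) \in S) \sum_v \sum_(y | (y, v) \in T)
    X x u * X y v * (adj u v)%:R).
  rewrite [RHS](exchange_big_dep xpredT)//= [RHS]pair_big_dep/=.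
  apply: eq_big => [[x u]//|[x u] _/=].
  rewrite [RHS](exchange_big_dep xpredT)//= [RHS]pair_big_dep/=.
  by apply: eq_big => [[y v]//|[y v] _/=].
apply: eq_bigr => u _; rewrite exchange_big/=; apply: eq_bigr => v _.
rewrite -mulrA mulr_suml; apply: eq_bigr => x _.
by rewrite mulr_suml mulr_sumr; apply: eq_bigr => y _; rewrite mulrA.
Qed.

(** For the overlay [X], a set of pairs corresponds to a union of overlaps, its [cell], and the
    overlay sum is the integral of the difference of graphons over a product of cells. The cut norm
    runs over more test sets, and the cut distance over more overlays. *)
Lemma cut_distance_le :
  cut_distance R G G' <= cut_norm (graphon_of R l \- graphon_of R l').
Proof.
have bb : bounded_mfun (graphon_of R l \- graphon_of R l').
  by apply: bounded_mfunB; exact: graphon_bmf.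
apply: (@le_trans _ _ (overlay_cut X)).
  apply: ge_inf; last by exists X.
  exists 0 => _ [Y _ <-].
  by rewrite /overlay_cut; apply: bigmax_ge_id.
apply: bigmax_le; first exact: cut_norm_ge0.
move=> S _; apply: bigmax_le; first exact: cut_norm_ge0.
by move=> T _; rewrite overlay_sum; apply: cut_norm_ub.
Qed.

End Overlay.

End CutDistance.

(** * Graphons of vertex-colored graphs sorted by color *)

(** Cumulative on purpose: once nodes are sorted by [k], these numbers are the end points in [0, 1]
    of the segments occupied by the keys. *)
Definition freq (R : realType) (G : sgraph) (k : G -> nat) (a : nat) : R :=
  #|[set x | (k x < a)%N]%SET|%:R / #|G|%:R.

(** A down-closed set containing [i] contains the [i.+1] indices up to [i]; one that misses [i] lies
    below it. *)
Lemma card_prefix n (P : pred 'I_n) :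
  (forall i j : 'I_n, (i <= j)%N -> P j -> P i) -> forall i, P i = (i < #|P|)%N.
Proof.
move=> Pdown i; have winj m (mn : (m <= n)%N) : injective (widen_ord mn).
  by move=> a b /(congr1 val) /= ab; apply: val_inj.
apply/idP/idP => [Pi|].
  rewrite -[i.+1]card_ord -(fintype.card_image (winj _ (ltn_ord i))).
  apply: subset_leq_card; apply/fintype.subsetP => _ /fintype.imageP[j _ ->].
  by apply: (Pdown _ i) => //=; rewrite -ltnS.
apply: contraTT => nPi; rewrite -leqNgt -[leqRHS]card_ord.
rewrite -(fintype.card_image (winj _ (ltnW (ltn_ord i)))).
apply: subset_leq_card; apply/fintype.subsetP => j Pj.
have ji : (j < i)%N by rewrite ltnNge; apply: contra nPi => ij; exact: Pdown ij Pj.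
by apply/fintype.imageP; exists (Ordinal ji) => //; exact: val_inj.
Qed.

Section Sorted.
Variable R : realType.
Local Notation TR := (measurableTypeR R).

(** For a sorted labeling this is the measure of [S] inside the segment of key [a], expressed
    without the labeling. *)
Definition mass (S : set TR) (G : sgraph) (k : G -> nat) (a : nat) : R :=
  cumul S (freq R k a.+1) - cumul S (freq R k a).

Section Keys.
Variables (G : sgraph) (l : 'I_#|G| -> G) (k : G -> nat) (Q : nat).
Hypothesis l_bij : bijective l.
Hypothesis k_sorted : forall i j : 'I_#|G|, (i <= j)%N -> (k (l i) <= k (l j))%N.
Hypothesis k_lt : forall x, (k x < Q)%N.

Lemma sum_key_lt (S : set TR) a : unit_subset S ->
  \sum_(i < #|G| | (k (l i) < a)%N) lam (S `&` part i) = cumul S (freq R k a).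
Proof.
move=> uS; rewrite /freq -sum_lam_part//; last exact: max_card.
have -> : #|[set x | (k x < a)%N]%SET| = #|[pred i | (k (l i) < a)%N]|.
  rewrite -sum1_card -[RHS]sum1_card/= (reindex l)/=; last exact: onW_bij.
  by apply: eq_bigl => j; rewrite inE.
apply: eq_bigl => i; apply: (@card_prefix _ [pred i | (k (l i) < a)%N]).
by move=> {}i j ij /=; apply: leq_ltn_trans; exact: k_sorted.
Qed.

Lemma sum_key_eq (S : set TR) a : unit_subset S ->
  \sum_(i < #|G| | k (l i) == a) lam (S `&` part i) = mass S k a.
Proof.
move=> uS; rewrite /mass -!sum_key_lt// [X in _ = X - _](bigID (fun i => (k (l i) < a)%N))/=.
rewrite [X in _ = X + _ - _](eq_bigl (fun i => (k (l i) < a)%N)); last first.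
  by move=> i; apply/andP/idP => [[]//|h]; split=> //; exact: leqW h.
rewrite [X in _ = X - _]addrC addrK; apply: eq_bigl => i.
by rewrite -leqNgt eqn_leq.
Qed.

Lemma mass_ge0 (S : set TR) a : unit_subset S -> 0 <= mass S k a.
Proof. by move=> uS; rewrite -sum_key_eq//; apply: sumr_ge0 => i _; exact: lam_ge0. Qed.

Lemma sum_mass (S : set TR) : unit_subset S -> \sum_(a < Q) mass S k a <= 1.
Proof.
move=> uS; apply: le_trans (lam_le1 uS).
rewrite (lam_sum_part uS (vertex_gt0 G)).
rewrite (partition_big (fun i => Ordinal (k_lt (l i))) xpredT)//=.
by apply: ler_sum => a _; rewrite -sum_key_eq.
Qed.

Lemma rect_int_approx (S T : set TR) (D : nat -> nat -> R) (c : R) :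
  unit_subset S -> unit_subset T ->
  cut_le (fun x y => (adj x y)%:R - D (k x) (k y)) (c * #|G|%:R ^+ 2) ->
  `|rect_int (graphon_of R l) S T -
    \sum_(a < Q) \sum_(b < Q) mass S k a * mass T k b * D a b| <= c.
Proof.
move=> uS uT cutU.
have k_lt_l i : (k (l i) < Q)%N by exact: k_lt.
pose K i := Ordinal (k_lt_l i).
have -> : \sum_(a < Q) \sum_(b < Q) mass S k a * mass T k b * D a b =
    \sum_(i < #|G|) \sum_(j < #|G|)
      lam (S `&` part i) * lam (T `&` part j) * D (k (l i)) (k (l j)).
  rewrite [RHS](partition_big K xpredT)//=; apply: eq_bigr => a _.
  rewrite exchange_big [RHS](partition_big K xpredT)//=; apply: eq_bigr => b _.
  rewrite -(sum_key_eq _ uS) -(sum_key_eq _ uT).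
  rewrite exchange_big/= -mulrA mulr_suml; apply: eq_big => // i /eqP ka.
  rewrite mulr_suml mulr_sumr; apply: eq_big => // j /eqP kb.
  by rewrite ka kb mulrA.
rewrite rect_int_graphon_of// -sumrB.
under eq_bigr => i _ do rewrite -sumrB.
under eq_bigr => i _ do under eq_bigr => j _ do rewrite -mulrBr.
have [g lK gK] := l_bij.
have n0 : (0 : R) < #|G|%:R by rewrite ltr0n vertex_gt0.
(* The fraction of the interval of node [x] that [U] covers: a weight in [0, 1], for which the cut
   bound of the remainder holds. *)
pose w U x : R := #|G|%:R * lam (U `&` part (g x)).
have w01 U x : unit_subset U -> 0 <= w U x <= 1.
  move=> uU; rewrite /w mulr_ge0 ?lam_ge0//= -ler_pdivlMl// mulr1.
  rewrite -(lam_part1 R (g x)); apply: lam_le; last by move=> ? [].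
    by apply: unit_subsetI => //; exact: measurable_part.
  exact: part_unit.
have := cut_le_weight cutU (fun x => w01 S x uS) (fun x => w01 T x uT).
rewrite (reindex l)/=; last by exists g => ? _.
have -> : \sum_(i < #|G|) \sum_y w S (l i) * w T y *
      ((adj (l i) y)%:R - D (k (l i)) (k y)) =
    #|G|%:R ^+ 2 * \sum_(i < #|G|) \sum_(j < #|G|) lam (S `&` part i) *
      lam (T `&` part j) * ((adj (l i) (l j))%:R - D (k (l i)) (k (l j))).
  rewrite mulr_sumr; apply: eq_bigr => i _.
  rewrite (reindex l)/=; last by exists g => ? _.
  by rewrite mulr_sumr; apply: eq_bigr => j _; rewrite /w !lK; ring.
rewrite normrM [`|#|G|%:R ^+ 2|]ger0_norm ?exprn_ge0// [c * _]mulrC.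
by rewrite ler_pM2l ?exprn_gt0.
Qed.

End Keys.

(** The term [2 * c] pays for replacing both graphs by [D]. Each mass changes by at most [2 * e], as
    both ends of its segment move by at most [e]. Switching the two factors of a product of masses
    in turn, and using that masses add up to at most 1, costs [2 * e * Q] twice. *)
Lemma graphon_close (G G' : sgraph) (l : 'I_#|G| -> G) (l' : 'I_#|G'| -> G')
    (k : G -> nat) (k' : G' -> nat) (D : nat -> nat -> R) (Q : nat) (c e : R) :
  bijective l -> bijective l' ->
  (forall i j : 'I_#|G|, (i <= j)%N -> (k (l i) <= k (l j))%N) ->
  (forall i j : 'I_#|G'|, (i <= j)%N -> (k' (l' i) <= k' (l' j))%N) ->
  (forall x, (k x < Q)%N) -> (forall x, (k' x < Q)%N) ->
  (forall a b, 0 <= D a b <= 1) ->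
  cut_le (fun x y => (adj x y)%:R - D (k x) (k y)) (c * #|G|%:R ^+ 2) ->
  cut_le (fun x y => (adj x y)%:R - D (k' x) (k' y)) (c * #|G'|%:R ^+ 2) ->
  (forall a, (a <= Q)%N -> `|freq R k a - freq R k' a| <= e) ->
  cut_norm (graphon_of R l \- graphon_of R l') <= 2 * c + 4 * Q%:R * e.
Proof.
move=> lb lb' ks ks' kQ kQ' D01 kc kc' fe.
have e0 : 0 <= e by exact: le_trans (normr_ge0 _) (fe 0%N (leq0n _)).
apply: cut_norm_le => S T uS uT.
rewrite rect_intB; [|exact: graphon_bmf|exact: graphon_bmf|by []|by []].
have h1 := rect_int_approx lb ks kQ uS uT kc.
have h2 := rect_int_approx lb' ks' kQ' uS uT kc'.
set M := \sum_(a < Q) _ in h1; set M' := \sum_(a < Q) _ in h2.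
suff h3 : `|M - M'| <= 4 * Q%:R * e.
  move: h1 h2 h3; rewrite !ler_norml => /andP[? ?] /andP[? ?] /andP[? ?].
  by apply/andP; split; lra.
have massB U (uU : unit_subset U) a : (a < Q)%N -> `|mass U k a - mass U k' a| <= 2 * e.
  move=> aQ; rewrite /mass.
  have f0 (H : sgraph) (h : H -> nat) b : 0 <= freq R h b by rewrite divr_ge0.
  have c1 := cumul_lip uU (f0 _ k' a.+1) (f0 _ k a.+1).
  have c2 := cumul_lip uU (f0 _ k' a) (f0 _ k a).
  have := le_trans c1 (fe _ aQ); have := le_trans c2 (fe _ (ltnW aQ)).
  by rewrite !ler_norml => /andP[? ?] /andP[? ?]; apply/andP; split; lra.
have step (a b : 'I_Q) : `|mass S k a * mass T k b * D a b - mass S k' a * mass T k' b * D a b|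
    <= 2 * e * mass T k b + 2 * e * mass S k' a.
  have m1 : 0 <= mass T k b by exact: (mass_ge0 lb ks _ uT).
  have m2 : 0 <= mass S k' a by exact: (mass_ge0 lb' ks' _ uS).
  rewrite -mulrBl normrM; have /andP[D0 D1] := D01 a b.
  rewrite [`|D a b|]ger0_norm//.
  apply: (@le_trans _ _ (`|mass S k a * mass T k b - mass S k' a * mass T k' b|)).
    by rewrite -[leRHS]mulr1 ler_wpM2l.
  have -> : mass S k a * mass T k b - mass S k' a * mass T k' b =
    (mass S k a - mass S k' a) * mass T k b + mass S k' a * (mass T k b - mass T k' b).
    by ring.
  apply: le_trans (ler_normD _ _) _; rewrite !normrM (ger0_norm m1) (ger0_norm m2).
  rewrite [mass S k' a * _]mulrC.
  by apply: lerD; apply: ler_wpM2r => //; apply: massB.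
apply: (@le_trans _ _ (\sum_(a < Q) \sum_(b < Q) (2 * e * mass T k b + 2 * e * mass S k' a))).
  rewrite /M /M' -sumrB; apply: le_trans (ler_norm_sum _ _ _) _.
  apply: ler_sum => a _; rewrite -sumrB; apply: le_trans (ler_norm_sum _ _ _) _.
  by apply: ler_sum => b _; exact: step.
under eq_bigr => a _ do rewrite big_split/= -mulr_sumr sumr_const card_ord.
rewrite big_split/= sumr_const card_ord sumrMnl -mulr_sumr.
have s1 := sum_mass lb ks kQ uT; have s2 := sum_mass lb' ks' kQ' uS.
rewrite -mulr_natr -[X in _ + X]mulr_natr.
have Q0 : (0 : R) <= Q%:R by [].
have eQ : 0 <= 2 * e * Q%:R by rewrite !mulr_ge0.
have t1 := ler_wpM2l eQ s1; have t2 := ler_wpM2l eQ s2.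
lra.
Qed.

End Sorted.

(** * Averages over tuples of sampled nodes *)

Section Sampling.
Variables (R : realType) (V : finType).

(** Removing [X] is a bijection onto the subsets of the complement of [X] of size [k - #|X|]. *)
Lemma card_supersets k (X : {set V}) : (#|X| <= k)%N ->
  #|[set S : {set V} | (#|S| == k) && (X \subset S)]%SET| =
  'C(#|V| - #|X|, k - #|X|).
Proof.
move=> Xk; have -> : (#|V| - #|X| = #|~: X|)%N by rewrite -(cardsC X) addKn.
rewrite -cards_draws -(card_in_imset (f := fun S => S :\: X)); last first.
  move=> S S'; rewrite !inE => /andP[_ XS] /andP[_ XS'] E.
  by rewrite -(finset.setID S X) -(finset.setID S' X) E (finset.setIidPr XS) (finset.setIidPr XS').
congr #|pred_of_set _|; apply/finset.setP => A; rewrite inE; apply/idP/idP.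
  move=> /imsetP[S]; rewrite inE => /andP[/eqP Sk XS] ->.
  by rewrite {1}finset.setDE finset.subsetIr/= cardsD (finset.setIidPr XS) Sk.
move=> /andP[AX /eqP Ak]; apply/imsetP; exists (A :|: X).
  rewrite inE finset.subsetUr andbT cardsU disjoint_setI0; last by rewrite finset.disjoints_subset.
  by rewrite cards0 subn0 Ak subnK.
rewrite finset.setDUl finset.setDv finset.setU0; apply/esym/finset.setDidPl.
by rewrite finset.disjoints_subset.
Qed.

(** A tuple that is not injective has a coincidence at one of fewer than [r ^ 2] pairs of positions,
    and each pair accounts for a fraction 1/m of all tuples. *)
Lemma inj_tuple_gap (m r : nat) :
  m%:R * ((m ^ r)%:R - (m ^_ r)%:R) <= (r ^ 2)%:R * (m ^ r)%:R :> R.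
Proof.
elim: r => [|r IH]; first by rewrite expn0 ffactn0 subrr mulr0 mulr_ge0.
rewrite ffactnSr expnSr.
have ffle : (m ^_ r)%:R <= (m ^ r)%:R :> R.
  rewrite ler_nat; elim: {IH} r => // r IH.
  by rewrite ffactnSr expnSr leq_mul// leq_subr.
have [mr|rm] := leqP r m; last first.
  rewrite ffact_small// mul0n subr0 -!natrM ler_nat.
  have -> : (r.+1 ^ 2 * (m ^ r * m) = m ^ r * m * r.+1 ^ 2)%N by lia.
  rewrite mulnC leq_mul2l; apply/orP; right; nia.
rewrite !natrX in IH ffle; rewrite !natrM natrB// !natrX -[r.+1%:R]natr1.
set p := m%:R ^+ r in IH ffle *; set q := (m ^_ r)%:R in IH ffle *.
have m0 : (0 : R) <= m%:R by []; have r0 : (0 : R) <= r%:R by [].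
have p0 : 0 <= p by exact: exprn_ge0.
have h1 := ler_wpM2l m0 IH.
have h2 := ler_wpM2l (mulr_ge0 m0 r0) ffle.
have h3 := mulr_ge0 (mulr_ge0 m0 r0) p0.
have h4 := mulr_ge0 m0 p0.
lra.
Qed.

Definition tuples (r : nat) (A : {set V}) := [pred x : {ffun 'I_r -> V} | x \in ffun_on (mem A)].

(** Double counting: every injective tuple lies in the same number of k-subsets. The ratio of the
    constants comes from the case of the constant function 1, which spares a computation with
    binomials. *)
Lemma sum_inj_tuples k r (g : {ffun 'I_r -> V} -> R) : (r <= k)%N ->
  (#|V| ^_ r)%:R * \sum_(S : {set V} | #|S| == k)
    \sum_(x in tuples r S | injectiveb x) g x =
  ('C(#|V|, k) * k ^_ r)%:R * \sum_(x : {ffun 'I_r -> V} | injectiveb x) g x.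
Proof.
move=> rk.
have E (h : {ffun 'I_r -> V} -> R) : \sum_(S : {set V} | #|S| == k)
    \sum_(x in tuples r S | injectiveb x) h x =
    ('C(#|V| - r, k - r))%:R * \sum_(x : {ffun 'I_r -> V} | injectiveb x) h x.
  rewrite (exchange_big_dep (fun x : {ffun 'I_r -> V} => injectiveb x))/=; last first.
    by move=> S x _ /andP[].
  rewrite mulr_sumr; apply: eq_bigr => x xinj.
  have cx : #|[set x i | i : 'I_r]%SET| = r.
    by rewrite card_imset ?card_ord//; exact/injectiveP.
  have := @card_supersets k [set x i | i : 'I_r]%SET; rewrite cx => /(_ rk) <-.
  rewrite sumr_const mulr_natl; congr (_ *+ _); apply: eq_card => S.
  rewrite inE -[LHS]/([&& #|S| == k, x \in tuples r S & injectiveb x]) xinj andbT inE.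
  congr (_ && _); apply/ffun_onP/fintype.subsetP => H.
    by move=> _ /imsetP[i _ ->]; exact: H.
  by move=> i; apply: H; exact: imset_f.
have := E (fun=> 1); have {}E := E g.
rewrite (eq_bigr (fun=> (k ^_ r)%:R)); last first.
  move=> S /eqP Sk; rewrite sumr_const -[in RHS]Sk -[in RHS](card_ord r).
  rewrite -(card_inj_ffuns_on 'I_r (mem S)); congr _%:R; apply: eq_card => x.
  by rewrite !inE.
rewrite !sumr_const -(card_draws V k).
have -> : #|[pred x : {ffun 'I_r -> V} | injectiveb x]| = (#|V| ^_ r)%N.
  rewrite -[in RHS](card_ord r) -(card_inj_ffuns 'I_r V); apply: eq_card => x.
  by rewrite !inE.
rewrite E mulrA => E1; congr (_ * _); rewrite mulrC -E1 natrM mulr_natl.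
by congr (_ *+ _); apply: eq_card => S; rewrite !inE.
Qed.

Lemma ffact_expn_le m r : (m ^_ r <= m ^ r)%N.
Proof. by elim: r => // r IH; rewrite ffactnSr expnSr leq_mul// leq_subr. Qed.

Lemma card_tuples r (A : {set V}) : #|tuples r A| = (#|A| ^ r)%N.
Proof.
by rewrite -[in RHS](card_ord r) -card_ffun_on; apply: eq_card => x; rewrite !inE.
Qed.

Lemma card_inj_tuples r (A : {set V}) :
  #|[pred x in tuples r A | injectiveb x]| = (#|A| ^_ r)%N.
Proof.
rewrite -[in RHS](card_ord r) -(card_inj_ffuns_on 'I_r (mem A)).
by apply: eq_card => x; rewrite !inE.
Qed.

Lemma avg_inj_tuples r (A : {set V}) (g : {ffun 'I_r -> V} -> R) :
  (0 < #|A|)%N -> (r <= #|A|)%N -> (forall x, `|g x| <= 1) ->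
  `|(\sum_(x in tuples r A) g x) / (#|A| ^ r)%:R -
    (\sum_(x in tuples r A | injectiveb x) g x) / (#|A| ^_ r)%:R|
  <= 2 * (r ^ 2)%:R / #|A|%:R.
Proof.
move=> A0 rA g1; rewrite (bigID (fun x : {ffun 'I_r -> V} => injectiveb x))/=.
set s := (X in (X + _) / _); set t := (X in (_ + X) / _).
set a := #|A|; set p : R := (a ^ r)%:R; set q : R := (a ^_ r)%:R.
have p0 : 0 < p by rewrite ltr0n expn_gt0 A0.
have q0 : 0 < q by rewrite ltr0n ffact_gt0.
have a0 : (0 : R) < a%:R by rewrite ltr0n.
have qp : q <= p by rewrite ler_nat ffact_expn_le.
have gap : 1 - q / p <= (r ^ 2)%:R / a%:R.
  rewrite ler_pdivlMr// mulrC -[X in X - _](@divff _ p) ?lt0r_neq0// -mulrBl mulrA.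
  by rewrite ler_pdivrMr//; exact: inj_tuple_gap.
have ss : `|s| <= q.
  apply: le_trans (ler_norm_sum _ _ _) _; rewrite /q -card_inj_tuples.
  apply: (@le_trans _ _ (\sum_(x : {ffun 'I_r -> V} | (x \in tuples r A) && injectiveb x) 1)); first exact: ler_sum.
  by rewrite sumr_const.
have tt : `|t| <= p - q.
  apply: le_trans (ler_norm_sum _ _ _) _; rewrite /p /q /a -card_tuples -card_inj_tuples.
  apply: (@le_trans _ _ (\sum_(x : {ffun 'I_r -> V} | (x \in tuples r A) && ~~ injectiveb x) 1)); first exact: ler_sum.
  rewrite lerBrDl -!sumr_const [leRHS](bigID (fun x : {ffun 'I_r -> V} => injectiveb x))/=.
  by [].
(* Both the contribution of the noninjective tuples and the change of denominator cost at most
   [1 - q / p], whence the factor 2. *)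
have -> : (s + t) / p - s / q = t / p - (s / q) * (1 - q / p).
  by field; rewrite !lt0r_neq0.
apply: le_trans (ler_normB _ _) _.
have h1 : `|t / p| <= 1 - q / p.
  rewrite normrM normfV (gtr0_norm p0) ler_pdivrMr// mulrBl mul1r mulfVK ?lt0r_neq0//.
have h2 : `|s / q * (1 - q / p)| <= 1 - q / p.
  have h : 0 <= 1 - q / p by rewrite subr_ge0 ler_pdivrMr// mul1r.
  rewrite normrM (ger0_norm h) -[leRHS]mul1r ler_wpM2r//.
  by rewrite normrM normfV (gtr0_norm q0) ler_pdivrMr// mul1r.
move: h1 h2 gap; set v := 1 - _; rewrite -[2 * _ / _]mulrA; set w := _%:R / _.
by move=> h1 h2 gap; lra.
Qed.

(* The passage to injective tuples, whose law is the same for a uniform k-subset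
   as for the whole node set, costs O(r^2 / k) on each side. *)
Lemma sampling_avg k r (g : {ffun 'I_r -> V} -> R) :
  (0 < k)%N -> (r <= k)%N -> (k <= #|V|)%N -> (forall x, `|g x| <= 1) ->
  `|(\sum_(S : {set V} | #|S| == k) (\sum_(x in tuples r S) g x) / (k ^ r)%:R)
      / 'C(#|V|, k)%:R - (\sum_x g x) / (#|V| ^ r)%:R| <= 4 * (r ^ 2)%:R / k%:R.
Proof.
move=> k0 rk kV g1.
have V0 := leq_trans k0 kV; have rV := leq_trans rk kV.
have hV := @avg_inj_tuples r [set: V]%SET g; rewrite !cardsT in hV.
have {}hV := hV V0 rV g1.
have C0 : (0 : R) < 'C(#|V|, k)%:R by rewrite ltr0n bin_gt0.
have kr0 : (0 : R) < (k ^_ r)%:R by rewrite ltr0n ffact_gt0.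
have Vr0 : (0 : R) < (#|V| ^_ r)%:R by rewrite ltr0n ffact_gt0.
have eV : (\sum_(x in tuples r [set: V]%SET | injectiveb x) g x) / (#|V| ^_ r)%:R =
    (\sum_(S : {set V} | #|S| == k)
      (\sum_(x in tuples r S | injectiveb x) g x) / (k ^_ r)%:R) / 'C(#|V|, k)%:R.
  rewrite -mulr_suml; apply/eqP; rewrite -mulrA -invfM eqr_div ?lt0r_neq0 ?mulr_gt0//.
  have := sum_inj_tuples g rk; rewrite natrM => /esym E.
  rewrite mulrC [(k ^_ r)%:R * _]mulrC; apply/eqP.
  transitivity ('C(#|V|, k)%:R * (k ^_ r)%:R * \sum_(x : {ffun 'I_r -> V} | injectiveb x) g x).
    by congr (_ * _); apply: eq_bigl => x; rewrite inE; case: ffun_onP => // -[] i; rewrite inE.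
  by rewrite E mulrC.
rewrite eV in hV.
have hS : `|(\sum_(S : {set V} | #|S| == k) (\sum_(x in tuples r S) g x) / (k ^ r)%:R)
      / 'C(#|V|, k)%:R - (\sum_(S : {set V} | #|S| == k)
      (\sum_(x in tuples r S | injectiveb x) g x) / (k ^_ r)%:R) / 'C(#|V|, k)%:R|
    <= 2 * (r ^ 2)%:R / k%:R.
  rewrite -mulrBl -sumrB normrM normfV (gtr0_norm C0) ler_pdivrMr//.
  apply: le_trans (ler_norm_sum _ _ _) _.
  have -> : 2 * (r ^ 2)%:R / k%:R * 'C(#|V|, k)%:R =
      \sum_(S : {set V} | #|S| == k) (2 * (r ^ 2)%:R / k%:R) :> R.
    rewrite -(card_draws V k) [LHS]mulr_natr sumr_const.
    by congr (_ *+ _); apply: eq_card => S; rewrite !inE.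
  apply: ler_sum => S /eqP Sk.
  by have := @avg_inj_tuples r S g; rewrite Sk; exact.
have kV' : 2 * (r ^ 2)%:R / #|V|%:R <= 2 * (r ^ 2)%:R / k%:R :> R.
  by rewrite ler_wpM2l// ler_pV2 ?inE ?unitfE ?ltr0n ?pnatr_eq0 -?lt0n// ?V0 ?k0// ler_nat.
have sV : \sum_(x in tuples r [set: V]%SET) g x = \sum_x g x.
  by apply: eq_bigl => x; rewrite inE; case: ffun_onP => // -[] i; rewrite inE.
rewrite sV in hV.
move: hS hV kV'; rewrite !ler_norml => /andP[? ?] /andP[? ?] ?.
by apply/andP; split; lra.
Qed.


End Sampling.

Lemma card_ksubset (G : sgraph) k : #|{: ksubset k G}| = 'C(#|G|, k).
Proof. by rewrite card_sig -card_draws; apply: eq_card => S; rewrite !inE. Qed.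

Lemma sum_ksubset (R : realType) (G : sgraph) k (F : {set G} -> R) :
  \sum_(S : ksubset k G) F (val S) = \sum_(S : {set G} | #|S| == k) F S.
Proof. by rewrite -(big_sub (fun S : {set G} => #|S| == k)). Qed.

(** * Cut norm and frequencies of a sample *)

Section TupleSums.
Variables (R : realType) (V : finType) (A : {set V}).

Definition fcons r (a : V) (y : {ffun 'I_r -> V}) : {ffun 'I_r.+1 -> V} :=
  [ffun i => if unlift ord0 i is Some j then y j else a].

Lemma fcons0 r a (y : {ffun 'I_r -> V}) : fcons a y ord0 = a.
Proof. by rewrite ffunE unlift_none. Qed.

Lemma fconsS r a (y : {ffun 'I_r -> V}) i : fcons a y (lift ord0 i) = y i.
Proof. by rewrite ffunE liftK. Qed.

Lemma sum_tuplesS r (F : {ffun 'I_r.+1 -> V} -> R) :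
  \sum_(x in tuples r.+1 A) F x =
  \sum_(a in A) \sum_(y in tuples r A) F (fcons a y).
Proof.
rewrite pair_big/= (reindex (fun p : V * {ffun 'I_r -> V} => fcons p.1 p.2))/=.
  apply: eq_bigl => -[a y]; rewrite !inE/=; apply/ffun_onP/andP => [H|[aA /ffun_onP H] i].
    split; first by rewrite -(fcons0 a y).
    by apply/ffun_onP => i; rewrite -(fconsS a y).
  by rewrite ffunE; case: unliftP.
exists (fun x : {ffun 'I_r.+1 -> V} => (x ord0, [ffun i => x (lift ord0 i)])).
  by move=> [a y] _; rewrite fcons0; congr pair; apply/ffunP => i; rewrite ffunE fconsS.
move=> x _; apply/ffunP => i; rewrite ffunE/=.
by case: unliftP => [j ->|-> //]; rewrite ffunE.
Qed.

Lemma sum_tuples0 (F : {ffun 'I_0 -> V} -> R) :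
  \sum_(x in tuples 0 A) F x = F (ffun0 (card_ord 0)).
Proof.
set x0 := ffun0 _; rewrite (big_pred1 x0)// => x; rewrite inE.
have -> : x = x0 by apply/ffunP => -[].
by rewrite [RHS]eqxx; apply/ffun_onP => -[].
Qed.

Definition o0 {r} : 'I_r.+1 := ord0.
Definition o1 {r} : 'I_r.+2 := lift ord0 o0.
Definition o2 {r} : 'I_r.+3 := lift ord0 o1.
Definition o3 {r} : 'I_r.+4 := lift ord0 o2.

Lemma sum_tuples2 (F : V -> V -> R) :
  \sum_(x in tuples 2 A) F (x o0) (x o1) = \sum_(a in A) \sum_(b in A) F a b.
Proof.
rewrite sum_tuplesS; apply: eq_bigr => a _; rewrite sum_tuplesS; apply: eq_bigr => b _.
by rewrite sum_tuples0 /o1 /o0 ?fconsS !fcons0.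
Qed.

Lemma sum_tuples4 (F : V -> V -> V -> V -> R) :
  \sum_(x in tuples 4 A) F (x o0) (x o1) (x o2) (x o3) =
  \sum_(a in A) \sum_(b in A) \sum_(c in A) \sum_(d in A) F a b c d.
Proof.
rewrite sum_tuplesS; apply: eq_bigr => a _; rewrite sum_tuplesS; apply: eq_bigr => b _.
rewrite sum_tuplesS; apply: eq_bigr => c _; rewrite sum_tuplesS; apply: eq_bigr => d _.
by rewrite sum_tuples0 /o3 /o2 /o1 /o0 ?fconsS !fcons0.
Qed.

End TupleSums.

Section Samples.
Variables (R : realType) (G : sgraph) (k : nat).
Hypotheses (k_ge4 : (4 <= k)%N) (kG : (k <= #|G|)%N).

Definition c4_on (U : G -> G -> R) (S : {set G}) : R :=
  \sum_(x' in S) \sum_(y' in S) \sum_(x in S) \sum_(y in S)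
    U x y * U x' y * U x y' * U x' y'.

Definition avg (F : {set G} -> R) : R :=
  (\sum_(S : {set G} | #|S| == k) F S) / 'C(#|G|, k)%:R.

(** The term [4 * e] bounds the density of four-cycles in the whole graph; 64 is [4 * r ^ 2] from
    [sampling_avg] with r = 4. *)
Lemma avg_c4 (U : G -> G -> R) (e : R) : (forall x y, `|U x y| <= 1) ->
  cut_le U (e * #|G|%:R ^+ 2) ->
  avg (fun S => c4_on U S / (k ^ 4)%:R) <= 4 * e + 64 / k%:R.
Proof.
move=> U1 Ue.
have k0 : (0 < k)%N by exact: leq_trans k_ge4.
pose g (x : {ffun 'I_4 -> G}) : R :=
  U (x o2) (x o3) * U (x o0) (x o3) * U (x o2) (x o1) * U (x o0) (x o1).
have g1 x : `|g x| <= 1.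
  by rewrite /g !normrM !mulr_ile1// ?mulr_ge0.
have := sampling_avg k0 k_ge4 kG g1.
rewrite ler_norml => /andP[_]; rewrite lerBlDr => h.
rewrite /avg; apply: le_trans (le_trans h _).
  rewrite ler_pM2r ?invr_gt0 ?ltr0n ?bin_gt0//; apply: ler_sum => S _.
  by rewrite (sum_tuples4 _ (fun a b c d => U c d * U a d * U c b * U a b)).
rewrite addrC -natrM lerD//.
have -> : \sum_x g x = c4 U.
  have := sum_tuples4 [set: G]%SET (fun a b c d => U c d * U a d * U c b * U a b).
  have inT : tuples 4 [set: G]%SET =i predT.
    by move=> x; rewrite !inE; apply/ffun_onP => i; rewrite inE.
  rewrite (eq_bigl _ _ inT) => ->.
  do 4! (apply: eq_big => [x|? _]; [by rewrite inE|]).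
  by [].
rewrite ler_pdivrMr ?ltr0n ?expn_gt0 ?(leq_trans k0)//.
apply: le_trans (c4_le U1 Ue) _; rewrite natrX le_eqVlt; apply/orP; left; apply/eqP; ring.
Qed.

Lemma c4_on_sub (U : G -> G -> R) (S : {set G}) :
  c4_on U S = c4 (fun x y : {x | x \in S} => U (val x) (val y)).
Proof.
rewrite /c4_on /c4 (big_sub S); apply: eq_bigr => x' _.
rewrite (big_sub S); apply: eq_bigr => y' _; rewrite (big_sub S); apply: eq_bigr => x _.
by rewrite (big_sub S).
Qed.

Lemma c4_on_ge0 U S : 0 <= c4_on U S.
Proof. by rewrite c4_on_sub c4_ge0. Qed.

Definition dev (A S : {set G}) : R := #|S :&: A|%:R / k%:R - #|A|%:R / #|G|%:R.

(** The squared deviation is an average over pairs of a product of centered weights. Over all of [G]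
    this average is 0, so only the sampling error [4 * 2 ^ 2 / k] remains. *)
Lemma avg_dev (A : {set G}) : avg (fun S => dev A S ^+ 2) <= 16 / k%:R.
Proof.
have k0 : (0 < k)%N by exact: leq_trans k_ge4.
have n0 : (0 : R) < #|G|%:R by rewrite ltr0n (leq_trans k0).
pose p : R := #|A|%:R / #|G|%:R.
have p01 : 0 <= p <= 1.
  by rewrite divr_ge0//= ler_pdivrMr// mul1r ler_nat max_card.
pose w (v : G) : R := (v \in A)%:R - p.
have w1 v : `|w v| <= 1.
  by rewrite /w ler_norml; case: (v \in A) => /=; apply/andP; split; lra.
pose g (x : {ffun 'I_2 -> G}) : R := w (x o0) * w (x o1).
have g1 x : `|g x| <= 1 by rewrite /g normrM mulr_ile1.
have := sampling_avg k0 (leq_trans _ k_ge4) kG g1 => /(_ isT).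
have sumw (S : {set G}) : \sum_(v in S) w v = #|S :&: A|%:R - p * #|S|%:R.
  rewrite sumrB sumr_const -[p *+ _]mulr_natr; congr (_ - _).
  rewrite -sum1_card natr_sum [RHS]big_mkcond [LHS]big_mkcond/=; apply: eq_bigr => v _.
  by rewrite inE; case: (v \in S); case: (v \in A).
have sumg (S : {set G}) : \sum_(x in tuples 2 S) g x = (\sum_(v in S) w v) ^+ 2.
  rewrite (sum_tuples2 S (fun a b => w a * w b)) expr2 mulr_suml.
  by apply: eq_bigr => a _; rewrite mulr_sumr.
have -> : \sum_x g x = 0.
  have inT : tuples 2 [set: G]%SET =i predT.
    by move=> x; rewrite !inE; apply/ffun_onP => i; rewrite inE.
  rewrite -(eq_bigl _ _ inT) sumg sumw finset.setTI cardsT /p mulfVK ?lt0r_neq0//.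
  by rewrite subrr expr0n.
rewrite mul0r subr0 ler_norml => /andP[_].
have -> : 4 * (2 ^ 2)%:R = 16 :> R by rewrite -natrM.
apply: le_trans; rewrite ler_pM2r ?invr_gt0 ?ltr0n ?bin_gt0//.
apply: ler_sum => S /eqP Sk; rewrite sumg sumw Sk /dev -/p natrX.
have k0R : k%:R != 0 :> R by rewrite pnatr_eq0 -lt0n.
by rewrite le_eqVlt; apply/orP; left; apply/eqP; field.
Qed.

(* By Markov's inequality for the sum of all the normalized defects. *)
Lemma good_sample (eps eta : R) (J m : nat) (U : 'I_J -> G -> G -> R)
    (e tau : 'I_J -> R) (A : 'I_m -> {set G}) (P : pred (ksubset k G)) :
  0 < eta -> (forall j, 0 < tau j) ->
  (forall j x y, `|U j x y| <= 1) ->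
  (forall j, cut_le (U j) (e j * #|G|%:R ^+ 2)) ->
  eps < Pr_ksubset R P ->
  \sum_j (4 * e j + 64 / k%:R) / tau j + m%:R * (16 / k%:R / eta ^+ 2) <= eps ->
  exists S : ksubset k G, [/\ P S,
    forall j, c4_on (U j) (val S) <= tau j * (k ^ 4)%:R &
    forall i, `|dev (A i) (val S)| <= eta].
Proof.
move=> eta0 tau0 U1 Ue PP sum_le.
have k0 : (0 < k)%N by exact: leq_trans k_ge4.
have k4 : (0 : R) < (k ^ 4)%:R by rewrite ltr0n expn_gt0 k0.
have C0 : (0 : R) < 'C(#|G|, k)%:R by rewrite ltr0n bin_gt0.
pose Z (S : {set G}) : R := \sum_j c4_on (U j) S / (k ^ 4)%:R / tau j +
  \sum_i dev (A i) S ^+ 2 / eta ^+ 2.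
have t1 j S : 0 <= c4_on (U j) S / (k ^ 4)%:R / tau j.
  by rewrite !divr_ge0 ?c4_on_ge0// ltW.
have t2 i S : 0 <= dev (A i) S ^+ 2 / eta ^+ 2 by rewrite divr_ge0 ?sqr_ge0.
have EZ : avg Z <= eps.
  apply: le_trans sum_le; rewrite /avg /Z big_split/= mulrDl.
  apply: lerD.
    rewrite exchange_big/= mulr_suml; apply: ler_sum => j _.
    rewrite -mulr_suml mulrAC ler_pM2r ?invr_gt0//.
    exact: avg_c4.
  rewrite exchange_big/= mulr_suml.
  have -> : m%:R * (16 / k%:R / eta ^+ 2) = \sum_(i < m) (16 / k%:R / eta ^+ 2).
    by rewrite sumr_const card_ord [LHS]mulr_natl.
  apply: ler_sum => i _.
  rewrite -mulr_suml mulrAC ler_pM2r ?invr_gt0 ?exprn_gt0//.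
  exact: avg_dev.
have [S PS ZS] : exists2 S : ksubset k G, P S & Z (val S) <= 1.
  apply: contrapT => nZ; move: PP; apply/negP; rewrite -leNgt.
  apply: le_trans EZ; rewrite /Pr_ksubset /avg card_ksubset ler_pM2r ?invr_gt0//.
  rewrite -sum_ksubset -sum1_card natr_sum [leLHS]big_mkcond/=.
  apply: ler_sum => S _.
  rewrite inE; case: ifPn => PS; last by rewrite addr_ge0// sumr_ge0.
  by apply/ltW; rewrite ltNge; apply/negP => ZS; apply: nZ; exists S.
have Zc j : c4_on (U j) (val S) / (k ^ 4)%:R / tau j <= 1.
  apply: le_trans ZS; rewrite /Z (bigD1 j)//= -addrA lerDl addr_ge0//; exact: sumr_ge0.
have Zd i : dev (A i) (val S) ^+ 2 / eta ^+ 2 <= 1.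
  apply: le_trans ZS; rewrite /Z addrC (bigD1 i)//= -addrA lerDl addr_ge0//; exact: sumr_ge0.
exists S; split=> // [j|i].
  by have := Zc j; rewrite ler_pdivrMr// mul1r ler_pdivrMr.
have := Zd i; rewrite ler_pdivrMr ?exprn_gt0// mul1r -[leLHS]real_normK ?num_real//.
by rewrite ler_sqr// nnegrE// ltW.
Qed.

End Samples.

(** * From graphon functionals to testability *)

Lemma sorted_labeling (G : sgraph) (K : G -> nat) :
  exists2 l : 'I_#|G| -> G, bijective l &
    forall i j : 'I_#|G|, (i <= j)%N -> (K (l i) <= K (l j))%N.
Proof.
have [x0 _] : exists x : G, true by have /card_gt0P[x _] := vertex_gt0 G; exists x.
pose le := relpre K leq; pose s := sort le (enum G).
have le_tr : transitive le by move=> ? ? ?; exact: leq_trans.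
have le_tot : total le by move=> ? ?; exact: leq_total.
have ss : size s = #|G| by rewrite size_sort -cardE.
have us : uniq s by rewrite sort_uniq enum_uniq.
exists (fun i => nth x0 s i).
  apply: inj_card_bij; last by rewrite card_ord.
  move=> i j /eqP; rewrite nth_uniq ?ss//; [|exact: ltn_ord..].
  by move=> /eqP ij; exact: val_inj.
move=> i j ij; apply: (@sorted_leq_nth _ le) => //; rewrite ?inE ?ss ?ltn_ord//.
- by move=> x; exact: leqnn.
- exact: sort_sorted.
Qed.

Section Keys.
Variables (q : nat -> nat) (T : Type) (s : nat -> T -> nat).
Hypothesis sq : forall j x, (s j x < q j)%N.

(* Mixed-radix encoding of the colors, so that comparing keys of a higher level
   refines the comparison at each lower level. *)
Fixpoint key j x : nat := if j is i.+1 then (key i x * q i + s i x)%N else 0.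

Definition key_bound j : nat := (\prod_(i < j) q i)%N.

Lemma key_lt j x : (key j x < key_bound j)%N.
Proof.
rewrite /key_bound; elim: j => [|j IH]; first by rewrite big_ord0.
rewrite big_ord_recr/=; have := sq j x; move: IH; set a := key j x; set b := s j x.
by set p := (\prod_(i < j) _)%N; nia.
Qed.

Lemma key_mod j x : (key j.+1 x %% q j = s j x)%N.
Proof. by rewrite /= modnMDl modn_small. Qed.

Lemma key_mono j n x y : (j <= n)%N -> (key n x <= key n y)%N -> (key j x <= key j y)%N.
Proof.
elim: n => [|n IH]; first by rewrite leqn0 => /eqP ->.
rewrite leq_eqVlt => /orP[/eqP -> //|]; rewrite ltnS => jn h; apply: IH => //.
have kE z : (key n z = key n.+1 z %/ q n)%N.
  by rewrite /= divnMDl ?divn_small ?addn0// (leq_ltn_trans _ (sq n z)).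
by rewrite !kE leq_div2r.
Qed.

End Keys.

Section Models.
Variable R : realType.
Variables (Q N : nat -> nat) (D : nat -> nat -> nat -> nat -> R).

(** One labeling is sorted for the keys of all levels below [n] at once. The index [a j] selects one
    of [N j] kernels fixed in advance, so graphs that share it are compared through their
    frequencies alone. *)
Definition modelled (n : nat) (G : sgraph) (a : nat -> nat) (k : nat -> G -> nat)
    (l : 'I_#|G| -> G) :=
  bijective l /\ forall j, (j < n)%N -> [/\ (a j < N j)%N, forall x, (k j x < Q j)%N,
    forall i i' : 'I_#|G|, (i <= i')%N -> (k j (l i) <= k j (l i'))%N &
    cut_le (fun x y => (adj x y)%:R - D j (a j) (k j x) (k j y))
      (2^-1 ^+ j * #|G|%:R ^+ 2)].

Lemma modelled_close n m (G H : sgraph) a b (k : nat -> G -> nat) (k' : nat -> H -> nat)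
    (l : 'I_#|G| -> G) (l' : 'I_#|H| -> H) j (e : R) :
  (forall j a x y, 0 <= D j a x y <= 1) ->
  modelled n a k l -> modelled m b k' l' -> (j < n)%N -> (j < m)%N -> a j = b j ->
  (forall c, (c <= Q j)%N -> `|freq R (k j) c - freq R (k' j) c| <= e) ->
  cut_norm (graphon_of R l \- graphon_of R l') <= 2 * 2^-1 ^+ j + 4 * (Q j)%:R * e.
Proof.
move=> D01 [lb mG] [lb' mH] jn jm ab fe.
have [aN kQ ks kc] := mG _ jn; have [bN kQ' ks' kc'] := mH _ jm.
by apply: (graphon_close lb lb' ks ks' kQ kQ' (D01 j (a j))) => //; rewrite ab.
Qed.

End Models.

Lemma regularity_family (R : realType) (e : nat -> R) : (forall j, 0 < e j) ->
  exists (q N : nat -> nat) (d : nat -> nat -> nat -> nat -> R),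
    (forall j a x y, 0 <= d j a x y <= 1) /\
    forall G : sgraph, exists (a : nat -> nat) (s : nat -> G -> nat), forall j,
      [/\ (a j < N j)%N, forall x, (s j x < q j)%N &
        cut_le (fun x y => (adj x y)%:R - d j (a j) (s j x) (s j y))
          (e j * #|G|%:R ^+ 2)].
Proof.
move=> e0.
have H j : exists p : nat * nat * (nat -> nat -> nat -> R),
    (forall a x y, 0 <= p.2 a x y <= 1) /\
    forall G : sgraph, exists (a : nat) (s : G -> nat),
      [/\ (a < p.1.2)%N, forall x, (s x < p.1.1)%N &
        cut_le (fun x y => (adj x y)%:R - p.2 a (s x) (s y)) (e j * #|G|%:R ^+ 2)].
  by have [q [N [d [d01 h]]]] := weak_regularity (e0 j); exists (q, N, d).
have {H}[p Hp] := choice H.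
exists (fun j => (p j).1.1), (fun j => (p j).1.2), (fun j => (p j).2).
split=> [j|G]; first by case: (Hp j).
have HG j : exists as_ : nat * (G -> nat),
    [/\ (as_.1 < (p j).1.2)%N, forall x, (as_.2 x < (p j).1.1)%N &
        cut_le (fun x y => (adj x y)%:R - (p j).2 as_.1 (as_.2 x) (as_.2 y))
          (e j * #|G|%:R ^+ 2)].
  by have [_ /(_ G)[a [s ?]]] := Hp j; exists (a, s).
have [as_ Has] := choice HG.
by exists (fun j => (as_ j).1), (fun j => (as_ j).2).
Qed.

Lemma sum_half_powers (R : realType) n : \sum_(j < n) 2^-1 ^+ j <= 2 :> R.
Proof.
have -> : \sum_(j < n) 2^-1 ^+ j = 2 - 2 * 2^-1 ^+ n :> R.
  elim: n => [|n IH]; first by rewrite big_ord0 expr0 mulr1 subrr.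
  rewrite big_ord_recr/= IH exprS; set z := 2^-1 ^+ n; lra.
by rewrite gerBl mulr_ge0// exprn_ge0.
Qed.

Lemma untestable_samples (R : realType) (f : sgraph -> R) (eps : R) : 0 < eps ->
  (forall (k : nat) (k_gt0 : (0 < k)%N), exists2 G : sgraph, (k <= #|G|)%N &
    eps < Pr_ksubset R (fun S : ksubset k G =>
      eps < `|f G - f (induced_sgraph k_gt0 S)|)) ->
  exists (Q N : nat -> nat) (D : nat -> nat -> nat -> nat -> R),
    (forall j a x y, 0 <= D j a x y <= 1) /\
    forall n, exists (G H : sgraph) (a : nat -> nat) (k : nat -> G -> nat)
        (k' : nat -> H -> nat) (l : 'I_#|G| -> G) (l' : 'I_#|H| -> H),
      [/\ (n <= #|G|)%N /\ (n <= #|H|)%N, eps < `|f G - f H|,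
        modelled Q N D n a k l, modelled Q N D n a k' l' &
        forall j b, (j < n)%N -> (b <= Q j)%N ->
          `|freq R (k j) b - freq R (k' j) b| <= n.+1%:R^-1].
Proof.
move=> eps0 bad.
pose h := Num.min eps 1; have h0 : 0 < h by rewrite lt_min eps0 ltr01.
have he : h <= eps by rewrite ge_min lexx.
have h1 : h <= 1 by rewrite ge_min lexx orbT.
pose z j : R := 2^-1 ^+ j.
have z0 j : 0 < z j by rewrite exprn_gt0.
have z1 j : z j <= 1 by rewrite exprn_ile1// invf_le1// ler1n.
(* By [cut_c4] a cut error [z j] on the sample requires four-cycle density at most [z j ^+ 4]. The
   choice of [e] turns [4 * e j / tau j] into [h / 4 * z j], with sum at most [h / 2]; the other
   half of [h] is left for the terms in 1/k. *)
pose tau j := z j ^+ 4; pose e j := h / 16 * z j * tau j.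
have tau0 j : 0 < tau j by rewrite exprn_gt0.
have tau1 j : tau j <= 1 by rewrite exprn_ile1// ltW.
have e0 j : 0 < e j by rewrite !mulr_gt0.
have ez j : e j <= z j.
  rewrite /e; have := z0 j; have := tau0 j; have := tau1 j => t1 t0 zz.
  have h16 : h / 16 <= 1 by lra.
  have hz : h / 16 * z j <= z j by rewrite -[leRHS]mul1r ler_wpM2r// ltW.
  have hz0 : 0 <= h / 16 * z j by rewrite !mulr_ge0// ltW.
  by apply: le_trans hz; rewrite -[leRHS]mulr1 ler_wpM2l.
have [q [N [d [d01 reg]]]] := regularity_family e0.
(* The kernels are to be read on keys; the remainder modulo [q j] recovers the color of level
   [j]. *)
pose D j a x y := d j a (x %% q j)%N (y %% q j)%N.
exists (fun j => key_bound q j.+1), N, D; split=> [j a x y|n]; first exact: d01.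
set Q := fun j => key_bound q j.+1.
(* A common bound for all thresholds, so that the pairs (level, threshold) lie in one finite
   type. *)
pose B := (\sum_(j < n) (Q j).+1)%N.
pose eta : R := n.+1%:R^-1.
have eta0 : 0 < eta by rewrite invr_gt0.
pose m := #|{: 'I_n * 'I_B}|.
(* The coefficient of 1/k in the sum required by [good_sample]. *)
pose K : R := \sum_(j < n) 64 / tau j + m%:R * 16 / eta ^+ 2.
pose k := maxn 4 (maxn n (Num.bound (2 * K / h))).
have k4 : (4 <= k)%N by exact: leq_maxl.
have kn : (n <= k)%N by rewrite !leq_max leqnn orbT.
have k0 : (0 < k)%N by exact: leq_trans k4.
have K0 : 0 <= K.
  rewrite addr_ge0 ?sumr_ge0// => [j _|]; first by rewrite divr_ge0// ltW.
  by apply: divr_ge0; [exact: mulr_ge0|exact: sqr_ge0].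
have kK : K / k%:R <= h / 2.
  have k0R : (0 : R) < k%:R by rewrite ltr0n.
  have kb : (Num.bound (2 * K / h) <= k)%N by rewrite !leq_max leqnn !orbT.
  have : 2 * K / h <= k%:R.
    apply: le_trans (ltW (archi_boundP _)) _; last by rewrite ler_nat.
    by rewrite divr_ge0 ?mulr_ge0// ltW.
  rewrite !ler_pdivrMr//; nra.
have [G kG badG] := bad k k0.
have [a [s Has]] := reg G.
have sq j x : (s j x < q j)%N by case: (Has j).
pose kk j x := key q s j.+1 x.
pose U (j : 'I_n) x y : R := (adj x y)%:R - d j (a j) (s j x) (s j y).
have U1 j x y : `|U j x y| <= 1.
  have /andP[? ?] := d01 j (a j) (s j x) (s j y); have /andP[? ?] := adj01 R x y.
  by rewrite /U ler_norml; apply/andP; split; lra.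
have Ue (j : 'I_n) : cut_le (U j) (e j * #|G|%:R ^+ 2) by case: (Has j).
pose A (i : 'I_m) : {set G} := let p := enum_val i in [set x | (kk p.1 x < p.2)%N]%SET.
have [|S [fS cS dS]] := @good_sample R G k k4 kG eps eta n m U
    (fun j => e j) (fun j => tau j) A _ eta0 (fun j => tau0 j) U1 Ue badG.
  have -> : \sum_(j < n) (4 * e j + 64 / k%:R) / tau j +
      m%:R * (16 / k%:R / eta ^+ 2) =
      h / 4 * \sum_(j < n) 2^-1 ^+ j + K / k%:R.
    have -> : K / k%:R = \sum_(j < n) 64 / tau j / k%:R + m%:R * 16 / eta ^+ 2 / k%:R.
      by rewrite [LHS]mulrDl mulr_suml.
    rewrite mulr_sumr addrA -big_split/=; congr (_ + _).
      apply: eq_bigr => j _; rewrite /e -/(z j).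
      by field; rewrite pnatr_eq0 -lt0n k0 lt0r_neq0.
    by field; rewrite pnatr_eq0 -lt0n k0 lt0r_neq0.
  have s2 := sum_half_powers R n.
  have : h / 4 * \sum_(j < n) 2^-1 ^+ j <= h / 4 * 2 by rewrite ler_wpM2l// divr_ge0// ltW.
  by move=> ?; lra.
pose H := induced_sgraph k0 S.
have cardH : #|H| = k by rewrite card_sig (eqP (valP S)).
(* The sample keeps the colors and the kernels of [G]; it gets no regularity partition of its
   own. *)
pose kk' j (y : H) := kk j (val y).
(* The key of level [n] refines all the lower ones, so sorting by it sorts every level. *)
have [l lb lm] := sorted_labeling (key q s n).
have [l' lb' lm'] := sorted_labeling (fun y : H => key q s n (val y)).
exists G, H, a, kk, kk', l, l'.
split=> //; first by rewrite cardH (leq_trans kn).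
- split=> // j jn; have [aN _ cj] := Has j; split=> //.
  + by move=> x; exact: key_lt.
  + by move=> i i' /lm; exact: key_mono.
  + move=> X Y; apply: le_trans (_ : e j * #|G|%:R ^+ 2 <= _).
      have := cj X Y; congr (`|_| <= _); apply: eq_bigr => x _; apply: eq_bigr => y _.
      by rewrite /D /kk !key_mod.
    by rewrite ler_wpM2r// exprn_ge0.
- split=> // j jn; have [aN _ cj] := Has j; split=> //.
  + by move=> x; exact: key_lt.
  + by move=> i i' /lm'; exact: key_mono.
  + move=> X Y.
    (* Compare fourth powers, since the four-cycle count of the sample bounds the fourth power of
       its cut sums. *)
    rewrite -(@ler_pXn2r _ 4)// ?nnegrE ?mulr_ge0 ?exprn_ge0// -normrX.
    rewrite ger0_norm; last by rewrite (exprM _ 2 2) sqr_ge0.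
    pose V := fun x y : H => U (Ordinal jn) (val x) (val y).
    have -> : \sum_(x in X) \sum_(y in Y) ((adj x y)%:R - D j (a j) (kk' j x) (kk' j y)) =
        \sum_(x in X) \sum_(y in Y) V x y.
      apply: eq_bigr => x _; apply: eq_bigr => y _.
      by rewrite /D /kk' /kk !key_mod.
    apply: le_trans (cut_c4 V X Y) _; rewrite /V -(c4_on_sub (U (Ordinal jn)) (val S)).
    have -> : (2^-1 ^+ j * #|H|%:R ^+ 2) ^+ 4 = z j ^+ 4 * k%:R ^+ 4 * k%:R ^+ 4.
      by rewrite cardH /z exprMn -exprM -[RHS]mulrA -exprD -exprM.
    rewrite cardH mulrC.
    have := cS (Ordinal jn); rewrite /= natrX /tau => cj'.
    by rewrite ler_wpM2r// exprn_ge0.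
- move=> j b jn bQ.
  have bB : (b < B)%N.
    by rewrite /B (bigD1 (Ordinal jn))//= ltnS (leq_trans bQ)// leq_addr.
  have := dS (enum_rank (Ordinal jn, Ordinal bB)).
  rewrite /dev /A enum_rankK/= distrC; congr (`|_ - _| <= _).
  rewrite /freq cardH; congr (_%:R / _).
  rewrite -sum1_card -[RHS]sum1_card.
  rewrite (eq_bigl (fun x => (x \in val S) && (kk j x < b)%N)); last first.
    by move=> x; rewrite !inE.
  rewrite (big_sub_cond (mem (val S)) (fun x => (kk j x < b)%N))/=.
  by apply: eq_bigl => y; rewrite inE.
Qed.

Lemma bounded_max (P : nat -> nat -> Prop) Q :
  (forall b, exists N, forall n, (N <= n)%N -> P b n) ->
  exists N, forall b n, (b <= Q)%N -> (N <= n)%N -> P b n.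
Proof.
move=> H; elim: Q => [|Q [N HN]].
  by have [N HN] := H 0%N; exists N => b n; rewrite leqn0 => /eqP ->; exact: HN.
have [N' HN'] := H Q.+1; exists (maxn N N') => b n.
rewrite leq_eqVlt geq_max => /orP[/eqP ->|bQ] /andP[h1 h2]; first exact: HN'.
exact: HN.
Qed.

Lemma freq_le1 (R : realType) (G : sgraph) (k : G -> nat) b : 0 <= freq R k b <= 1.
Proof.
rewrite /freq divr_ge0//= ler_pdivrMr ?ltr0n ?vertex_gt0// mul1r ler_nat.
exact: max_card.
Qed.

Lemma graphon_of01 (R : realType) (G : sgraph) (l : 'I_#|G| -> G) p :
  0 <= graphon_of R l p <= 1.
Proof.
by rewrite /graphon_of/= /graphon_of_fun indicE; case: (_ \in _); rewrite ?lexx ?ler01.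
Qed.

Lemma small_half_power (R : realType) (e : R) : 0 < e -> exists j, 2^-1 ^+ j < e.
Proof.
move=> e0; exists (Num.bound e^-1).
rewrite exprVn -[ltRHS]invrK ltf_pV2 ?posrE ?exprn_gt0 ?invr_gt0//.
apply: (@lt_trans _ _ (Num.bound e^-1)%:R).
  by apply: archi_boundP; rewrite invr_ge0 ltW.
by rewrite -natrX ltr_nat ltn_expl.
Qed.

Section Limit.
Variables (R : realType) (f : sgraph -> R) (fcheck : graphon R -> R).
Hypothesis fcheck_cont : cut_continuous fcheck.
Hypothesis fcheckE : forall eps : R, 0 < eps -> exists N : nat, forall G : sgraph,
  (N <= #|G|)%N -> forall l : 'I_#|G| -> G, bijective l ->
  `|fcheck (graphon_of R l) - f G| < eps.

(** The estimate is the value of [f] on the sample itself. *)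
Lemma functional_testable : graph_parameter f -> testable f.
Proof.
move=> f_param eps eps0; apply: contrapT => nt.
have {nt}bad (k : nat) (k_gt0 : (0 < k)%N) : exists2 G : sgraph, (k <= #|G|)%N &
    eps < Pr_ksubset R (fun S : ksubset k G =>
      eps < `|f G - f (induced_sgraph k_gt0 S)|).
  apply: contrapT => nG; apply: nt; exists k, k_gt0, f; split=> // G kG.
  by rewrite leNgt; apply/negP => h; apply: nG; exists G.
have [Q [N [D [D01 Hs]]]] := untestable_samples eps0 bad.
(* Choices are made one at a time, because the types of the later ones depend on the graphs chosen
   before. *)
have [G HG] := choice Hs; have [H HH] := choice HG.
have [a Ha] := choice HH.
have [k Hk] : exists k : forall n, nat -> G n -> nat, forall n,
    exists (k' : nat -> H n -> nat) (l : 'I_#|G n| -> G n) (l' : 'I_#|H n| -> H n),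
      [/\ (n <= #|G n|)%N /\ (n <= #|H n|)%N, eps < `|f (G n) - f (H n)|,
        modelled Q N D n (a n) (k n) l, modelled Q N D n (a n) k' l' &
        forall j b, (j < n)%N -> (b <= Q j)%N ->
          `|freq R (k n j) b - freq R (k' j) b| <= n.+1%:R^-1].
  by exists (fun n => sval (cid (Ha n))) => n; case: cid.
have [k' Hk'] : exists k' : forall n, nat -> H n -> nat, forall n,
    exists (l : 'I_#|G n| -> G n) (l' : 'I_#|H n| -> H n),
      [/\ (n <= #|G n|)%N /\ (n <= #|H n|)%N, eps < `|f (G n) - f (H n)|,
        modelled Q N D n (a n) (k n) l, modelled Q N D n (a n) (k' n) l' &
        forall j b, (j < n)%N -> (b <= Q j)%N ->
          `|freq R (k n j) b - freq R (k' n j) b| <= n.+1%:R^-1].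
  by exists (fun n => sval (cid (Hk n))) => n; case: cid.
have [l Hl] : exists l : forall n, 'I_#|G n| -> G n, forall n,
    exists (l' : 'I_#|H n| -> H n),
      [/\ (n <= #|G n|)%N /\ (n <= #|H n|)%N, eps < `|f (G n) - f (H n)|,
        modelled Q N D n (a n) (k n) (l n), modelled Q N D n (a n) (k' n) l' &
        forall j b, (j < n)%N -> (b <= Q j)%N ->
          `|freq R (k n j) b - freq R (k' n j) b| <= n.+1%:R^-1].
  by exists (fun n => sval (cid (Hk' n))) => n; case: cid.
have [l' Hl'] : exists l' : forall n, 'I_#|H n| -> H n, forall n,
      [/\ (n <= #|G n|)%N /\ (n <= #|H n|)%N, eps < `|f (G n) - f (H n)|,
        modelled Q N D n (a n) (k n) (l n), modelled Q N D n (a n) (k' n) (l' n) &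
        forall j b, (j < n)%N -> (b <= Q j)%N ->
          `|freq R (k n j) b - freq R (k' n j) b| <= n.+1%:R^-1].
  by exists (fun n => sval (cid (Hl n))) => n; case: cid.
move=> {Hs HG HH Ha Hk Hk' Hl bad}.
(* Kernel indices and frequencies of all levels are listed as one countable family of real
   sequences. Kernel indices are bounded only for levels below n, hence the value 0 otherwise. *)
pose u i n : R := match unpickle i with
  | Some (inl j) => if (j < n)%N then (a n j)%:R else 0
  | Some (inr (j, b)) => freq R (k n j) b
  | None => 0 end.
have ub i : exists M, forall n, `|u i n| <= M.
  rewrite /u; case: (unpickle i) => [[j|[j b]]|]; last by exists 0 => n; rewrite normr0.
    exists (N j)%:R => n; case: ifPn => jn; last by rewrite normr0.
    have [_ _ [_ mG] _ _] := Hl' n; have [aN _ _ _] := mG _ jn.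
    by rewrite normr_nat ler_nat ltnW.
  by exists 1 => n; have /andP[? ?] := freq_le1 R (k n j) b; rewrite ger0_norm.
have [phi [phin ucvg]] := diagonal_subsequence ub.
pose W n := graphon_of R (l (phi n)); pose W' n := graphon_of R (l' (phi n)).
(* The level [j] comes first and [eta] second, because the number of keys [Q j] depends on [j]. *)
have small (e : R) : 0 < e -> exists j, exists2 eta, 0 < eta &
    2 * 2^-1 ^+ j + 4 * (Q j)%:R * eta <= e.
  move=> e0; have e40 : 0 < e / 4 by rewrite divr_gt0.
  have [j hj] := small_half_power e40.
  exists j, (e / (8 * (Q j).+1%:R)); first by rewrite divr_gt0// mulr_gt0.
  have Q0 : (0 : R) < (Q j).+1%:R by [].
  have : 4 * (Q j)%:R * (e / (8 * (Q j).+1%:R)) <= e / 2.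
    rewrite mulrA ler_pdivrMr ?mulr_gt0// -natr1; have : (0 : R) <= (Q j)%:R by [].
    nra.
  by move: hj; set z := 2^-1 ^+ j; set w := 4 * _ * _; lra.
have WC (e : R) : 0 < e -> exists M, forall m n, (M <= m)%N -> (M <= n)%N ->
    cut_norm (W m \- W n) <= e.
  move=> /small[j [eta eta0 le]].
  (* Natural numbers at distance at most 1/2 are equal, so convergence makes the kernel index
     eventually constant. *)
  have half0 : (0 : R) < 2^-1 by rewrite invr_gt0.
  have [M1 HM1] := cvgn_cauchy (ucvg (pickle (inl j : (nat + nat * nat)%type))) half0.
  pose L b := limn (fun n => u (pickle (inr (j, b) : (nat + nat * nat)%type)) (phi n)).
  have [M2 HM2] : exists M, forall b n, (b <= Q j)%N -> (M <= n)%N ->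
      `|freq R (k (phi n) j) b - L b| <= eta / 2.
    apply: (@bounded_max (fun b n => `|freq R (k (phi n) j) b - L b| <= eta / 2)) => b.
    have /cvgn_leP/(_ _ (divr_gt0 eta0 (ltr0Sn R 1)))[M HM] :=
      ucvg (pickle (inr (j, b) : (nat + nat * nat)%type)).
    by exists M => n /HM; rewrite {1}/u pickleK.
  exists (maxn j.+1 (maxn M1 M2)) => m n.
  rewrite !geq_max => /and3P[jm m1 m2] /and3P[jn n1 n2].
  have jpm := leq_trans jm (phin m); have jpn := leq_trans jn (phin n).
  apply: le_trans le.
  have [_ _ mGm _ _] := Hl' (phi m); have [_ _ mGn _ _] := Hl' (phi n).
  apply: (modelled_close D01 mGm mGn jpm jpn).
    have := HM1 _ _ m1 n1; rewrite /u pickleK jpm jpn ler_norml => /andP[h1 h2].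
    case: (ltngtP (a (phi m) j) (a (phi n) j)) => // h; exfalso.
      by move: h; rewrite -(ler_nat R) -natr1; lra.
    by move: h; rewrite -(ler_nat R) -natr1; lra.
  move=> c cQ; have := HM2 _ _ cQ m2; have := HM2 _ _ cQ n2; rewrite !ler_norml.
  by move=> /andP[? ?] /andP[? ?]; apply/andP; split; lra.
have [V HV] : exists V : graphon R, forall e : R, 0 < e ->
    exists M, forall n, (M <= n)%N -> cut_norm (W n \- V) <= e.
  by apply: cut_norm_complete => // n p; exact: graphon_of01.
have WW' (e : R) : 0 < e -> exists M, forall n, (M <= n)%N -> cut_norm (W' n \- W n) <= e.
  move=> /small[j [eta eta0 le]].
  exists (maxn j.+1 (Num.bound eta^-1)) => n; rewrite geq_max => /andP[jn bn].
  have jpn := leq_trans jn (phin n).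
  have [_ _ mG mH fGH] := Hl' (phi n); apply: le_trans le.
  apply: (modelled_close D01 mH mG jpn jpn) => // c cQ.
  rewrite distrC; apply: le_trans (fGH _ _ jpn cQ) _.
  rewrite -[leRHS]invrK lef_pV2 ?posrE ?invr_gt0//.
  apply: le_trans (ltW (archi_boundP _)) _; first by rewrite invr_ge0 ltW.
  by rewrite ler_nat (leq_trans bn)// (leq_trans (phin n)).
have e4 : 0 < eps / 4 by rewrite divr_gt0.
have [delta d0 Hd] := fcheck_cont V e4.
have [N0 HN0] := fcheckE e4.
have [M1 HM1] := HV _ (divr_gt0 d0 (ltr0Sn R 2)).
have [M2 HM2] := WW' _ (divr_gt0 d0 (ltr0Sn R 2)).
pose n := maxn N0 (maxn M1 M2).
have nN0 : (N0 <= n)%N by rewrite leq_maxl.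
have nM1 : (M1 <= n)%N by rewrite !leq_max leqnn orbT.
have nM2 : (M2 <= n)%N by rewrite !leq_max leqnn !orbT.
have [[sG sH] ff [lb _] [lb' _] _] := Hl' (phi n).
have b W0 : bounded_mfun (W0 : graphon R) by exact: graphon_bmf.
have c1 : cut_norm (W n \- V) < delta by apply: le_lt_trans (HM1 _ nM1) _; lra.
have c2 : cut_norm (W' n \- V) < delta.
  apply: le_lt_trans (cut_norm_triangle (b (W' n)) (b (W n)) (b V)) _.
  by have := HM1 _ nM1; have := HM2 _ nM2; lra.
have := Hd _ c1; have := Hd _ c2.
have := HN0 _ (leq_trans nN0 (leq_trans (phin n) sG)) _ lb.
have := HN0 _ (leq_trans nN0 (leq_trans (phin n) sH)) _ lb'.
rewrite -/(W n) -/(W' n) => h1 h2 h3 h4.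
suff : `|f (G (phi n)) - f (H (phi n))| <= eps by rewrite leNgt ff.
move: h1 h2 h3 h4; rewrite !ltr_norml ler_norml.
by move=> /andP[? ?] /andP[? ?] /andP[? ?] /andP[? ?]; apply/andP; split; lra.
Qed.

End Limit.

(** * Extension of a uniformly continuous parameter to graphons *)

Lemma point_sym : symmetric (fun _ _ : unit => false).
Proof. by []. Qed.

Lemma point_irr : irreflexive (fun _ _ : unit => false).
Proof. by []. Qed.

Lemma point_gt0 : (0 < #|{: unit}|)%N.
Proof. by rewrite card_unit. Qed.

(** Ensures that the infimum defining the extension is taken over a nonempty set. *)
Definition point_graph : sgraph := SGraph point_sym point_irr point_gt0.

Section McShane.
Variables (R : realType) (f : sgraph -> R) (M : R).
Hypothesis M0 : 0 < M.
Hypothesis fM : forall G, `|f G| <= M.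
Hypothesis f_cont : forall eps : R, 0 < eps ->
  exists2 eps0 : R, 0 < eps0 & exists2 n0 : nat, (0 < n0)%N &
    forall G1 G2 : sgraph, (n0 <= #|G1|)%N -> (n0 <= #|G2|)%N ->
      cut_distance R G1 G2 < eps0 -> `|f G1 - f G2| < eps.

Local Notation z n := ((2^-1 : R) ^+ n).

(** If the last bracket is below the threshold [d], both graphs are large and close in cut distance,
    and [f_cont] applies; otherwise the slope [2 * M / d] makes the bound exceed the oscillation of
    [f]. *)
Lemma affine_moduli : exists K : nat -> R, (forall n, 0 <= K n) /\
  forall n (G1 G2 : sgraph) (l1 : 'I_#|G1| -> G1) (l2 : 'I_#|G2| -> G2),
    bijective l1 -> bijective l2 ->
    f G1 <= f G2 + z n + K n *
      (cut_norm (graphon_of R l1 \- graphon_of R l2) + #|G1|%:R^-1 + #|G2|%:R^-1).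
Proof.
suff H n : exists K : R, 0 <= K /\
    forall (G1 G2 : sgraph) (l1 : 'I_#|G1| -> G1) (l2 : 'I_#|G2| -> G2),
    bijective l1 -> bijective l2 ->
    f G1 <= f G2 + z n + K *
      (cut_norm (graphon_of R l1 \- graphon_of R l2) + #|G1|%:R^-1 + #|G2|%:R^-1).
  have [K HK] := choice H; exists K; split=> n; first by case: (HK n).
  by case: (HK n) => _; apply.
have z0 : 0 < z n by rewrite exprn_gt0.
have [e0 e00 [n0 n00 H]] := f_cont z0.
pose d := Num.min e0 n0%:R^-1.
have d0 : 0 < d by rewrite lt_min e00 invr_gt0 ltr0n.
exists (2 * M / d); split; first by rewrite divr_ge0 ?mulr_ge0// ltW.
move=> G1 G2 l1 l2 [g1 lK1 gK1] [g2 lK2 gK2].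
set c := cut_norm _; set s := c + _ + _.
have c0 : 0 <= c by apply: cut_norm_ge0; apply: bounded_mfunB; exact: graphon_bmf.
have i0 (G : sgraph) : (0 : R) < #|G|%:R^-1 by rewrite invr_gt0 ltr0n vertex_gt0.
have := fM G1; have := fM G2; rewrite !ler_norml => /andP[? ?] /andP[? ?].
case: (ltP s d) => sd; last first.
  have : 2 * M <= 2 * M / d * s.
    by rewrite mulrAC ler_pdivlMr// ler_wpM2l// mulr_ge0// ltW.
  lra.
have big (G : sgraph) : #|G|%:R^-1 < d -> (n0 <= #|G|)%N.
  rewrite lt_min => /andP[_]; rewrite ltf_pV2 ?posrE ?ltr0n ?vertex_gt0// ltr_nat.
  exact: ltnW.
have s1 := i0 G1; have s2 := i0 G2.
have cd : cut_distance R G1 G2 < e0.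
  apply: le_lt_trans (cut_distance_le R lK1 gK1 lK2 gK2) _.
  have : d <= e0 by rewrite ge_min lexx.
  by rewrite -/c; rewrite /s in sd; lra.
have := H G1 G2 (big _ _) (big _ _) cd.
have -> : #|G1|%:R^-1 < d by rewrite /s in sd; lra.
have -> : #|G2|%:R^-1 < d by rewrite /s in sd; lra.
move=> /(_ isT isT); rewrite ltr_norml => /andP[? ?].
have : 0 <= 2 * M / d * s.
  apply: mulr_ge0; first by rewrite divr_ge0 ?mulr_ge0// ltW.
  by rewrite /s; lra.
lra.
Qed.

(* McShane extension with respect to the concave modulus inf_n (2^-n + K_n t). *)
Lemma cut_continuous_extension : exists2 fcheck : graphon R -> R, cut_continuous fcheck &
  forall eps : R, 0 < eps ->
  exists N : nat, forall G : sgraph, (N <= #|G|)%N ->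
  forall l : 'I_#|G| -> G, bijective l -> `|fcheck (graphon_of R l) - f G| < eps.
Proof.
have [K [K0 HK]] := affine_moduli.
(* The index [n] of the affine modulus is one more variable of the infimum. The penalty 1/|G|
   prevents small graphs, to which continuity says nothing, from lowering it too much. *)
pose V (W : graphon R) (G : sgraph) (l : 'I_#|G| -> G) n : R :=
  f G + z n + K n * (cut_norm (graphon_of R l \- W) + #|G|%:R^-1).
pose A (W : graphon R) := [set v : R | exists (G : sgraph) (l : 'I_#|G| -> G) (n : nat),
  bijective l /\ v = V W G l n].
have z0 n : 0 < z n by rewrite exprn_gt0.
have cn0 (W W' : graphon R) : 0 <= cut_norm (W \- W').
  by apply: cut_norm_ge0; apply: bounded_mfunB; exact: graphon_bmf.
have i0 (G : sgraph) : (0 : R) < #|G|%:R^-1 by rewrite invr_gt0 ltr0n vertex_gt0.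
have VlM W G l n : - M <= V W G l n.
  have := fM G; rewrite ler_norml => /andP[? _].
  have : 0 <= K n * (cut_norm (graphon_of R l \- W) + #|G|%:R^-1).
    by rewrite mulr_ge0// addr_ge0// ltW.
  by have := z0 n; rewrite /V; lra.
have A_inf W : has_inf (A W).
  split; last by exists (- M) => _ [G [l [n [_ ->]]]]; exact: VlM.
  have [l lb _] := sorted_labeling (fun _ : point_graph => 0%N).
  by exists (V W point_graph l 0%N), point_graph, l, 0%N.
pose fc W := inf (A W).
have fc_le W G l n : bijective l -> fc W <= V W G l n.
  by move=> lb; apply: ge_inf; [case: (A_inf W)|exists G, l, n].
have fc_ge W (x : R) : (forall G l n, bijective l -> x <= V W G l n) -> x <= fc W.
  move=> H; apply: lb_le_inf; first by case: (A_inf W).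
  by move=> _ [G [l [n [lb ->]]]]; exact: H.
have small (e : R) : 0 < e -> exists m, exists2 d, 0 < d &
    forall t, 0 <= t -> t <= d -> z m + K m * t < e.
  move=> e0; have e20 : 0 < e / 2 by rewrite divr_gt0.
  have [m hm] := small_half_power e20; exists m, (e / 2 / (K m + 1)).
    by rewrite divr_gt0// ltr_wpDl.
  move=> t t0 td; have Km := K0 m.
  have : K m * t <= e / 2.
    have K1 : 0 < K m + 1 by rewrite ltr_wpDl.
    move: td; rewrite ler_pdivlMr//; nra.
  by move: hm; lra.
(* Apply the hypothesis to whichever of [m], [n] has the smaller slope. *)
have pick m n (x t s : R) : 0 <= t -> 0 <= s ->
    (forall i, x <= z i + K i * (t + s)) -> x <= z m + K m * t + (z n + K n * s).
  move=> t0 s0 H; have := z0 m; have := z0 n; have := K0 m; have := K0 n.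
  have := H m; have := H n; case: (lerP (K m) (K n)) => ?; nra.
have fc_lip m (W W' : graphon R) t : 0 <= t -> cut_norm (W \- W') <= t ->
    fc W <= fc W' + (z m + K m * t).
  move=> t0 Wt; rewrite -lerBlDr; apply: fc_ge => G l n lb; rewrite /V.
  set s := cut_norm _ + _; have s0 : 0 <= s by rewrite addr_ge0// ltW.
  suff P : fc W - f G <= z m + K m * t + (z n + K n * s) by lra.
  apply: pick => // i; rewrite lerBlDl; apply: le_trans (fc_le W G l i lb) _.
  rewrite /V -addrA lerD2l lerD2l ler_wpM2l// /s addrA lerD2r.
  have := cut_norm_triangle (graphon_bmf (graphon_of R l)) (graphon_bmf W') (graphon_bmf W).
  rewrite (cut_normC (graphon_bmf W') (graphon_bmf W)); lra.
exists fc.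
  move=> W e e0; have [m [d d0 H]] := small _ e0; exists d => // W' Wd.
  have c0 := cn0 W' W.
  have h1 := fc_lip m W' W _ c0 (lexx _).
  have h2 := fc_lip m W W' (cut_norm (W' \- W)) c0.
  rewrite (cut_normC (graphon_bmf W) (graphon_bmf W')) in h2.
  exact: dist_lt_of_le h1 (h2 (lexx _)) (H _ c0 (ltW Wd)).
move=> e e0; have [m [d d0 H]] := small _ e0.
exists (Num.bound d^-1) => G GN l lb.
have Gd : #|G|%:R^-1 <= d.
  rewrite -[leRHS]invrK lef_pV2 ?posrE ?invr_gt0// ?ltr0n ?vertex_gt0//.
  apply: le_trans (ltW (archi_boundP _)) _; first by rewrite invr_ge0 ltW.
  by rewrite ler_nat.
have {}H := H _ (ltW (i0 G)) Gd.
have h1 := fc_le (graphon_of R l) G l m lb.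
rewrite /V in h1.
have c0 : cut_norm (graphon_of R l \- graphon_of R l) = 0.
  apply/eqP; rewrite eq_le cn0 andbT; apply: cut_norm_le => S T uS uT.
  by rewrite rect_intB ?subrr ?normr0//; exact: graphon_bmf.
rewrite c0 add0r in h1.
have h2 : f G - (z m + K m * #|G|%:R^-1) <= fc (graphon_of R l).
  apply: fc_ge => G' l' n lb'; rewrite /V.
  set s := cut_norm _ + _; have s0 : 0 <= s by rewrite addr_ge0// ltW.
  suff P : f G - f G' <= z m + K m * #|G|%:R^-1 + (z n + K n * s) by lra.
  apply: pick => [||i]; [exact: ltW|by []|].
  rewrite lerBlDl; apply: le_trans (HK i G G' l l' lb lb') _.
  rewrite -addrA lerD2l lerD2l ler_wpM2l// /s.
  by rewrite (cut_normC (graphon_bmf _) (graphon_bmf _)); lra.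
by rewrite ltr_norml; apply/andP; split; lra.
Qed.

End McShane.

(** * Expected values on samples *)

Lemma is_cvg_sum (R : realType) (I : Type) (s : seq I) (P : pred I) (u : I -> nat -> R) :
  (forall i, P i -> cvgn (u i)) -> cvgn (fun n => \sum_(i <- s | P i) u i n).
Proof.
move=> cu; elim: s => [|i s IH].
  rewrite (_ : (fun n => _) = cst 0); first exact: is_cvg_cst.
  by apply/funext => n; rewrite big_nil.
case: (boolP (P i)) => Pi; last first.
  rewrite (_ : (fun n => _) = (fun n => \sum_(j <- s | P j) u j n))//.
  by apply/funext => n; rewrite big_cons (negbTE Pi).
rewrite (_ : (fun n => _) = (fun n => u i n + \sum_(j <- s | P j) u j n)).
  exact: is_cvgD (cu i Pi) IH.
by apply/funext => n; rewrite big_cons Pi.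
Qed.

Section Expectation.
Variables (R : realType) (f : sgraph -> R).
Hypothesis f_param : graph_parameter f.

Lemma testable_expectation : bounded_parameter f -> testable f ->
  forall eps : R, 0 < eps -> exists (k : nat) (k_gt0 : (0 < k)%N),
    forall G : sgraph, (k <= #|G|)%N ->
      `|f G - E_ksubset (fun S : ksubset k G => f (induced_sgraph k_gt0 S))| <= eps.
Proof.
move=> [M' fM'] ft eps eps0; have [M M0 fM] : exists2 M : R, 0 <= M & forall G, `|f G| <= M.
  by exists `|M'| => // G; exact: le_trans (fM' G) (ler_norm _).
have M2 : 0 < 2 + 2 * M by rewrite ltr_wpDr ?mulr_ge0.
(* The bound 1/2 excludes an event of probability 1. The other bound makes the total error
   [2 * eta + 2 * M * eta] at most [eps]: [2 * eta] on typical samples, [2 * M] on the others. *)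
pose eta := Num.min 2^-1 (eps / (2 + 2 * M)).
have eta0 : 0 < eta by rewrite lt_min invr_gt0 ltr0n divr_gt0.
have [k [k_gt0 [g [g_param Hg]]]] := ft eta eta0.
exists k, k_gt0 => G kG.
(* With a single sample, the failure probability is 0 or 1, and being at most 1/2 it is 0. *)
have fg (H : sgraph) : #|H| = k -> `|f H - g H| <= eta.
  move=> Hk; have := Hg H; rewrite Hk leqnn => /(_ isT).
  pose S0 : ksubset k H := exist _ [set: H]%SET (introT eqP (etrans (cardsT H) Hk)).
  rewrite /Pr_ksubset card_ksubset Hk binn divr1.
  have gE : g (induced_sgraph k_gt0 S0) = g H.
    apply: g_param; exists val => //; exists (fun x : H => exist (fun y => y \in val S0) x (finset.in_setT x)) => [y|//].
    exact: val_inj.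
  set B := [set S | _]%SET => Bh.
  have : S0 \notin B.
    apply/negP => SB; have : (1 : R) <= #|B|%:R by rewrite ler1n card_gt0; apply/set0Pn; exists S0.
    have : eta <= 2^-1 by rewrite ge_min lexx.
    by move: Bh; set b := #|B|%:R; lra.
  by rewrite inE gE -leNgt.
have C0 : (0 : R) < 'C(#|G|, k)%:R by rewrite ltr0n bin_gt0.
rewrite /E_ksubset card_ksubset.
set B := fun S : ksubset k G => eta < `|f G - g (induced_sgraph k_gt0 S)|.
have HB := Hg G kG; rewrite /Pr_ksubset card_ksubset -/B in HB.
have step (S : ksubset k G) :
    `|f G - f (induced_sgraph k_gt0 S)| <= 2 * eta + 2 * M * (B S)%:R.
  have cS : #|induced_sgraph k_gt0 S| = k by rewrite card_sig (eqP (valP S)).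
  have h1 := fg _ cS; case: (boolP (B S)) => BS.
    rewrite mulr1; apply: le_trans (ler_normB _ _) _.
    by have := fM G; have := fM (induced_sgraph k_gt0 S); lra.
  move: BS; rewrite /B -leNgt => h2; rewrite mulr0 addr0.
  apply: le_trans (ler_distD (g (induced_sgraph k_gt0 S)) _ _) _.
  by rewrite [X in _ + X]distrC; lra.
have -> : f G = (\sum_(S : ksubset k G) f G) / 'C(#|G|, k)%:R.
  by rewrite sumr_const -card_ksubset -[X in X / _]mulr_natr mulfK// card_ksubset lt0r_neq0.
rewrite -mulrBl -sumrB normrM normfV (gtr0_norm C0) ler_pdivrMr//.
apply: le_trans (ler_norm_sum _ _ _) _; apply: le_trans (ler_sum _ (fun S _ => step S)) _.
rewrite big_split/= sumr_const -mulr_sumr card_ksubset.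
have -> : \sum_(S : ksubset k G) (B S)%:R = #|[set S | B S]%SET|%:R :> R.
  by rewrite -sum1_card natr_sum [RHS]big_mkcond/=; apply: eq_bigr => S _; rewrite inE; case: (B S).
rewrite ler_pdivrMr// in HB.
have h : eta * (2 + 2 * M) <= eps by rewrite -ler_pdivlMr// ge_min lexx orbT.
rewrite -mulr_natr.
apply: (@le_trans _ _ (eta * (2 + 2 * M) * 'C(#|G|, k)%:R)); last by rewrite ler_wpM2r// ltW.
have M20 : 0 <= 2 * M by rewrite mulr_ge0.
by have := ler_wpM2l M20 HB; lra.
Qed.

Definition pull_edges k (G : sgraph) (x : {ffun 'I_k -> G}) : {set 'I_k * 'I_k} :=
  [set p | adj (x p.1) (x p.2)]%SET.

(** Symmetrized and freed of loops, so that every set of pairs gives a graph and sums may run over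
    all sets. A set that is asymmetric or has loops is never a [pull_edges] and has induced density
    0. *)
Definition rel_adj k (E : {set 'I_k * 'I_k}) : rel 'I_k :=
  fun i j => (i != j) && (((i, j) \in E) || ((j, i) \in E)).

Lemma rel_adj_sym k (E : {set 'I_k * 'I_k}) : symmetric (rel_adj E).
Proof. by move=> i j; rewrite /rel_adj eq_sym orbC. Qed.

Lemma rel_adj_irr k (E : {set 'I_k * 'I_k}) : irreflexive (rel_adj E).
Proof. by move=> i; rewrite /rel_adj eqxx. Qed.

Lemma ord_card_gt0 k : (0 < k)%N -> (0 < #|{: 'I_k}|)%N.
Proof. by rewrite card_ord. Qed.

Definition rel_graph k (k_gt0 : (0 < k)%N) (E : {set 'I_k * 'I_k}) : sgraph :=
  SGraph (rel_adj_sym E) (rel_adj_irr E) (ord_card_gt0 k_gt0).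

Lemma rel_adj_pull k (G : sgraph) (x : {ffun 'I_k -> G}) i j :
  rel_adj (pull_edges x) i j = adj (x i) (x j).
Proof.
rewrite /rel_adj !inE/= [adj (x j) _]adj_sym orbb.
by case: eqVneq => // ->; rewrite adj_irr.
Qed.

Lemma induced_pull k (k_gt0 : (0 < k)%N) (G : sgraph) (S : ksubset k G)
    (x : {ffun 'I_k -> G}) : injective x -> x \in tuples k (val S) ->
  f (rel_graph k_gt0 (pull_edges x)) = f (induced_sgraph k_gt0 S).
Proof.
move=> xinj; rewrite inE => /ffun_onP xS.
apply: f_param; exists (fun i : 'I_k => exist (fun y => y \in val S) (x i) (xS i)).
  apply: inj_card_bij => [i j /(congr1 val)/xinj//|].
  by rewrite card_sig (eqP (valP S)) card_ord.
by move=> i j; rewrite /= /induced_adj/= rel_adj_pull.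
Qed.

(** A k-subset is listed by [k ^_ k] injective tuples, and on each of them [f] takes the same value
    by invariance. *)
Lemma E_ksubset_inj k (k_gt0 : (0 < k)%N) (G : sgraph) : (k <= #|G|)%N ->
  E_ksubset (fun S : ksubset k G => f (induced_sgraph k_gt0 S)) =
  (\sum_(x : {ffun 'I_k -> G} | injectiveb x) f (rel_graph k_gt0 (pull_edges x)))
    / (#|G| ^_ k)%:R.
Proof.
move=> kG.
have kk0 : (0 : R) < (k ^_ k)%:R by rewrite ltr0n ffact_gt0.
have Gk0 : (0 : R) < (#|G| ^_ k)%:R by rewrite ltr0n ffact_gt0.
have C0 : (0 : R) < 'C(#|G|, k)%:R by rewrite ltr0n bin_gt0.
have := @sum_inj_tuples R G k k
  (fun x => f (rel_graph k_gt0 (pull_edges x))) (leqnn k).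
rewrite -(@sum_ksubset R G k (fun S : {set G} =>
  \sum_(x in tuples k S | injectiveb x) f (rel_graph k_gt0 (pull_edges x)))).
rewrite (eq_bigr (fun S : ksubset k G => (k ^_ k)%:R * f (induced_sgraph k_gt0 S))); last first.
  move=> S _; rewrite (eq_bigr (fun=> f (induced_sgraph k_gt0 S))); last first.
    by move=> x /andP[xS /injectiveP xinj]; exact: induced_pull.
  rewrite sumr_const mulr_natl; congr (_ *+ _).
  by have := card_inj_tuples k (val S); rewrite (eqP (valP S)) => <-; apply: eq_card.
rewrite -mulr_sumr /E_ksubset card_ksubset natrM => E.
apply/eqP; rewrite eqr_div ?lt0r_neq0//; apply/eqP.
apply: (mulfI (lt0r_neq0 kk0)); rewrite mulrA [LHS]mulrC E; ring.
Qed.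

(** All maps count here, injective or not, in order to match homomorphism densities exactly. *)
Definition ind_density k (G : sgraph) (E : {set 'I_k * 'I_k}) : R :=
  #|[set x : {ffun 'I_k -> G} | pull_edges x == E]%SET|%:R / (#|G| ^ k)%:R.

Definition up_density k (G : sgraph) (E : {set 'I_k * 'I_k}) : R :=
  #|[set x : {ffun 'I_k -> G} | E \subset pull_edges x]%SET|%:R / (#|G| ^ k)%:R.

Lemma up_density_sum k (G : sgraph) (E : {set 'I_k * 'I_k}) :
  up_density G E = \sum_(E' : {set 'I_k * 'I_k} | E \subset E') ind_density G E'.
Proof.
rewrite /up_density /ind_density -mulr_suml -natr_sum; congr (_%:R / _).
rewrite -sum1_card (partition_big (@pull_edges k G) (fun E' => E \subset E'))/=; last first.
  by move=> x; rewrite inE.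
apply: eq_bigr => E' EE'; rewrite -sum1_card; apply: eq_bigl => x; rewrite !inE.
by case: eqP => [->|]; rewrite ?andbT ?andbF.
Qed.

Lemma up_density_hom k (k_gt0 : (0 < k)%N) (G : sgraph) (E : {set 'I_k * 'I_k}) :
  (forall i, (i, i) \notin E) ->
  up_density G E = hom_density R (rel_graph k_gt0 E) G.
Proof.
move=> nE; rewrite /up_density /hom_density /hom card_ord; congr (_%:R / _).
apply: eq_card => x; rewrite !inE; apply/fintype.subsetP/forallP => [H i|H [i j] ij].
  apply/forallP => j; apply/implyP => /andP[ij /orP[/H|/H]]; rewrite inE//=.
  by rewrite adj_sym.
rewrite inE/=; have /forallP/(_ j)/implyP := H i; apply; rewrite /= /rel_adj ij andbT.
by apply: contraTneq ij => ->; exact: nE.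
Qed.

Lemma up_density_diag k (G : sgraph) (E : {set 'I_k * 'I_k}) i :
  (i, i) \in E -> up_density G E = 0.
Proof.
move=> iE; rewrite /up_density (_ : [set _ | _]%SET = finset.set0) ?cards0 ?mul0r//.
apply/finset.setP => x; rewrite !inE; apply/negP => /fintype.subsetP/(_ _ iE).
by rewrite inE adj_irr.
Qed.

(** Inclusion-exclusion as downward induction on [E]: subtract from the density of the maps that
    preserve [E] the induced densities of the proper supersets. The former is a homomorphism
    density, or 0 if [E] has a loop. *)
Lemma ind_density_cvg k (k_gt0 : (0 < k)%N) (G_ : nat -> sgraph) (E : {set 'I_k * 'I_k}) :
  convergent R G_ -> cvgn (fun n => ind_density (G_ n) E).
Proof.
move=> cG.
have up_cvg (E' : {set 'I_k * 'I_k}) : cvgn (fun n => up_density (G_ n) E').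
  have [[i iE]|nE] := pselect (exists i, (i, i) \in E').
    rewrite (_ : (fun n => _) = cst 0); first exact: is_cvg_cst.
    by apply/funext => n; exact: up_density_diag iE.
  rewrite (_ : (fun n => _) = (fun n => hom_density R (rel_graph k_gt0 E') (G_ n))).
    exact: cG.
  apply/funext => n; apply: up_density_hom => i.
  by apply/negP => iE; apply: nE; exists i.
have [m] := ubnP #|~: E|; elim: m E => // m IH E; rewrite ltnS => Em.
rewrite (_ : (fun n => _) = (fun n => up_density (G_ n) E -
    \sum_(E' : {set 'I_k * 'I_k} | (E \subset E') && (E' != E)) ind_density (G_ n) E')).
  apply: is_cvgB; first exact: up_cvg.
  apply: is_cvg_sum => E' /andP[EE' nEE']; apply: IH; apply: leq_trans Em.
  by apply: proper_card; rewrite finset.properEneq finset.setCS EE' andbT (inj_eq (@finset.setC_inj _)).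
apply/funext => n; rewrite up_density_sum (bigD1 E)//=.
by rewrite addrK.
Qed.

Lemma E_ksubset_approx k (k_gt0 : (0 < k)%N) (G : sgraph) (M : R) : (k <= #|G|)%N ->
  0 < M -> (forall H, `|f H| <= M) ->
  `|E_ksubset (fun S : ksubset k G => f (induced_sgraph k_gt0 S)) -
    \sum_(E : {set 'I_k * 'I_k}) f (rel_graph k_gt0 E) * ind_density G E|
  <= M * (2 * (k ^ 2)%:R / #|G|%:R).
Proof.
move=> kG M0 fM; rewrite E_ksubset_inj//.
pose g (x : {ffun 'I_k -> G}) := f (rel_graph k_gt0 (pull_edges x)) / M.
have g1 x : `|g x| <= 1.
  by rewrite /g normrM normfV (gtr0_norm M0) ler_pdivrMr// mul1r.
have := @avg_inj_tuples R G k [set: G]%SET g; rewrite !cardsT.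
move=> /(_ (leq_trans k_gt0 kG) kG g1); rewrite distrC.
have inT (x : {ffun 'I_k -> G}) : x \in tuples k [set: G]%SET.
  by rewrite inE; apply/ffun_onP => i; rewrite inE.
have -> : \sum_(x in tuples k [set: G]%SET) g x = \sum_x g x.
  by apply: eq_bigl => x; rewrite inT.
have -> : \sum_(x in tuples k [set: G]%SET | injectiveb x) g x =
    \sum_(x : {ffun 'I_k -> G} | injectiveb x) g x.
  by apply: eq_bigl => x; rewrite inT.
move=> h; have := ler_wpM2l (ltW M0) h; apply: le_trans.
rewrite -[X in X * `|_|](gtr0_norm M0) -normrM le_eqVlt; apply/orP; left; apply/eqP.
congr (`|_|); rewrite mulrBr; congr (_ - _).
  rewrite mulrA mulr_sumr; congr (_ / _); apply: eq_bigr => x _.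
  by rewrite /g mulrC divfK// lt0r_neq0.
rewrite mulrA mulr_sumr (partition_big (@pull_edges k G) xpredT)//= mulr_suml.
apply: eq_bigr => E _; rewrite /ind_density mulrA; congr (_ / _).
rewrite (eq_bigr (fun=> f (rel_graph k_gt0 E))); last first.
  by move=> x /eqP <-; rewrite /g mulrC divfK// lt0r_neq0.
rewrite sumr_const mulr_natr; congr (_ *+ _).
by apply: eq_card => x; rewrite !inE.
Qed.

Lemma expectation_convergent : bounded_parameter f ->
  (forall eps : R, 0 < eps -> exists (k : nat) (k_gt0 : (0 < k)%N),
    forall G : sgraph, (k <= #|G|)%N ->
      `|f G - E_ksubset (fun S : ksubset k G => f (induced_sgraph k_gt0 S))| <= eps) ->
  forall G_ : nat -> sgraph, convergent R G_ ->
    (fun n => #|G_ n|) @ \oo --> \oo -> cvgn (fun n => f (G_ n)).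
Proof.
move=> [M' fM'] Hf G_ cG Goo; pose M := `|M'| + 1.
have M0 : 0 < M by rewrite ltr_wpDl.
have fM G : `|f G| <= M.
  by apply: le_trans (fM' G) _; rewrite (le_trans (ler_norm _))// lerDl.
apply: cvgn_approx => e e0; have e20 : 0 < e / 2 by rewrite divr_gt0.
have [k [k_gt0 Hk]] := Hf _ e20.
exists (fun n => \sum_(E : {set 'I_k * 'I_k}) f (rel_graph k_gt0 E) * ind_density (G_ n) E).
  apply: is_cvg_sum => E _; apply: is_cvgM; first exact: is_cvg_cst.
  exact: ind_density_cvg.
pose b := Num.bound ((e / 2)^-1 * (M * (2 * (k ^ 2)%:R))).
have [N _ HN] : \forall n \near \oo, (maxn k (maxn 1 b) <= #|G_ n|)%N.
  exact: (cvgnyPge _).1 Goo _.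
exists N => n /HN /=; rewrite !geq_max => /and3P[kG G1 bG].
have G0 : (0 : R) < #|G_ n|%:R by rewrite ltr0n.
have h1 := Hk _ kG; have h2 := E_ksubset_approx k_gt0 kG M0 fM.
apply: le_trans (ler_distD _ _ _) _; apply: le_trans (lerD h1 h2) _.
rewrite [leRHS](splitr e) lerD2l mulrA ler_pdivrMr// -ler_pdivrMl//.
apply: le_trans (ltW (archi_boundP _)) _; last by rewrite ler_nat.
by rewrite mulr_ge0 ?invr_ge0 ?mulr_ge0// ltW.
Qed.

End Expectation.

(** * Counting lemma *)

Section ProductWeights.
Variables (R : realType) (F O : finType) (x : O -> R).
Hypothesis x1 : \sum_p x p = 1.
Hypothesis x0 : forall p, 0 <= x p.

(** The probability of [phi] when its values are drawn independently with law [x]. For an overlay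
    [x], both projections of [phi] are uniformly distributed maps. *)
Definition weight (phi : {ffun F -> O}) : R := \prod_i x (phi i).

Definition upd (phi : {ffun F -> O}) (i : F) (u : O) : {ffun F -> O} :=
  [ffun j => if j == i then u else phi j].

Lemma weight_upd phi i u : weight (upd phi i u) * x (phi i) = weight phi * x u.
Proof.
rewrite /weight (bigD1 i)//= [in RHS](bigD1 i)//= ffunE eqxx.
rewrite (eq_bigr (fun j => x (phi j))); last by move=> j ji; rewrite ffunE (negbTE ji).
by rewrite mulrC mulrA [RHS]mulrC mulrA; congr (_ * _); rewrite mulrC.
Qed.

(* Refreshing one coordinate preserves the product measure: the map
   (phi, u) |-> (upd phi i u, phi i) is a weight-preserving involution. *)
Lemma resample (i : F) (H : {ffun F -> O} -> R) :
  \sum_phi weight phi * H phi =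
  \sum_phi weight phi * \sum_u x u * H (upd phi i u).
Proof.
transitivity (\sum_(p : {ffun F -> O} * O) weight p.1 * x p.2 * H p.1).
  rewrite -(pair_bigA _ (fun phi u => weight phi * x u * H phi))/=.
  apply: eq_bigr => phi _; rewrite -[LHS]mul1r -x1 mulr_suml; apply: eq_bigr => u _; ring.
pose io (p : {ffun F -> O} * O) := (upd p.1 i p.2, p.1 i).
have ioK : involutive io.
  move=> [phi u]; rewrite /io/= ffunE eqxx; congr pair; apply/ffunP => j.
  by rewrite !ffunE; case: eqP => // ->.
transitivity (\sum_(p : {ffun F -> O} * O) weight p.1 * x p.2 * H (upd p.1 i p.2)).
  rewrite (reindex io)/=; last exact/onW_bij/inv_bij.
  by apply: eq_bigr => -[phi u] _ /=; rewrite weight_upd.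
rewrite -(pair_bigA _ (fun phi u => weight phi * x u * H (upd phi i u)))/=.
by apply: eq_bigr => phi _; rewrite mulr_sumr; apply: eq_bigr => u _; rewrite mulrA.
Qed.

Lemma weight_ge0 phi : 0 <= weight phi.
Proof. exact: prodr_ge0. Qed.

Lemma sum_weight : \sum_phi weight phi = 1.
Proof.
rewrite -(bigA_distr_bigA (fun (_ : F) p => x p)) /= big1// => i _.
Qed.

Lemma sum_weight_marginal (V : finType) (pr : O -> V) (m : R) (H : {ffun F -> V} -> R) :
  (forall v, \sum_(p | pr p == v) x p = m) ->
  \sum_phi weight phi * H [ffun i => pr (phi i)] = \sum_psi m ^+ #|F| * H psi.
Proof.
move=> mE.
rewrite (partition_big (fun phi : {ffun F -> O} => [ffun i => pr (phi i)]) xpredT)//=.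
apply: eq_bigr => psi _.
rewrite (eq_bigr (fun phi => weight phi * H psi)); last by move=> phi /eqP ->.
rewrite -mulr_suml; congr (_ * _); rewrite -prodr_const.
rewrite -(eq_bigr _ (fun i _ => mE (psi i))) bigA_distr_big_dep/=.
apply: eq_bigl => phi; apply/eqP/familyP => [E i|E].
  by rewrite unfold_in -E ffunE.
by apply/ffunP => i; rewrite ffunE; have := E i; rewrite unfold_in => /eqP.
Qed.

Variables (K : bool -> O -> O -> R) (c : R).
Hypothesis K01 : forall b p q, 0 <= K b p q <= 1.
Hypothesis cutK : cut_le (fun p q => x p * x q * (K false p q - K true p q)) c.

(** The tag of an edge tells which of the two kernels it uses; this gives the hybrids between the
    two counts. *)
Definition edge_prod (r : seq (bool * (F * F))) (phi : {ffun F -> O}) : R :=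
  \prod_(t <- r) K t.1 (phi t.2.1) (phi t.2.2).

Definition count_edges (r : seq (bool * (F * F))) : R :=
  \sum_phi weight phi * edge_prod r phi.

Definition touches (i : F) (e : F * F) := (e.1 == i) || (e.2 == i).

(** Redraw the images of [i] and [j] and freeze all others. No other edge joins [i] and [j], so the
    remaining factors split into a weight in [u] and a weight in [v], both in [0, 1], and the cut
    bound applies. *)
Lemma count_edges_step (i j : F) (r : seq (bool * (F * F))) : i != j ->
  (forall t, t \in r -> ~~ (touches i t.2 && touches j t.2)) ->
  `|count_edges ((false, (i, j)) :: r) - count_edges ((true, (i, j)) :: r)| <= c.
Proof.
move=> ij rP.
pose D (phi : {ffun F -> O}) := (K false (phi i) (phi j) - K true (phi i) (phi j)) * edge_prod r phi.
have -> : count_edges ((false, (i, j)) :: r) - count_edges ((true, (i, j)) :: r) =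
    \sum_phi weight phi * D phi.
  rewrite -sumrB; apply: eq_bigr => phi _.
  by rewrite /edge_prod !big_cons/= /D mulrBl mulrBr.
rewrite (resample j) (resample i).
apply: le_trans (ler_norm_sum _ _ _) _.
rewrite -[leRHS]mul1r -sum_weight mulr_suml; apply: ler_sum => phi _.
rewrite normrM (ger0_norm (weight_ge0 _)) ler_wpM2l ?weight_ge0//.
pose al u := \prod_(t <- r | touches i t.2) K t.1 (upd phi i u t.2.1) (upd phi i u t.2.2).
pose be v := \prod_(t <- r | ~~ touches i t.2) K t.1 (upd phi j v t.2.1) (upd phi j v t.2.2).
have prod01 (P : pred (bool * (F * F))) psi :
    0 <= \prod_(t <- r | P t) K t.1 (psi t.2.1) (psi t.2.2) <= 1.
  apply/andP; split; first by apply: prodr_ge0 => t _; case/andP: (K01 t.1 (psi t.2.1) (psi t.2.2)).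
  by apply: prodr_ile1 => t _; exact: K01.
have := cut_le_weight cutK (fun u => prod01 _ (upd phi i u) : 0 <= al u <= 1)
  (fun v => prod01 _ (upd phi j v) : 0 <= be v <= 1).
congr (`|_| <= _); apply: eq_bigr => u _; rewrite mulr_sumr; apply: eq_bigr => v _.
have -> : D (upd (upd phi i u) j v) = (K false u v - K true u v) * (al u * be v).
  rewrite /D !ffunE eqxx (negbTE ij) eqxx; congr (_ * _).
  rewrite /edge_prod (bigID (fun t => touches i t.2))/=; congr (_ * _).
    rewrite /al big_seq_cond [RHS]big_seq_cond; apply: eq_bigr => t /andP[tr ti].
    have := rP _ tr; rewrite ti/= /touches negb_or => /andP[/negbTE h1 /negbTE h2].
    by rewrite !ffunE h1 h2.
  rewrite /be; apply: eq_bigr => t; rewrite /touches negb_or => /andP[/negbTE h1 /negbTE h2].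
  by rewrite !ffunE h1 h2.
ring.
Qed.

Lemma count_edges_perm r s : perm_eq r s -> count_edges r = count_edges s.
Proof. by move=> rs; apply: eq_bigr => phi _; rewrite /edge_prod (perm_big s). Qed.

(** Edges are switched from one kernel to the other one by one. Uniqueness and the asymmetry of [lt]
    ensure that no other edge of the list has the same two ends. *)
Lemma count_edges_dist (lt : rel F) (es : seq (F * F)) : 
  (forall i j, lt i j -> ~~ lt j i) -> uniq es -> (forall e, e \in es -> lt e.1 e.2) ->
  `|count_edges [seq (false, e) | e <- es] - count_edges [seq (true, e) | e <- es]|
    <= (size es)%:R * c.
Proof.
move=> lt_asym.
suff H (es1 es2 : seq (F * F)) : uniq (es1 ++ es2) -> (forall e, e \in es1 ++ es2 -> lt e.1 e.2) ->
    `|count_edges ([seq (false, e) | e <- es1] ++ [seq (true, e) | e <- es2]) -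
      count_edges [seq (true, e) | e <- es1 ++ es2]| <= (size es1)%:R * c.
  by move=> ues ltes; have := H es [::]; rewrite !cats0; apply.
elim: es1 es2 => [|[i j] es1 IH] es2; first by rewrite subrr normr0 mul0r.
move=> U L; have lij : lt i j by apply: (L (i, j)); rewrite inE eqxx.
have irr k : lt k k = false by apply/negP => h; have := lt_asym _ _ h; rewrite h.
have ij : i != j by apply: contraTneq lij => ->; rewrite irr.
have p1 : perm_eq ((i, j) :: es1 ++ es2) (es1 ++ (i, j) :: es2).
  by rewrite -cat1s -[(i, j) :: es2]cat1s perm_catCA.
have U' : uniq (es1 ++ (i, j) :: es2) by rewrite -(perm_uniq p1).
have L' e : e \in es1 ++ (i, j) :: es2 -> lt e.1 e.2 by rewrite -(perm_mem p1); exact: L.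
have h1 := IH _ U' L'.
have -> : count_edges [seq (true, e) | e <- ((i, j) :: es1) ++ es2] =
    count_edges [seq (true, e) | e <- es1 ++ (i, j) :: es2].
  by apply: count_edges_perm; exact: perm_map.
apply: le_trans (ler_distD (count_edges ([seq (false, e) | e <- es1] ++
  [seq (true, e) | e <- (i, j) :: es2])) _ _) _.
rewrite /= -natr1 mulrDl mul1r addrC; apply: lerD => //.
have -> : count_edges ([seq (false, e) | e <- es1] ++
    (true, (i, j)) :: [seq (true, e) | e <- es2]) =
    count_edges ((true, (i, j)) :: [seq (false, e) | e <- es1] ++ [seq (true, e) | e <- es2]).
  by apply: count_edges_perm; rewrite -cat1s -[(true, _) :: _ ++ _]cat1s perm_catCA.
apply: count_edges_step => // t; rewrite mem_cat => /orP tin.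
have [e ee te] : exists2 e, e \in es1 ++ es2 & t.2 = e.
  by case: tin => /mapP[e ee ->]; exists e => //; rewrite mem_cat ee ?orbT.
have le : lt e.1 e.2 by apply: L; rewrite inE ee orbT.
rewrite te /touches; apply/negP => /andP[].
move: U; rewrite /= => /andP[/negP nij _].
case: e ee te le => a b ab _ /= le /orP[]/eqP ai /orP[]/eqP bj.
- by move: ij; rewrite -ai -bj eqxx.
- by apply: nij; rewrite -ai -bj.
- by have := lt_asym _ _ lij; rewrite -ai -bj le.
- by move: ij; rewrite -ai -bj eqxx.
Qed.

End ProductWeights.

Section Counting.
Variables (R : realType) (F G G' : sgraph).

(** Each edge is listed once, in the direction of increasing rank, as [count_edges_dist]
    requires. *)
Definition oriented_edges : seq (F * F) :=
  [seq e <- enum {: F * F} | (enum_rank e.1 < enum_rank e.2)%N && adj e.1 e.2].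

Lemma sum_hom (H : sgraph) (m : R) : m = #|H|%:R^-1 ->
  \sum_(psi : {ffun F -> H}) m ^+ #|F| *
    \prod_(e <- oriented_edges) (adj (psi e.1) (psi e.2))%:R = hom_density R F H.
Proof.
move=> ->; rewrite -mulr_sumr [LHS]mulrC /hom_density natrX exprVn; congr (_ / _).
rewrite /Defs.hom -sum1_card natr_sum [RHS]big_mkcond/=; apply: eq_bigr => psi _.
rewrite inE; case: ifPn => [/forallP hpsi|].
  rewrite big_seq big1// => e; rewrite mem_filter => /andP[/andP[_ e12] _].
  by have /forallP/(_ e.2)/implyP/(_ e12) -> := hpsi e.1.
move=> /forallPn[a /forallPn[b]]; rewrite negb_imply => /andP[ab nab].
wlog lt_ab : a b ab nab / (enum_rank a < enum_rank b)%N.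
  move=> W; case: (ltngtP (enum_rank a) (enum_rank b)) => [lt|gt|eq].
  - exact: (W a b).
  - by apply: (W b a) => //; rewrite adj_sym.
  - by move: ab; rewrite (enum_rank_inj (val_inj eq)) adj_irr.
rewrite (big_rem (a, b))/=; last by rewrite mem_filter lt_ab ab mem_enum.
by rewrite (negbTE nab) mul0r.
Qed.

(** Map [F] into the set of pairs: the two densities are the counts with all edges read in the first
    or in the second coordinate, and [overlay_cut] is a cut bound for the difference of these
    kernels. *)
Lemma hom_density_dist (X : G -> G' -> R) : fractional_overlay X ->
  `|hom_density R F G - hom_density R F G'| <=
    (size oriented_edges)%:R * overlay_cut X.
Proof.
move=> [X0 Xr Xc]; pose x (p : G * G') := X p.1 p.2.
pose K b (p q : G * G') : R := if b then (adj p.2 q.2)%:R else (adj p.1 q.1)%:R.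
have K01 b p q : 0 <= K b p q <= 1 by case: b; exact: adj01.
have x0 p : 0 <= x p by exact: X0.
have xr v : \sum_(p | p.1 == v) x p = #|G|%:R^-1.
  rewrite -(Xr v) (reindex (fun u => (v, u)))/=; first by apply: eq_bigl => u; rewrite eqxx.
  by exists snd => [u _//|[a b]]; rewrite inE/= => /eqP ->.
have xc v : \sum_(p | p.2 == v) x p = #|G'|%:R^-1.
  rewrite -(Xc v) (reindex (fun u => (u, v)))/=; first by apply: eq_bigl => u; rewrite eqxx.
  by exists fst => [u _//|[a b]]; rewrite inE/= => /eqP ->.
have x1 : \sum_p x p = 1.
  rewrite -(pair_bigA _ X)/= (eq_bigr _ (fun i _ => Xr i)) sumr_const -[LHS]mulr_natr mulVf//.
  by rewrite pnatr_eq0 -lt0n vertex_gt0.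
have cutK : cut_le (fun p q => x p * x q * (K false p q - K true p q)) (overlay_cut X).
  move=> S T; rewrite /overlay_cut.
  apply: le_trans (le_bigmax 0 _ S); apply: le_trans (le_bigmax 0 _ T).
  rewrite le_eqVlt; apply/orP; left; exact/eqP.
have E b (H : sgraph) (pr : G * G' -> H) : (forall v, \sum_(p | pr p == v) x p = #|H|%:R^-1) ->
    (forall p q, K b p q = (adj (pr p) (pr q))%:R) ->
    count_edges x K [seq (b, e) | e <- oriented_edges] = hom_density R F H.
  move=> prE KE; rewrite -(sum_hom erefl) -(sum_weight_marginal _ prE).
  apply: eq_bigr => phi _; congr (_ * _); rewrite /edge_prod big_map.
  by apply: eq_bigr => e _; rewrite /= KE !ffunE.
rewrite -(E false _ fst xr)// -(E true _ snd xc)//.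
apply: (count_edges_dist x1 x0 K01 cutK (lt := fun i j : F => (enum_rank i < enum_rank j)%N)).
- by move=> i j; rewrite -leqNgt; exact: ltnW.
- exact/filter_uniq/enum_uniq.
- by move=> e; rewrite mem_filter => /andP[/andP[]].
Qed.

End Counting.

(** * Convergent sequences and the cut distance *)

Lemma hom_density_iso (R : realType) (F F' H : sgraph) : sg_iso F F' ->
  hom_density R F H = hom_density R F' H.
Proof.
move=> [phi phi_bij phi_adj]; have [psi phiK psiK] := phi_bij.
have cF : #|F| = #|F'| by exact: bij_eq_card phi_bij.
rewrite /hom_density cF; congr (_%:R / _); rewrite /Defs.hom -sum1_card -[RHS]sum1_card.
rewrite [LHS](reindex (fun g : {ffun F' -> H} => [ffun i => g (phi i)]))/=; last first.
  exists (fun g : {ffun F -> H} => [ffun i => g (psi i)]) => g _; apply/ffunP => i;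
    by rewrite !ffunE ?psiK ?phiK.
apply: eq_bigl => g; rewrite !inE; apply/forallP/forallP => gh i; apply/forallP => j.
  have /forallP/(_ (psi j)) := gh (psi i).
  by rewrite !ffunE !psiK -phi_adj !psiK.
by rewrite !ffunE -phi_adj; have /forallP := gh (phi i); apply.
Qed.

(** Up to isomorphism there are countably many graphs, which makes diagonal extraction over all [F]
    possible. *)
Lemma rel_graph_iso (F : sgraph) : exists (k : nat) (E : {set 'I_k.+1 * 'I_k.+1}),
  sg_iso (rel_graph (ltn0Sn k) E) F.
Proof.
case Fk : #|F| => [|k]; first by have := vertex_gt0 F; rewrite Fk.
pose x : {ffun 'I_k.+1 -> F} := [ffun i => enum_val (cast_ord (esym Fk) i)].
exists k, (pull_edges x), x; last by move=> i j; rewrite [RHS]rel_adj_pull.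
apply: inj_card_bij; last by rewrite card_ord Fk.
by move=> i j; rewrite !ffunE => /enum_val_inj/cast_ord_inj.
Qed.

Lemma hom_density01 (R : realType) (F G : sgraph) : 0 <= hom_density R F G <= 1.
Proof.
rewrite /hom_density divr_ge0//= ler_pdivrMr ?ltr0n ?expn_gt0 ?vertex_gt0// mul1r ler_nat.
by rewrite /Defs.hom -card_ffun max_card.
Qed.

Lemma overlay_cut_lt (R : realType) (G G' : sgraph) (e : R) : cut_distance R G G' < e ->
  exists2 X : G -> G' -> R, fractional_overlay X & overlay_cut X < e.
Proof.
move=> de; apply: contrapT => nX; move: de; apply/negP; rewrite -leNgt.
apply: lb_le_inf.
  (* The product overlay shows that the infimum is over a nonempty set. *)
  pose X (_ : G) (_ : G') : R := #|G|%:R^-1 * #|G'|%:R^-1.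
  exists (overlay_cut X), X => //; rewrite /X; split=> [i u|i|u]; first by rewrite mulr_ge0// invr_ge0.
    by rewrite sumr_const -[LHS]mulr_natr mulfVK// pnatr_eq0 -lt0n vertex_gt0.
  rewrite sumr_const mulrC -[LHS]mulr_natr mulfVK// pnatr_eq0 -lt0n.
  exact: vertex_gt0.
by move=> _ [X oX <-]; rewrite leNgt; apply/negP => h; apply: nX; exists X.
Qed.

Lemma convergent_cut_continuity (R : realType) (f : sgraph -> R) :
  (forall G_ : nat -> sgraph, convergent R G_ ->
    (fun n => #|G_ n|) @ \oo --> \oo -> cvgn (fun n => f (G_ n))) ->
  forall eps : R, 0 < eps ->
  exists2 eps0 : R, 0 < eps0 & exists2 n0 : nat, (0 < n0)%N &
    forall G1 G2 : sgraph, (n0 <= #|G1|)%N -> (n0 <= #|G2|)%N ->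
      cut_distance R G1 G2 < eps0 -> `|f G1 - f G2| < eps.
Proof.
move=> Hc eps eps0; apply: contrapT => nH.
have bad n : exists p : sgraph * sgraph, [/\ (n.+1 <= #|p.1|)%N, (n.+1 <= #|p.2|)%N,
    cut_distance R p.1 p.2 < n.+1%:R^-1 & eps <= `|f p.1 - f p.2|].
  apply: contrapT => np; apply: nH; exists n.+1%:R^-1; first by rewrite invr_gt0.
  exists n.+1 => // G1 G2 h1 h2 d; rewrite ltNge; apply/negP => h.
  by apply: np; exists (G1, G2).
have [P HP] := choice bad.
pose u i n : R := if unpickle i is Some t then
  let: existT k E := t : {k : nat & {set 'I_k.+1 * 'I_k.+1}} in
  hom_density R (rel_graph (ltn0Sn k) E) (P n).1 else 0.
have ub i : exists M, forall n, `|u i n| <= M.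
  exists 1 => n; rewrite /u; case: unpickle => [[k E]|]; last by rewrite normr0.
  by have /andP[? ?] := hom_density01 R (rel_graph (ltn0Sn k) E) (P n).1; rewrite ger0_norm.
have [phi [phin ucvg]] := diagonal_subsequence ub.
(* The two sequences interleaved. The even terms converge by extraction; the odd ones follow by the
   counting lemma, since the cut distances tend to 0. *)
pose H m := if odd m then (P (phi m./2)).2 else (P (phi m./2)).1.
have cG1 F : cvgn (fun n => hom_density R F (P (phi n)).1).
  have [k [E FE]] := rel_graph_iso F.
  rewrite (_ : (fun n => _) = (fun n => u (pickle (Tagged (fun k => {set 'I_k.+1 * 'I_k.+1}) E)) (phi n))).
    exact: ucvg.
  by apply/funext => n; rewrite /u pickleK/= (hom_density_iso _ _ FE).
have cH : convergent R H.
  move=> F; have /cvgn_leP cF := cG1 F.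
  apply/cvg_ex; exists (limn (fun n => hom_density R F (P (phi n)).1)).
  apply/cvgn_leP => e e0; have e20 : 0 < e / 2 by rewrite divr_gt0.
  have [N HN] := cF _ e20.
  pose s : R := (size (oriented_edges F))%:R.
  exists (maxn N (Num.bound ((e / 2)^-1 * s))).*2 => m mN.
  have : (maxn N (Num.bound ((e / 2)^-1 * s)) <= m./2)%N.
    by rewrite -(doubleK (maxn _ _)); exact: half_leq.
  rewrite geq_max => /andP[Nm bm].
  have h1 := HN _ Nm; rewrite /H; case: (odd m); last by apply: le_trans h1 _; lra.
  have [_ _ dP _] := HP (phi m./2).
  have [X oX Xl] := overlay_cut_lt dP.
  have h2 := hom_density_dist F oX.
  apply: le_trans (ler_distD (hom_density R F (P (phi m./2)).1) _ _) _.
  rewrite [leRHS](splitr e); apply: lerD => //; rewrite distrC.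
  apply: le_trans h2 _; rewrite -/s.
  apply: (@le_trans _ _ (s * (phi m./2).+1%:R^-1)); first by rewrite ler_wpM2l// ltW.
  rewrite ler_pdivrMr// -ler_pdivrMl//.
  apply: le_trans (ltW (archi_boundP _)) _; first by rewrite mulr_ge0// invr_ge0 ltW.
  by rewrite ler_nat (leq_trans bm)// (leq_trans (phin _)).
have Hoo : (fun n => #|H n|) @ \oo --> \oo.
  apply/cvgnyPge => A; exists A.*2 => // m /= Am.
  have Am2 : (A <= m./2)%N by rewrite -(doubleK A); exact: half_leq.
  have [s1 s2 _ _] := HP (phi m./2).
  have h : (A <= (phi m./2).+1)%N by rewrite (leq_trans Am2)// (leq_trans (phin _)).
  by rewrite /H; case: odd; [exact: leq_trans s2|exact: leq_trans s1].
have e20 : 0 < eps / 2 by rewrite divr_gt0.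
have [N HN] := cvgn_cauchy (Hc _ cH Hoo) e20.
(* Two consecutive terms are the two members of one bad pair, whose values differ by at least
   [eps]. *)
have := HN N.*2 N.*2.+1; rewrite -addnn leq_addr (leq_trans (leq_addr _ _) (leqnSn _)).
move=> /(_ isT isT); rewrite addnn /H/= odd_double/= doubleK uphalf_double.
have [_ _ _ h1] := HP (phi N); move=> /(le_trans h1); lra.
Qed.

Theorem theorem6p1 (R : realType) (f : sgraph -> R)
    (f_param : graph_parameter f) (f_bounded : bounded_parameter f) :
  [<-> (* (a) *)
       testable f;
       (* (b) *)
       forall eps : R, 0 < eps ->
       exists (k : nat) (k_gt0 : (0 < k)%N),
         forall G : sgraph, (k <= #|G|)%N ->
           `|f G - E_ksubset (fun S : ksubset k G => f (induced_sgraph k_gt0 S))|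
             <= eps;
       (* (c) *)
       forall G_ : nat -> sgraph, convergent R G_ ->
         (fun n => #|G_ n|) @ \oo --> \oo ->
         cvgn (fun n => f (G_ n));
       (* (d) *)
       exists2 fcheck : graphon R -> R, cut_continuous fcheck &
         forall eps : R, 0 < eps ->
         exists N : nat, forall G : sgraph, (N <= #|G|)%N ->
         forall l : 'I_#|G| -> G, bijective l ->
           `|fcheck (graphon_of R l) - f G| < eps;
       (* (e) *)
       forall eps : R, 0 < eps ->
       exists2 eps0 : R, 0 < eps0 &
       exists2 n0 : nat, (0 < n0)%N &
         forall G1 G2 : sgraph, (n0 <= #|G1|)%N -> (n0 <= #|G2|)%N ->
           cut_distance R G1 G2 < eps0 -> `|f G1 - f G2| < eps].
Proof.
have ab := testable_expectation f_bounded.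
have bc := expectation_convergent f_param f_bounded.
have ce := @convergent_cut_continuity R f.
have [M fM] := f_bounded.
have M0 : 0 < `|M| + 1 by rewrite ltr_wpDl.
have {}fM G : `|f G| <= `|M| + 1.
  by apply: le_trans (fM G) _; rewrite (le_trans (ler_norm M))// lerDl.
(* The listed order has (d) before (e): (c) gives (d) through (e), (d) gives (e) through (a), (b)
   and (c), and (e) gives (a) through (d). *)
tfae; [exact: ab|exact: bc| | |].
- by move=> /ce; exact: (cut_continuous_extension M0 fM).
- by move=> [fcheck fc1 fc2]; apply/ce/bc/ab; exact: functional_testable fc1 fc2 f_param.
- move=> /(cut_continuous_extension M0 fM)[fcheck fc1 fc2].
  exact: functional_testable fc1 fc2 f_param.
Qed.
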